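(* There is an absolute constant $C$ such that the following holds. Let $d\ge4$, $\tau\in S_d$, let $R\in\mathbb N_+$ satisfy $\min_{1\le i\le d} n_i\ge R^2>\max_{1\le j\le d} r_j$ and $\min_{1\le j\le d} r_j\ge R$, and let $\vec{\mathbf u}\in\mathcal U^d_{\vec r,\vec n,\tau}$. Suppose there is a constant $\sigma>0$ such that for any $i_1,i_2,i_3,i_4\in\{1,\dots,d\}$ for which $(i_1,i_2,i_3,i_4)$ is of the correct order with respect to $\tau$ and any $y_i\in\{1,\dots,n_i\}$, $i\in\{1,\dots,d\}\setminus\{i_1,i_2,i_3,i_4\}$, the matrix $M_{(i_1,i_3),(i_2,i_4)}$ formed from $\varphi(\vec{\mathbf u},\tau)$ satisfies $\sigma_{R^4}(M_{(i_1,i_3),(i_2,i_4)})\ge\sigma$. Suppose that each observation of an entry of $\mathbf T=\varphi(\vec{\mathbf u},\tau)$ is contaminated by additive noise distributed as $\mathcal N(0,\sigma_e^2)$, $\sigma_e>0$, independently across observations. Let $n_{\max}=\max_{1\le i\le d} n_i$. Then for any $T<\frac{\sigma}{\sigma_e}$, the probability that the Ring Recovery Algorithm, run with the integer $R$ and the noisy observations, returns an incorrect ordering (i.e. does not return an element of $\mathcal CS^d_{\mathrm{TR}}(\tau)$) is smaller than or equal to $$C\,d\log d\cdot\exp\left(-\tfrac18\max\{T-4n_{\max},0\}^2\right).$$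
   Context: **Tensor ring format.** $d$ is a positive integer, $S_d$ is the group of permutations of $\{1,\dots,d\}$, and $\vec n=(n_1,\dots,n_d)$, $\vec r=(r_1,\dots,r_d)$ are vectors of positive integers. Arguments of $\tau$ and subscripts of $r$ are read modulo $d$ (so $\tau(d+1)=\tau(1)$, $r_{d+1}=r_1$). For $\tau\in S_d$ let $\mathcal U^d_{\vec r,\vec n,\tau}=\bigoplus_{i=1}^d\mathbb R^{r_{\tau^{-1}(i)}\times n_i\times r_{\tau^{-1}(i)+1}}$. For $\vec{\mathbf u}=(\mathbf u^{[1]},\dots,\mathbf u^{[d]})$ in it, write $\mathbf u^{[i]}(x)=\mathbf u^{[i]}(:,x,:)\in\mathbb R^{r_{\tau^{-1}(i)}\times r_{\tau^{-1}(i)+1}}$. The tensor $\varphi(\vec{\mathbf u},\tau)\in\mathbb R^{n_1\times\cdots\times n_d}$ has entries $$\varphi(\vec{\mathbf u},\tau)(x_1,\dots,x_d)=\mathrm{tr}\big(\mathbf u^{[\tau(1)]}(x_{\tau(1)})\,\mathbf u^{[\tau(2)]}(x_{\tau(2)})\cdots\mathbf u^{[\tau(d)]}(x_{\tau(d)})\big).$$ **Equivalence class.** $\mathcal CS^d_{\mathrm{TR}}(\tau)=\{\tau\circ\alpha^k\circ\beta^\ell:\ k\in\{0,1,\dots,d-1\},\ \ell\in\{0,1\}\}$, where $\alpha(j)=j+1$ (mod $d$) and $\beta(j)=d+1-j$. **Correct order.** For distinct $i_1,i_2,i_3,i_4\in\{1,\dots,d\}$, the tuple $(i_1,i_2,i_3,i_4)$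 is of the correct order with respect to $\tau$ if there is $s\in\{1,2,3,4\}$ with $\tau^{-1}(i_s)<\tau^{-1}(i_{s+1})<\tau^{-1}(i_{s+2})<\tau^{-1}(i_{s+3})$ or $\tau^{-1}(i_s)>\tau^{-1}(i_{s+1})>\tau^{-1}(i_{s+2})>\tau^{-1}(i_{s+3})$, the subscripts of $i$ being read modulo 4. **Matricizations.** Given distinct $i_1,\dots,i_4$ and fixed $y_i\in\{1,\dots,n_i\}$ for $i\notin\{i_1,\dots,i_4\}$, let $A(x_{i_1},x_{i_2},x_{i_3},x_{i_4})$ be the entry of the tensor whose $i_s$-th coordinate is $x_{i_s}$ ($1\le s\le4$) and whose $i$-th coordinate is $y_i$ for all other $i$. Define $M_{(i_1,i_2),(i_3,i_4)}\in\mathbb R^{(n_{i_1}n_{i_2})\times(n_{i_3}n_{i_4})}$, $M_{(i_1,i_3),(i_2,i_4)}\in\mathbb R^{(n_{i_1}n_{i_3})\times(n_{i_2}n_{i_4})}$, $M_{(i_1,i_4),(i_2,i_3)}\in\mathbb R^{(n_{i_1}n_{i_4})\times(n_{i_2}n_{i_3})}$ by $M_{(i_1,i_2),(i_3,i_4)}((x_{i_1},x_{i_2}),(x_{i_3},x_{i_4}))=M_{(i_1,i_3),(i_2,i_4)}((x_{i_1},x_{i_3}),(x_{i_2},x_{i_4}))=M_{(i_1,i_4),(i_2,i_3)}((x_{i_1},x_{i_4}),(x_{i_2},x_{i_3}))=A(x_{i_1},x_{i_2},x_{i_3},x_{i_4})$. $\sigma_k(M)$ denotes the $k$-th largest singular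 value of $M$. **Four-Index Algorithm.** Input: $i_1,i_2,i_3,i_4$, an integer $R\in\mathbb N_+$, and an oracle for the entries of $\mathbf T$. Sample $y_i\in\{1,\dots,n_i\}$ for $i\notin\{i_1,\dots,i_4\}$ (in any way independent of the noise); form the three matrices above from the (here noisy) observed entries of $\mathbf T$. Compare $a=\sigma_{R^4}(M_{(i_1,i_2),(i_3,i_4)})$, $b=\sigma_{R^4}(M_{(i_1,i_3),(i_2,i_4)})$, $c=\sigma_{R^4}(M_{(i_1,i_4),(i_2,i_3)})$. If $a>\max\{b,c\}$ return $(i_1,i_3,i_2,i_4)$; if $b>\max\{a,c\}$ return $(i_1,i_2,i_3,i_4)$; if $c>\max\{a,b\}$ return $(i_1,i_2,i_4,i_3)$. (If there is a tie and no case applies, this is counted as an incorrect output, and the whole recovery is counted as incorrect.) **Ring Recovery Algorithm.** Input: $R\in\mathbb N_+$ and an oracle for the entries of $\mathbf T$; every call to the Four-Index Algorithm makes its own observations. Two 4-tuples are called equivalent if they differ by a rotation and/or a reversal. 1. Let $(i_1,i_2,i_3,i_4)$ be the output of the Four-Index Algorithm on $1,2,3,4$. 2. For $t=4,\dots,d-1$: set $j_{\min}=1$, $j_{\max}=t+1$. While $j_{\max}-j_{\min}\ge2$: (i) if $j_{\max}-j_{\min}\ge3$, set $j_1=j_{\min}$, $j_2=j_{\min}+\lfloor\frac13(j_{\max}-j_{\min})\rfloor$, $j_3=j_{\min}+\lfloor\frac23(j_{\max}-j_{\min})\rfloor$; else if $j_{\max}\le t$, set $j_1=j_{\min}$, $j_2=j_{\min}+1$,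 $j_3=j_{\max}$; else set $j_1=1$, $j_2=t-1$, $j_3=t$; (ii) run the Four-Index Algorithm on $t+1,i_{j_1},i_{j_2},i_{j_3}$; if its output is equivalent to $(i_{j_1},t+1,i_{j_2},i_{j_3})$, set $j_{\min}=j_1$, $j_{\max}=j_2$; else if it is equivalent to $(i_{j_1},i_{j_2},t+1,i_{j_3})$, set $j_{\min}=j_2$, $j_{\max}=j_3$; else set $j_{\min}=j_3$. After the while loop, replace $(i_1,\dots,i_t)$ by $(i_1,\dots,i_{j_{\min}},t+1,i_{j_{\max}},\dots,i_t)$ (if $j_{\max}=t+1$, then $t+1$ is appended at the end). 3. Return $\tau'\in S_d$ with $\tau'(j)=i_j$ for $1\le j\le d$. *)

(* Defs.v *)
From HB Require Import structures.
From mathcomp Require Import all_boot all_order all_fingroup all_algebra.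
From mathcomp Require Import all_classical all_reals all_analysis.

Set Implicit Arguments.
Unset Strict Implicit.
Unset Printing Implicit Defensive.

Import Order.TTheory GRing.Theory Num.Theory.

Local Open Scope classical_set_scope.
Local Open Scope ring_scope.

(* The order of the tensors is d = d'.+1, and {1, ..., d} is represented by    *)
(* 'I_d = {0, ..., d - 1}; ordS is the successor modulo d.                     *)

Section Tensors.
Variables (K : realType) (d' : nat).
Local Notation d := d'.+1.

Definition multi_index (n : 'I_d -> nat) := {dffun forall i : 'I_d, 'I_(n i)}.

(* u i x is the matrix u^[i](x) = u^[i](:, x, :). *)
Definition ring_cores (r n : 'I_d -> nat) (tau : {perm 'I_d}) : Type :=
  forall i : 'I_d,
    'I_(n i) -> 'M[K]_(r ((tau^-1)%g i), r (ordS ((tau^-1)%g i))).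

Lemma iter_ordS (j : 'I_d) : iter d (@ordS d) j = j.
Proof.
have H k : val (iter k (@ordS d) j) = ((j + k) %% d)%N.
  elim: k => [|k IHk]; first by rewrite addn0 modn_small.
  by rewrite iterS /= IHk -[X in (X %% _)%N]addn1 modnDml addn1 addnS.
by apply: val_inj; rewrite H modnDr modn_small.
Qed.

(* The product A_j A_(j+1) ... A_(j+k-1), subscripts modulo d. *)
Fixpoint chain_mx (r : 'I_d -> nat) (A : forall j : 'I_d, 'M[K]_(r j, r (ordS j)))
    (j : 'I_d) (k : nat) : 'M[K]_(r j, r (iter k (@ordS d) j)) :=
  if k is k'.+1 then chain_mx A j k' *m A (iter k' (@ordS d) j) else 1%:M.

Definition ring_trace (r : 'I_d -> nat)
    (A : forall j : 'I_d, 'M[K]_(r j, r (ordS j))) : K :=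
  \tr (castmx (erefl, congr1 r (iter_ordS ord0)) (chain_mx A ord0 d)).

(* The cast only identifies tau^-1 (tau j) with j in the sizes. *)
Definition tr_tensor (r n : 'I_d -> nat) (tau : {perm 'I_d})
    (u : ring_cores r n tau) (x : multi_index n) : K :=
  ring_trace (fun j : 'I_d =>
    castmx (congr1 r (permK tau j), congr1 (fun i => r (ordS i)) (permK tau j))
           (u (tau j) (x (tau j)))).

(* The class of tau, in which (tau o alpha^k o beta^l) j =                     *)
(* tau (alpha^k (beta^l j)); in {perm _} the left factor is applied first.     *)
Definition ring_class (tau : {perm 'I_d}) : {set {perm 'I_d}} :=
  let alpha := perm (@ordS_inj d) in
  let beta := perm (@rev_ord_inj d) in
  [set (beta ^+ nat_of_ord l * alpha ^+ nat_of_ord k * tau)%g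
     | k in [set: 'I_d], l in [set: 'I_2]].

Definition correct_order (tau : {perm 'I_d}) (i1 i2 i3 i4 : 'I_d) : bool :=
  uniq [:: i1; i2; i3; i4] &&
  [exists s : 'I_4,
     let q := [seq val ((tau^-1)%g i) | i <- rot s [:: i1; i2; i3; i4]] in
     sorted ltn q || sorted gtn q].

(* The inverse of mxvec_index. *)
Definition index_pair (m n : nat) (k : 'I_(m * n)) : 'I_m * 'I_n :=
  enum_val (cast_ord (esym (mxvec_cast m n)) k).

Definition set_coords (n : 'I_d -> nat) (y : multi_index n) (a b c e : 'I_d)
    (xa : 'I_(n a)) (xb : 'I_(n b)) (xc : 'I_(n c)) (xe : 'I_(n e)) :
    multi_index n :=
  let upd := @eqtype.dfwith _ (fun i => 'I_(n i)) in
  finfun (upd (upd (upd (upd (fun i => y i) a xa) b xb) c xc) e xe).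

(* M_((a, b), (c, e)); the coordinates of y at a, b, c and e are not used. *)
Definition matricization (n : 'I_d -> nat) (T : multi_index n -> K)
    (y : multi_index n) (a b c e : 'I_d) : 'M[K]_(n a * n b, n c * n e) :=
  \matrix_(k, l)
    T (set_coords y (index_pair k).1 (index_pair k).2
                    (index_pair l).1 (index_pair l).2).

End Tensors.

Section SingularValues.
Variable K : realType.

(* The eigenvalues of A with their multiplicities, in decreasing order. This   *)
(* list exists, and is then unique, as soon as the characteristic polynomial   *)
(* of A splits over K; in particular it exists when A is symmetric.            *)
Definition eigenvalues (n : nat) (A : 'M[K]_n) : seq K :=
  xget [::] [set s | sorted >=%R s /\
                     char_poly A = \prod_(x <- s) ('X - x%:P)].

(* sigma_k(M), the k-th largest singular value, for 1 <= k <= minn m n. *)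
Definition singular_value (m n : nat) (k : nat) (M : 'M[K]_(m, n)) : K :=
  nth 0 [seq Num.sqrt x | x <- eigenvalues (M^T *m M)] k.-1.

End SingularValues.

Section Algorithms.
Variables (K : realType) (d' : nat).
Local Notation d := d'.+1.

(* T gives the observed entries; None is returned in case of a tie. *)
Definition four_index (n : 'I_d -> nat) (R : nat) (T : multi_index n -> K)
    (y : multi_index n) (i1 i2 i3 i4 : 'I_d) : option (seq 'I_d) :=
  let a := singular_value (R ^ 4) (matricization T y i1 i2 i3 i4) in
  let b := singular_value (R ^ 4) (matricization T y i1 i3 i2 i4) in
  let c := singular_value (R ^ 4) (matricization T y i1 i4 i2 i3) in
  if Num.max b c < a then Some [:: i1; i3; i2; i4]
  else if Num.max a c < b then Some [:: i1; i2; i3; i4]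
  else if Num.max a b < c then Some [:: i1; i2; i4; i3]
  else None.

Definition equiv_tuple (s t : seq 'I_d) : bool :=
  [exists k : 'I_4, (t == rot k s) || (t == rot k (rev s))].

Local Open Scope nat_scope.

(* The positions jmin, jmax, j1, j2, j3 and the times t are 1-based, as in     *)
(* (i_1, ..., i_t).                                                            *)
Definition probes (t jmin jmax : nat) : nat * nat * nat :=
  if 3 <= jmax - jmin then
    (jmin, jmin + (jmax - jmin) %/ 3, jmin + (2 * (jmax - jmin)) %/ 3)
  else if jmax <= t then (jmin, jmin.+1, jmax)
  else (1, t.-1, t).

(* F c i1 i2 i3 i4 is the output of the Four-Index Algorithm on (i1,i2,i3,i4)  *)
(* when it is called for the (c+1)-st time in the run of the Ring Recovery     *)
(* Algorithm. None means that some call ended with a tie.                      *)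
Variable F : nat -> 'I_d -> 'I_d -> 'I_d -> 'I_d -> option (seq 'I_d).

(* The while loop, for the insertion of v = t + 1 into s = (i_1, ..., i_t); c  *)
(* is the number of calls made so far. Whatever the answers of F, the loop     *)
(* stops after fewer than 2 * t rounds: jmax - jmin decreases in each round    *)
(* that does not turn jmax = t + 1 into a jmax <= t, and the latter happens at *)
(* most once.                                                                  *)
Fixpoint locate (t : nat) (s : seq 'I_d) (v : 'I_d) (fuel c jmin jmax : nat) :
    option (nat * (nat * nat)) :=
  if jmax - jmin < 2 then Some (c, (jmin, jmax)) else
  if fuel is fuel'.+1 then
    let: (j1, j2, j3) := probes t jmin jmax in
    let i j := nth v s j.-1 in
    if F c v (i j1) (i j2) (i j3) is Some q then
      if equiv_tuple q [:: i j1; v; i j2; i j3] then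
        locate t s v fuel' c.+1 j1 j2
      else if equiv_tuple q [:: i j1; i j2; v; i j3] then
        locate t s v fuel' c.+1 j2 j3
      else locate t s v fuel' c.+1 j3 jmax
    else None
  else None.

(* The element t + 1 of {1, ..., d} is inord t. *)
Definition insertion_step (st : option (nat * seq 'I_d)) (t : nat) :
    option (nat * seq 'I_d) :=
  if st is Some (c, s) then
    if locate t s (inord t) (2 * t) c 1 t.+1 is Some (c', (jmin, jmax)) then
      Some (c', take jmin s ++ inord t :: drop jmax.-1 s)
    else None
  else None.

(* Only a list which enumerates {1, ..., d} without repetition defines a       *)
(* permutation; such a tau' is unique.                                         *)
Definition ring_recovery : option {perm 'I_d} :=
  let start := omap (fun q => (1, q))
                    (F 0 (inord 0) (inord 1) (inord 2) (inord 3)) in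
  if foldl insertion_step start (iota 4 (d - 4)) is Some (_, s) then
    [pick tau' : {perm 'I_d} | [seq tau' j | j <- enum 'I_d] == s]
  else None.

End Algorithms.

Section Independence.
Context {K : realType} {disp : measure_display} {Omega : measurableType disp}.
Variable P : probability Omega K.

Definition mutually_independent (I : eqType) (X : I -> Omega -> K) : Prop :=
  forall (s : seq I) (B : I -> set K), uniq s ->
    (forall i, measurable (B i)) ->
    P (\big[setI/setT]_(i <- s) (X i @^-1` B i)) =
    (\prod_(i <- s) P (X i @^-1` B i))%E.

(* The sigma-algebra generated by the family X, whose values lie in a space S  *)
(* carrying the sigma-algebra G.                                               *)
Definition sigma_of (I S : Type) (G : set (set S)) (X : I -> Omega -> S) :
    set (set Omega) :=
  <<s [set A | exists i, exists2 B, G B & A = X i @^-1` B] >>.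

Definition independent_algebras (G H : set (set Omega)) : Prop :=
  forall A B, G A -> H B -> P (A `&` B) = (P A * P B)%E.

End Independence.

(* One run of the Ring Recovery Algorithm: in the (c+1)-st call, on the tuple  *)
(* q, of the Four-Index Algorithm, Y c q supplies the sampled y_i, and the     *)
(* entry x is observed as T x + Z c x. All three matrices of a call are formed *)
(* from the same observations.                                                 *)
Definition noisy_ring_recovery (K : realType) (d' : nat) (n : 'I_d'.+1 -> nat)
    (R : nat) (T : multi_index n -> K) (Z : nat -> multi_index n -> K)
    (Y : nat -> 4.-tuple 'I_d'.+1 -> multi_index n) : option {perm 'I_d'.+1} :=
  ring_recovery (fun c i1 i2 i3 i4 =>
    four_index R (fun x => T x + Z c x) (Y c [tuple i1; i2; i3; i4])
               i1 i2 i3 i4).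

(* Main.v *)
Require Import Defs.
From HB Require Import structures.
From mathcomp Require Import all_boot all_order all_fingroup all_algebra.
From mathcomp Require Import all_classical all_reals all_analysis.
From mathcomp Require Import measurable_realfun.
From mathcomp Require Import ring lra zify.
From mathcomp Require Import complex.
From mathcomp Require spectral.

Set Implicit Arguments.
Unset Strict Implicit.
Unset Printing Implicit Defensive.

Import Order.TTheory GRing.Theory Num.Theory.
Import numFieldNormedType.Exports.

Local Open Scope classical_set_scope.
Local Open Scope ring_scope.

(* If a noise matrix E satisfies ||E|| <= s in operator norm, then the singular
   values of M + E differ from those of M by at most s (Weyl). Two
   of the three matricizations of a call pair indices which two cuts of the ring
   separate from the other two, hence have rank at most (R^2 - 1)^2 < R^4, while
   the third has sigma_(R^4) >= sigma; so a call is answered correctly as soon as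
   all three noise matrices have operator norm at most s < sigma / 2. By Chevet's
   inequality an M x N Gaussian matrix of variance v^2 has operator norm at most
   v (sqrt M + sqrt N + t) with probability at least 1 - 4 exp (- t^2 / 2); with
   M, N <= n_max^2 and t = T / 2 - 2 n_max this is v T / 2 < sigma / 2. If all
   answers are right, each round of the while loop at least halves
   jmax - jmin, so at most d log_2 d calls occur, and these calls do not depend
   on the noise; a union bound over them concludes.

   Chevet's inequality is obtained, for the maximum over finitely many pairs
   (x, y) of unit vectors, by comparing the Gaussian processes x Z y^T + g and
   x g'^T + y g''^T: the second has the smaller covariances off the diagonal.
   Exponential moments of a maximum are compared for the regularization
   (sum_j exp (b z_j))^th, by convolving with a Gaussian in many small time
   steps and bounding each step to second order. *)

(** The comparison is carried out in the class of log-Lipschitz functions. It is stable under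
    Gaussian convolution, nonnegativity makes Tonelli applicable throughout, exponential growth
    makes every integral finite, and no derivative is taken. Instead of a Taylor expansion, the
    regularized maximum is squeezed between combinations of exponentials of linear forms (below,
    after subtracting a correction); convolution multiplies such exponentials by explicit constants,
    and both bounds have the same second-order term. This term decreases in the off-diagonal
    covariances because th < 1. A relative error of order s^2 in a step of length s leaves an error
    of order s after t / s steps. The variable g makes the variances of the two processes equal. It
    shifts all coordinates by the same amount, so it only multiplies the exponential moment of
    parameter la by exp (la^2 t / 2), which is divided out at the end. The constant is 24 = 2 * 2 *
    3 * 2: the loss in the comparison, the regularized maximum against the maximum, three matrices
    per call, and log_2 d <= 2 ln d. *)

(** * Integrals against one-dimensional normal laws *)

Section NormalProb.
Variable K : realType.
Implicit Types (m s a b x : K).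
Local Notation mu := (@lebesgue_measure K).

(** The Radon-Nikodym derivative of [normal_prob m s] and the density have the same integral over
    every measurable set, hence agree almost everywhere. *)
Lemma ge0_integral_normal_prob m s (f : K -> \bar K) :
  measurable_fun [set: K] f -> (forall x, (0 <= f x)%E) ->
  (\int[normal_prob m s]_x f x = \int[mu]_x (f x * (normal_pdf m s x)%:E))%E.
Proof.
move=> mf f0; have dom := @normal_prob_dominates K m s.
rewrite -(Radon_Nikodym_SigmaFinite.change_of_variables dom)//.
have mg : mu.-integrable setT (Radon_Nikodym_SigmaFinite.f (normal_prob m s) mu).
  exact: Radon_Nikodym_SigmaFinite.f_integrable.
apply: ae_eq_integral => //.
- by apply: emeasurable_funM => //; exact: measurable_int mg.
- apply: emeasurable_funM => //; apply/measurable_EFinP.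
  exact: measurable_normal_pdf.
- apply: ae_eqe_mul2l => /=; apply: integral_ae_eq => //.
  + by apply/measurable_EFinP; exact: measurable_normal_pdf.
  + by move=> E _ mE; rewrite -Radon_Nikodym_SigmaFinite.f_integral.
Qed.

Lemma integral_lebesgue_shift (G : K -> K) a :
  continuous G -> (forall x, 0 <= G x) ->
  (\int[mu]_x (G x)%:E = \int[mu]_x (G (x + a))%:E)%E.
Proof.
move=> cG G0; pose F := fun x : K => x + a.
have F'E : (F^`())%classic = cst 1.
  apply/funext => x; rewrite /F derive1E deriveD//.
  by rewrite derive_id derive_cst addr0.
rewrite (increasing_ge0_integration_by_substitutionT (F := F))//.
- by apply: eq_integral => x _; rewrite F'E /= fctE /= mulr1.
- by move=> x y; rewrite /F ltrD2r.
- by rewrite F'E => ?; exact: cvg_cst.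
- by rewrite F'E; exact: is_cvg_cst.
- by rewrite F'E; exact: is_cvg_cst.
- exact: cvg_addrr_Ny.
- exact: cvg_addrr.
Qed.

(** Completing the square: for the sum y of independent centred normal variables of variances a and
    b, the right-hand side is the density of y times the conditional density of the first summand
    given y. *)
Lemma normal_pdf_convolution a b x y : 0 < a -> 0 < b ->
  normal_pdf 0 (Num.sqrt a) x * normal_pdf 0 (Num.sqrt b) (y - x) =
  normal_pdf 0 (Num.sqrt (a + b)) y *
  normal_pdf (a / (a + b) * y) (Num.sqrt (a * b / (a + b))) x.
Proof.
move=> a0 b0.
have ab0 : 0 < a + b by lra.
have c0 : 0 < a * b / (a + b) by rewrite divr_gt0 ?mulr_gt0.
rewrite !normal_pdfE ?gt_eqF ?sqrtr_gt0 //.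
rewrite /normal_peak /normal_fun !sqr_sqrtr ?ltW//.
rewrite mulrACA -expRD [RHS]mulrACA -expRD; congr (_ * expR _).
  rewrite -!invfM -!sqrtrM ?mulrn_wge0 ?mulr_ge0 ?pi_ge0 ?ltW//.
  congr (Num.sqrt _)^-1; rewrite !mulr2n; field; rewrite ?(gt_eqF a0) ?(gt_eqF b0) ?gt_eqF ?oner_eq0 ?pnatr_eq0//; try lra.
rewrite !mulr2n; field; rewrite ?(gt_eqF a0) ?(gt_eqF b0) ?gt_eqF ?oner_eq0 ?pnatr_eq0//; try lra.
have := mulr_gt0 a0 b0; lra.
Qed.

(** After a shift of y by x, Tonelli lets x be integrated first, and the conditional density of
    [normal_pdf_convolution] integrates to 1. The shift is where continuity of g enters. *)
Lemma integral_normal_convolution a b (g : K -> K) : 0 < a -> 0 < b ->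
  continuous g -> (forall x, 0 <= g x) ->
  (\int[normal_prob 0 (Num.sqrt a)]_x \int[normal_prob 0 (Num.sqrt b)]_y
    (g (x + y))%:E = \int[normal_prob 0 (Num.sqrt (a + b))]_y (g y)%:E)%E.
Proof.
move=> a0 b0 cg g0.
have sb0 : Num.sqrt b != 0 by rewrite gt_eqF // sqrtr_gt0.
have mg : measurable_fun setT g by exact: continuous_measurable_fun.
have mp m s : measurable_fun setT (normal_pdf m s : K -> K).
  exact: measurable_normal_pdf.
have mgs x : measurable_fun setT (fun y : K => (g (x + y))%:E).
  apply/measurable_EFinP; apply: (measurableT_comp mg).
  exact: measurable_funD.
have step x : (\int[normal_prob 0 (Num.sqrt b)]_y (g (x + y))%:E =
    \int[mu]_y (g y * normal_pdf 0 (Num.sqrt b) (y - x))%:E)%E.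
  have g0x y : (0 <= (g (x + y))%:E)%E by rewrite lee_fin.
  rewrite (ge0_integral_normal_prob 0 (Num.sqrt b) (mgs x) g0x).
  rewrite [RHS](@integral_lebesgue_shift _ x); last 2 first.
  - move=> y; apply: cvgM; first exact: cg.
    apply: (cvg_comp (fun y => y - x) (normal_pdf 0 (Num.sqrt b))).
      by apply: (@cvgB _ K^o) => //; [exact: cvg_id|exact: cvg_cst].
    exact: continuous_normal_pdf.
  - by move=> y; rewrite mulr_ge0 ?normal_pdf_ge0.
  by apply: eq_integral => y _; rewrite addrK addrC EFinM.
have mF : measurable_fun setT
    (fun z : K * K => (g z.2 * normal_pdf 0 (Num.sqrt b) (z.2 - z.1))%:E).
  apply/measurable_EFinP; apply: measurable_funM.
    exact: (measurableT_comp mg).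
  apply: (measurableT_comp (mp _ _)).
  by apply: measurable_funB.
have F0 (z : K * K) :
    (0 <= (g z.2 * normal_pdf 0 (Num.sqrt b) (z.2 - z.1))%:E)%E.
  by rewrite lee_fin mulr_ge0 ?normal_pdf_ge0.
transitivity (\int[normal_prob 0 (Num.sqrt a)]_x
    \int[mu]_y (g y * normal_pdf 0 (Num.sqrt b) (y - x))%:E)%E.
  by apply: eq_integral => x _; exact: step.
rewrite [LHS]ge0_integral_normal_prob; last 2 first.
- exact: (@measurable_fun_fubini_tonelli_F _ _ _ _ _ mu _ mF F0).
- by move=> x; apply: integral_ge0 => y _; exact: F0 (x, y).
have mH : measurable_fun setT (fun z : K * K =>
    (g z.2 * normal_pdf 0 (Num.sqrt b) (z.2 - z.1) *
     normal_pdf 0 (Num.sqrt a) z.1)%:E).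
  apply/measurable_EFinP; apply: measurable_funM.
    exact/measurable_EFinP.
  by apply: (measurableT_comp (mp _ _)).
transitivity (\int[mu]_x \int[mu]_y (g y * normal_pdf 0 (Num.sqrt b) (y - x) *
     normal_pdf 0 (Num.sqrt a) x)%:E)%E.
  apply: eq_integral => x _; rewrite -ge0_integralZr//.
  - exact: (measurableT_comp mF (pair1_measurable x)).
  - by move=> y _; exact: F0 (x, y).
  - by rewrite lee_fin normal_pdf_ge0.
rewrite (fubini_tonelli (m1 := mu) (m2 := mu) _ mH) /=; last first.
  by move=> x; rewrite lee_fin !mulr_ge0 ?normal_pdf_ge0.
rewrite [RHS]ge0_integral_normal_prob => [||y]; rewrite ?lee_fin//; last first.
  exact/measurable_EFinP.
apply: eq_integral => y _.
transitivity (\int[mu]_x ((g y * normal_pdf 0 (Num.sqrt (a + b)) y)%:E *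
  (normal_pdf (a / (a + b) * y) (Num.sqrt (a * b / (a + b))) x)%:E))%E.
  apply: eq_integral => x _; rewrite -EFinM; congr EFin.
  by rewrite -mulrA [X in _ * X]mulrC normal_pdf_convolution// mulrA.
rewrite ge0_integralZl//; last 3 first.
- apply/measurable_EFinP; exact: mp.
- by move=> x _; rewrite lee_fin normal_pdf_ge0.
- by rewrite lee_fin mulr_ge0 ?normal_pdf_ge0.
by rewrite integral_normal_pdf mule1 EFinM.
Qed.

Lemma integral_normal_expR a (c : K) : 0 < a ->
  (\int[normal_prob 0 (Num.sqrt a)]_x (expR (c * x))%:E =
   (expR (a * c ^+ 2 / 2))%:E)%E.
Proof.
move=> a0.
have s0 : Num.sqrt a != 0 by rewrite gt_eqF // sqrtr_gt0.
rewrite ge0_integral_normal_prob => [||x]; rewrite ?lee_fin ?expR_ge0//; last first.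
  by apply/measurable_EFinP/measurableT_comp => //; apply: measurable_funM.
(* Exponential tilting only moves the mean, to [a * c]. *)
transitivity (\int[mu]_x ((expR (a * c ^+ 2 / 2))%:E *
   (normal_pdf (a * c) (Num.sqrt a) x)%:E))%E.
  apply: eq_integral => x _; rewrite -!EFinM; congr EFin.
  rewrite !normal_pdfE// mulrCA [RHS]mulrCA; congr (_ * _).
  rewrite /normal_fun -!expRD sqr_sqrtr ?ltW//; congr expR.
  by rewrite !mulr2n; field; rewrite ?(gt_eqF a0) ?(gt_eqF b0) ?gt_eqF ?oner_eq0 ?pnatr_eq0//; try lra.
rewrite ge0_integralZl//; last 2 first.
- by apply/measurable_EFinP; exact: measurable_normal_pdf.
- by move=> x _; rewrite lee_fin normal_pdf_ge0.
by rewrite integral_normal_pdf mule1.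
Qed.

Lemma integral_normal_expR_sqr a k : 0 < a -> 2 * k * a < 1 ->
  (\int[normal_prob 0 (Num.sqrt a)]_x (expR (k * x ^+ 2))%:E =
   (Num.sqrt (1 - 2 * k * a))^-1%:E)%E.
Proof.
move=> a0 ka.
have k0 : 0 < 1 - 2 * k * a by lra.
have s0 : Num.sqrt a != 0 by rewrite gt_eqF // sqrtr_gt0.
have b0 : 0 < a / (1 - 2 * k * a) by rewrite divr_gt0.
have t0 : Num.sqrt (a / (1 - 2 * k * a)) != 0 by rewrite gt_eqF // sqrtr_gt0.
rewrite ge0_integral_normal_prob => [||x]; rewrite ?lee_fin ?expR_ge0//; last first.
  by apply/measurable_EFinP/measurableT_comp => //; apply: measurable_funM => //.
(* A Gaussian weight only changes the variance, to [a / (1 - 2 * k * a)]. *)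
transitivity (\int[mu]_x ((Num.sqrt (1 - 2 * k * a))^-1%:E *
   (normal_pdf 0 (Num.sqrt (a / (1 - 2 * k * a))) x)%:E))%E.
  apply: eq_integral => x _; rewrite -!EFinM; congr EFin.
  rewrite !normal_pdfE// mulrCA [RHS]mulrA; congr (_ * _).
    rewrite /normal_peak -invfM -sqrtrM ?ltW//; congr (Num.sqrt _)^-1.
    rewrite !sqr_sqrtr ?ltW// !mulr2n; field; rewrite ?(gt_eqF a0) ?(gt_eqF b0) ?gt_eqF ?oner_eq0 ?pnatr_eq0//; try lra.
  rewrite /normal_fun -!expRD !sqr_sqrtr ?ltW//; congr expR.
  rewrite !mulr2n; field; rewrite ?(gt_eqF a0) ?(gt_eqF b0) ?gt_eqF ?oner_eq0 ?pnatr_eq0//; try lra.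
rewrite ge0_integralZl//; last 2 first.
- by apply/measurable_EFinP; exact: measurable_normal_pdf.
- by move=> x _; rewrite lee_fin normal_pdf_ge0.
by rewrite integral_normal_pdf mule1.
Qed.

End NormalProb.

(** * Measurability and continuity of Lipschitz and log-Lipschitz functions *)

Section MeasurableLipschitz.
Variable K : realType.

Definition l1 m n (A : 'M[K]_(m, n)) : K := \sum_i \sum_j `|A i j|.

Lemma l1_ge0 m n (A : 'M[K]_(m, n)) : 0 <= l1 A.
Proof. by apply: sumr_ge0 => i _; apply: sumr_ge0. Qed.

Lemma l1Z m n (a : K) (A : 'M[K]_(m, n)) : l1 (a *: A) = `|a| * l1 A.
Proof.
rewrite /l1 mulr_sumr; apply: eq_bigr => i _; rewrite mulr_sumr.
by apply: eq_bigr => j _; rewrite mxE normrM.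
Qed.

Lemma l1N m n (A : 'M[K]_(m, n)) : l1 (- A) = l1 A.
Proof. by rewrite -scaleN1r l1Z normrN1 mul1r. Qed.

Lemma rat_matrix_dense m n (A : 'M[K]_(m, n)) (e : K) : 0 < e ->
  exists Q : 'M[rat]_(m, n), l1 (A - map_mx ratr Q) < e.
Proof.
move=> e0; pose d : K := e / ((m * n).+1)%:R.
have d0 : 0 < d by rewrite divr_gt0.
have H i j : exists q : rat, `|A i j - ratr q| < d.
  have [q] : exists q : rat, ratr q \in `](A i j - d), (A i j + d)[.
    by apply: rat_in_itvoo; lra.
  by rewrite in_itv /= => H; exists q; rewrite ltr_norml; lra.
have {}H i : exists q : 'I_n -> rat, forall j, `|A i j - ratr (q j)| < d.
  by have [q Hq] := boolp.choice (H i); exists q.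
have [Q HQ] := boolp.choice H.
exists (\matrix_(i, j) Q i j).
have -> : e = d * ((m * n).+1)%:R by rewrite divfK // pnatr_eq0.
apply: (@le_lt_trans _ _ (\sum_(i < m) \sum_(j < n) d)).
  by apply: ler_sum => i _; apply: ler_sum => j _; rewrite !mxE ltW.
rewrite !sumr_const !card_ord -mulrnA -[ltLHS]mulr_natr ltr_pM2l//.
by rewrite ltr_nat mulnC.
Qed.

(** By density of the rational matrices Q, the event [a < f (X t)] is the countable union over Q of
    the events that X t is so close to Q that the Lipschitz bound already forces [a < f (X t)]. The
    factor 2 in the choice of Q pays for the two uses of the Lipschitz bound. *)
Lemma measurable_lipschitz d (T : measurableType d) m n
    (X : T -> 'M[K]_(m, n)) (f : 'M[K]_(m, n) -> K) (c : K) :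
  (forall i j, measurable_fun [set: T] (fun t => X t i j)) ->
  (forall A B, f A <= f B + c * l1 (A - B)) ->
  measurable_fun [set: T] (fun t => f (X t)).
Proof.
move=> mX Lf; pose c' : K := `|c| + 1.
have c'0 : 0 < c' by rewrite ltr_wpDl.
have {}Lf A B : f A <= f B + c' * l1 (A - B).
  apply: (le_trans (Lf A B)); rewrite lerD2l ler_wpM2r ?l1_ge0//.
  by rewrite /c'; have := ler_norm c; lra.
apply: (measurability _ (RGenOInfty.measurableE K)) => //.
move=> _ [_ [a ->] <-]; rewrite setTI.
pose D (Q : 'M[rat]_(m, n)) : set T :=
  [set t | c' * l1 (X t - map_mx ratr Q) < f (map_mx ratr Q) - a].
have -> : (fun t => f (X t)) @^-1` `]a, +oo[ = \bigcup_Q D Q.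
  apply/seteqP; split => t /=.
    rewrite in_itv /= andbT => aft.
    have e0 : 0 < (f (X t) - a) / (2 * c').
      by rewrite divr_gt0 ?subr_gt0 ?mulr_gt0.
    have [Q HQ] := rat_matrix_dense (X t) e0.
    exists Q => //; rewrite /D /=.
    have := Lf (X t) (map_mx ratr Q).
    move: HQ; rewrite ltr_pdivlMr ?mulr_gt0//.
    lra.
  case=> Q _; rewrite /D /= in_itv /= andbT => H.
  have := Lf (map_mx ratr Q) (X t).
  by rewrite -opprB l1N; lra.
apply: countable_bigcupT_measurable; first exact: countableP.
move=> Q; rewrite /D.
have mg : measurable_fun [set: T] (fun t => c' * l1 (X t - map_mx ratr Q)).
  apply: measurable_funM => //.
  apply: measurable_sum => i; apply: measurable_sum => j.
  apply: measurableT_comp => //=.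
  have -> : (fun x => (X x - map_mx ratr Q) i j) =
      (fun x => X x i j - ratr (Q i j) :> K).
    by apply/funext => x; rewrite !mxE.
  exact: measurable_funB.
have := mg measurableT `]-oo, (f (map_mx ratr Q) - a)[%classic (measurable_itv _).
by rewrite setTI; congr measurable; apply/seteqP; split => x /=; rewrite in_itv.
Qed.

End MeasurableLipschitz.

Section LogLipschitz.
Variables (K : realType) (J : nat).
Local Notation V := 'rV[K]_J.

(** The multiplicative form of a Lipschitz bound on [ln f], which still makes sense for f = 0. It is
    preserved by sums, nonnegative multiples and averages over translations. *)
Definition log_lipschitz (c : K) (f : V -> K) : Prop :=
  (forall x, 0 <= f x) /\ (forall x h, f (x + h) <= expR (c * l1 h) * f x).

Lemma log_lipschitz_eq0_or_gt0 c f : log_lipschitz c f ->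
  f = cst 0 \/ forall x, 0 < f x.
Proof.
move=> [f0 fL]; have [[x fx]|H] := pselect (exists x, f x = 0).
  left; apply/funext => y; apply/eqP; rewrite eq_le f0 andbT.
  by have := fL x (y - x); rewrite fx mulr0 addrC subrK.
by right => x; rewrite lt0r f0 andbT; apply: contra_notN H => /eqP fx; exists x.
Qed.

Lemma measurable_log_lipschitz d (T : measurableType d) (X : T -> V) c f :
  log_lipschitz c f ->
  (forall j, measurable_fun [set: T] (fun t => X t 0 j)) ->
  measurable_fun [set: T] (fun t => f (X t)).
Proof.
move=> Lf mX; have [->|f0] := log_lipschitz_eq0_or_gt0 Lf.
  exact: measurable_cst.
case: Lf => _ fL.
have -> : (fun t => f (X t)) = expR \o (fun t => ln (f (X t))).
  by apply/funext => t /=; rewrite lnK// posrE.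
apply: measurableT_comp => //.
apply: (measurable_lipschitz (f := fun x => ln (f x)) (c := c)).
  by move=> i j; rewrite ord1.
move=> x y; have := fL y (x - y); rewrite addrC subrK => H.
rewrite -[X in _ <= _ + X]expRK addrC -lnM ?posrE ?expR_gt0//.
by rewrite ler_ln ?posrE ?mulr_gt0 ?expR_gt0.
Qed.

(** Supplies the continuity that [integral_normal_convolution] asks for; [ln f] is Lipschitz along
    the line. *)
Lemma continuous_log_lipschitz c f (x v : V) :
  log_lipschitz c f -> continuous (fun z : K => f (x + z *: v)).
Proof.
move=> Lf; have [->|f0] := log_lipschitz_eq0_or_gt0 Lf; first exact: cst_continuous.
case: Lf => _ fL.
have -> : (fun z => f (x + z *: v)) = expR \o (fun z => ln (f (x + z *: v))).
  by apply/funext => t /=; rewrite lnK// posrE.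
move=> z; apply: continuous_comp; last exact: continuous_expR.
have L u w : ln (f (x + u *: v)) <= ln (f (x + w *: v)) + `|c| * l1 v * `|u - w|.
  have := fL (x + w *: v) ((u - w) *: v).
  rewrite -addrA -scalerDl subrKC l1Z => H.
  apply: (@le_trans _ _ (c * (`|u - w| * l1 v) + ln (f (x + w *: v)))).
    rewrite -[X in _ <= X + _]expRK -lnM ?posrE ?expR_gt0//.
    by rewrite ler_ln ?posrE ?mulr_gt0 ?expR_gt0.
  rewrite addrC lerD2l mulrCA mulrC.
  by rewrite ler_wpM2r// ler_wpM2r ?l1_ge0// ler_norm.
pose C := `|c| * l1 v + 1.
have C0 : 0 < C by rewrite ltr_wpDl// mulr_ge0 ?l1_ge0.
apply/cvgrPdist_lt => e e0; near=> u.
have : `|z - u| < e / C.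
  by near: u; apply: cvgr_dist_lt => //; rewrite divr_gt0.
rewrite ltr_pdivlMr// mulrC => H.
apply: le_lt_trans H; have := L z u; have := L u z.
rewrite (distrC u z) /C mulrDl mul1r => H1 H2; rewrite ler_norml.
have := normr_ge0 (z - u); lra.
Unshelve. all: by end_near. Qed.

End LogLipschitz.

(** * Gaussian convolution and comparison *)

Section GaussOp.
Variables (K : realType) (J : nat).
Local Notation V := 'rV[K]_J.
Implicit Types (t s c : K) (v w x : V) (f g : V -> K).

Fact gauss_op_key : unit. Proof. exact: tt. Qed.

(* Locked: conversion tests between unfolded integrals do not terminate in
   practice. *)
Definition gauss_op t v : (V -> K) -> V -> K := locked_with gauss_op_key
  (fun f x => fine (\int[normal_prob 0 (Num.sqrt t)]_z (f (x + z *: v))%:E)%E).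

Lemma measurable_line c f v x : log_lipschitz c f ->
  measurable_fun [set: K] (fun z : K => (f (x + z *: v))%:E).
Proof.
move=> Lf; apply/measurable_EFinP.
apply: (measurable_log_lipschitz (X := fun z : K => x + z *: v) Lf) => j.
have -> : (fun z : K => (x + z *: v) 0 j) = (fun z : K => x 0 j + z * v 0 j).
  by apply/funext => z; rewrite !mxE.
by apply: measurable_funD => //; apply: measurable_funM.
Qed.

(** Nothing is lost in [fine]: [f (x + z *: v)] is at most [f x] times the sum of two exponentials
    linear in z, whose Gaussian integrals are finite. *)
Lemma gauss_opE t v c f x : 0 < t -> log_lipschitz c f ->
  ((gauss_op t v f x)%:E =
   \int[normal_prob 0 (Num.sqrt t)]_z (f (x + z *: v))%:E)%E.
Proof.
move=> t0 Lf; have [f0 fL] := Lf; rewrite /gauss_op locked_withE fineK// ge0_fin_numE; last first.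
  by apply: integral_ge0 => z _; rewrite lee_fin.
pose C := `|c| * l1 v.
have mE (b : K) : measurable_fun [set: K] (fun z : K => (f x * expR (b * z))%:E).
  apply/measurable_EFinP; apply: measurable_funM => //.
  by apply: measurableT_comp => //; apply: measurable_funM.
apply: (@le_lt_trans _ _ (\int[normal_prob 0 (Num.sqrt t)]_z
    ((f x * expR (C * z))%:E + (f x * expR (- C * z))%:E))%E).
  apply: ge0_le_integral => //.
  - by move=> z _; rewrite lee_fin.
  - exact: measurable_line Lf.
  - by apply: emeasurable_funD; exact: mE.
  - move=> z _; rewrite lee_fin -mulrDr mulrC.
    apply: (le_trans (fL _ _)); rewrite ler_wpM2r// l1Z.
    apply: (@le_trans _ _ (expR (C * `|z|))).
      by rewrite ler_expR /C (mulrC `|z|) mulrA ler_wpM2r// ler_wpM2r ?l1_ge0// ler_norm.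
    have [z0|z0] := ger0P z; first by rewrite lerDl expR_ge0.
    by rewrite mulrN mulNr lerDr expR_ge0.
have iE (b : K) : (\int[normal_prob 0 (Num.sqrt t)]_z (f x * expR (b * z))%:E =
    (f x * expR (t * b ^+ 2 / 2))%:E)%E.
  under eq_integral do rewrite EFinM.
  rewrite ge0_integralZl ?integral_normal_expR//.
  - by apply/measurable_EFinP; apply: measurableT_comp => //; apply: measurable_funM.
  - by rewrite lee_fin.
rewrite ge0_integralD//.
- by rewrite !iE -EFinD ltry.
- by move=> z _; rewrite lee_fin mulr_ge0 ?expR_ge0.
- exact: mE.
- by move=> z _; rewrite lee_fin mulr_ge0 ?expR_ge0.
- exact: mE.
Qed.

Lemma log_lipschitzW c c' f : c <= c' -> log_lipschitz c f -> log_lipschitz c' f.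
Proof.
move=> cc' [f0 fL]; split=> // x h; apply: (le_trans (fL x h)).
by rewrite ler_wpM2r// ler_expR ler_wpM2r ?l1_ge0.
Qed.

Lemma log_lipschitzD c f g : log_lipschitz c f -> log_lipschitz c g ->
  log_lipschitz c (fun x => f x + g x).
Proof.
move=> [f0 fL] [g0 gL]; split=> [x|x h]; first by rewrite addr_ge0.
by rewrite mulrDr lerD.
Qed.

Lemma log_lipschitzZ c (a : K) f : 0 <= a -> log_lipschitz c f ->
  log_lipschitz c (fun x => a * f x).
Proof.
move=> a0 [f0 fL]; split=> [x|x h]; first by rewrite mulr_ge0.
by rewrite mulrCA ler_wpM2l.
Qed.

Lemma log_lipschitz0 c : log_lipschitz c (fun _ : V => 0).
Proof. by split=> [x|x h]; rewrite ?mulr0. Qed.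

Lemma log_lipschitz_sum c (I : Type) (r : seq I) (F : I -> V -> K) :
  (forall i, log_lipschitz c (F i)) ->
  log_lipschitz c (fun x => \sum_(i <- r) F i x).
Proof.
move=> LF; elim: r => [|i r IH].
  by under eq_fun do rewrite big_nil; exact: log_lipschitz0.
by under eq_fun do rewrite big_cons; exact: log_lipschitzD.
Qed.

Lemma gauss_op_monotone t v c c' f g : 0 < t ->
  log_lipschitz c f -> log_lipschitz c' g ->
  (forall x, f x <= g x) -> forall x, gauss_op t v f x <= gauss_op t v g x.
Proof.
move=> t0 Lf Lg fg x; rewrite -lee_fin (gauss_opE _ _ _ Lf)// (gauss_opE _ _ _ Lg)//.
apply: ge0_le_integral => //.
- by move=> z _; rewrite lee_fin; case: Lf.
- exact: measurable_line Lf.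
- exact: measurable_line Lg.
- by move=> z _; rewrite lee_fin.
Qed.

Lemma gauss_opZ t v c (a : K) f x : 0 < t -> 0 <= a -> log_lipschitz c f ->
  gauss_op t v (fun x => a * f x) x = a * gauss_op t v f x.
Proof.
move=> t0 a0 Lf; apply: EFin_inj.
rewrite (gauss_opE _ _ _ (log_lipschitzZ a0 Lf))// EFinM (gauss_opE _ _ _ Lf)//.
under eq_integral do rewrite EFinM.
rewrite ge0_integralZl//.
- exact: measurable_line Lf.
- by move=> z _; rewrite lee_fin; case: Lf.
Qed.

Lemma gauss_opD t v c f g x : 0 < t -> log_lipschitz c f -> log_lipschitz c g ->
  gauss_op t v (fun x => f x + g x) x = gauss_op t v f x + gauss_op t v g x.
Proof.
move=> t0 Lf Lg; apply: EFin_inj.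
rewrite (gauss_opE _ _ _ (log_lipschitzD Lf Lg))// EFinD.
rewrite (gauss_opE _ _ _ Lf)// (gauss_opE _ _ _ Lg)//.
under eq_integral do rewrite EFinD.
rewrite ge0_integralD//.
- by move=> z _; rewrite lee_fin; case: Lf.
- exact: measurable_line Lf.
- by move=> z _; rewrite lee_fin; case: Lg.
- exact: measurable_line Lg.
Qed.

Lemma log_lipschitz_gauss_op t v c f : 0 < t -> log_lipschitz c f ->
  log_lipschitz c (gauss_op t v f).
Proof.
move=> t0 Lf; split=> [x|x h].
  by rewrite -lee_fin (gauss_opE _ _ _ Lf)// integral_ge0// => z _; rewrite lee_fin; case: Lf.
have eh : 0 <= expR (c * l1 h) by exact: expR_ge0.
rewrite -(gauss_opZ _ _ _ _ Lf)// -lee_fin.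
rewrite (gauss_opE _ _ _ Lf)// (gauss_opE _ _ _ (log_lipschitzZ eh Lf))//.
apply: ge0_le_integral => //.
- by move=> z _; rewrite lee_fin; case: Lf.
- exact: measurable_line Lf.
- exact: (measurable_line _ _ (log_lipschitzZ eh Lf)).
- by move=> z _; rewrite lee_fin addrAC; case: Lf.
Qed.

Lemma gauss_opC s t v w c f x : 0 < s -> 0 < t -> log_lipschitz c f ->
  gauss_op s v (gauss_op t w f) x = gauss_op t w (gauss_op s v f) x.
Proof.
move=> s0 t0 Lf; apply: EFin_inj.
have E1 := gauss_opE v x s0 (log_lipschitz_gauss_op w t0 Lf).
have E2 := gauss_opE w x t0 (log_lipschitz_gauss_op v s0 Lf).
apply: (etrans E1); apply: etrans (esym E2).
transitivity (\int[normal_prob 0 (Num.sqrt s)]_z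
    \int[normal_prob 0 (Num.sqrt t)]_y (f (x + z *: v + y *: w))%:E)%E.
  by apply: eq_integral => z _; exact: (gauss_opE w _ t0 Lf).
pose F (z : K * K) := (f (x + z.1 *: v + z.2 *: w))%:E.
have mF : measurable_fun [set: K * K] F.
  apply/measurable_EFinP.
  apply: (measurable_log_lipschitz (X := fun z : K * K => x + z.1 *: v + z.2 *: w) Lf) => j.
  have -> : (fun z : K * K => (x + z.1 *: v + z.2 *: w) 0 j) =
     (fun z : K * K => x 0 j + z.1 * v 0 j + z.2 * w 0 j).
    by apply/funext => z; rewrite !mxE.
  by do ?apply: measurable_funD => //; apply: measurable_funM.
have F0 z : (0 <= F z)%E by rewrite lee_fin; case: Lf.
apply: etrans (fubini_tonelli (m1 := normal_prob 0 (Num.sqrt s))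
  (m2 := normal_prob 0 (Num.sqrt t)) F mF F0) _.
apply: eq_integral => z _; apply: etrans (esym (gauss_opE v _ s0 Lf)).
by apply: eq_integral => y _; rewrite /F /= addrAC.
Qed.

Lemma gauss_op_semigroup s t v c f x : 0 < s -> 0 < t -> log_lipschitz c f ->
  gauss_op s v (gauss_op t v f) x = gauss_op (s + t) v f x.
Proof.
move=> s0 t0 Lf; apply: EFin_inj.
apply: (etrans (gauss_opE v x s0 (log_lipschitz_gauss_op v t0 Lf))).
apply: etrans (esym (gauss_opE v x (addr_gt0 s0 t0) Lf)).
rewrite -integral_normal_convolution//.
- apply: eq_integral => z _; apply: (etrans (gauss_opE v _ t0 Lf)).
  by apply: eq_integral => y _; rewrite scalerDl addrA.
- exact: continuous_log_lipschitz Lf.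
- by move=> z; case: Lf.
Qed.

Definition dotr (a x : V) : K := \sum_j a 0 j * x 0 j.

Lemma dotrDr a x y : dotr a (x + y) = dotr a x + dotr a y.
Proof. by rewrite /dotr -big_split; apply: eq_bigr => j _; rewrite mxE mulrDr. Qed.

Lemma dotrZr a (z : K) y : dotr a (z *: y) = z * dotr a y.
Proof. by rewrite /dotr mulr_sumr; apply: eq_bigr => j _; rewrite mxE mulrCA. Qed.

Lemma log_lipschitz_expR a : log_lipschitz (l1 a) (fun x => expR (dotr a x)).
Proof.
split=> [x|x h]; first exact: expR_ge0.
rewrite -expRD ler_expR dotrDr addrC lerD2r.
apply: (@le_trans _ _ (\sum_j `|a 0 j| * `|h 0 j|)).
  by apply: ler_sum => j _; rewrite -normrM ler_norm.
rewrite /l1 !big_ord1 mulr_suml; apply: ler_sum => j _.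
by rewrite ler_wpM2l// (bigD1 j)//= lerDl sumr_ge0.
Qed.

(** Exponentials of linear forms are eigenfunctions of convolution; this replaces all computation of
    derivatives later on. *)
Lemma gauss_op_expR t v a x : 0 < t ->
  gauss_op t v (fun x => expR (dotr a x)) x =
  expR (t * dotr a v ^+ 2 / 2) * expR (dotr a x).
Proof.
move=> t0; apply: EFin_inj; rewrite (gauss_opE _ _ _ (log_lipschitz_expR a))//.
transitivity (\int[normal_prob 0 (Num.sqrt t)]_z
   ((expR (dotr a x))%:E * (expR (dotr a v * z))%:E))%E.
  apply: eq_integral => z _; rewrite -EFinM -expRD; congr (expR _)%:E.
  by rewrite dotrDr dotrZr (mulrC z).
rewrite ge0_integralZl ?integral_normal_expR//.
- by rewrite -EFinM mulrC.
- by apply/measurable_EFinP/measurableT_comp => //; apply: measurable_funM.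
Qed.

End GaussOp.

Section GaussOps.
Variables (K : realType) (J : nat).
Local Notation V := 'rV[K]_J.
Implicit Types (t s c : K) (v w x : V) (f g : V -> K) (vs ws : seq V).

(** The expectation of [f (x + G)], where G is the sum over v in vs of v times independent centred
    normals of variance t. A Gaussian law on V is thus encoded by a list of directions, with
    covariance t times the matrix called [cov vs] below. *)
Fixpoint gauss_ops t vs f : V -> K :=
  if vs is v :: vs' then gauss_op t v (gauss_ops t vs' f) else f.

Lemma log_lipschitz_gauss_ops t vs c f : 0 < t -> log_lipschitz c f ->
  log_lipschitz c (gauss_ops t vs f).
Proof. by move=> t0 Lf; elim: vs => //= v vs IH; exact: log_lipschitz_gauss_op. Qed.

Lemma gauss_ops_monotone t vs c c' f g : 0 < t ->
  log_lipschitz c f -> log_lipschitz c' g ->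
  (forall x, f x <= g x) -> forall x, gauss_ops t vs f x <= gauss_ops t vs g x.
Proof.
move=> t0 Lf Lg fg; elim: vs => //= v vs IH x.
exact: (gauss_op_monotone _ t0 (log_lipschitz_gauss_ops vs t0 Lf)
  (log_lipschitz_gauss_ops vs t0 Lg)).
Qed.

Lemma gauss_opsZ t vs c (a : K) f : 0 < t -> 0 <= a -> log_lipschitz c f ->
  gauss_ops t vs (fun x => a * f x) = fun x => a * gauss_ops t vs f x.
Proof.
move=> t0 a0 Lf; elim: vs => //= v vs ->; apply/funext => x.
exact: (gauss_opZ _ _ t0 a0 (log_lipschitz_gauss_ops vs t0 Lf)).
Qed.

Lemma gauss_opsD t vs c f g : 0 < t -> log_lipschitz c f -> log_lipschitz c g ->
  gauss_ops t vs (fun x => f x + g x) =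
  fun x => gauss_ops t vs f x + gauss_ops t vs g x.
Proof.
move=> t0 Lf Lg; elim: vs => //= v vs ->; apply/funext => x.
exact: (gauss_opD _ _ t0 (log_lipschitz_gauss_ops vs t0 Lf)
  (log_lipschitz_gauss_ops vs t0 Lg)).
Qed.

Lemma gauss_ops0 t vs : 0 < t -> gauss_ops t vs (fun=> 0) = fun=> 0.
Proof.
move=> t0; have L := @log_lipschitz0 K J 0.
have := gauss_opsZ vs t0 (lexx 0) L.
by under eq_fun do rewrite mulr0; move=> ->; apply/funext => x; rewrite mul0r.
Qed.

Lemma gauss_ops_sum t vs c (I : Type) (r : seq I) (F : I -> V -> K) : 0 < t ->
  (forall i, log_lipschitz c (F i)) ->
  gauss_ops t vs (fun x => \sum_(i <- r) F i x) =
  fun x => \sum_(i <- r) gauss_ops t vs (F i) x.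
Proof.
move=> t0 LF; elim: r => [|i r IH].
  under eq_fun do rewrite big_nil; rewrite gauss_ops0//.
  by apply/funext => x; rewrite big_nil.
under eq_fun do rewrite big_cons.
rewrite (gauss_opsD _ t0 (LF i) (log_lipschitz_sum _ LF)) IH.
by apply/funext => x; rewrite big_cons.
Qed.

Lemma gauss_op_opsC s t v vs c f : 0 < s -> 0 < t -> log_lipschitz c f ->
  gauss_op s v (gauss_ops t vs f) = gauss_ops t vs (gauss_op s v f).
Proof.
move=> s0 t0 Lf; elim: vs => //= w vs <-; apply/funext => x.
exact: (gauss_opC _ _ _ s0 t0 (log_lipschitz_gauss_ops vs t0 Lf)).
Qed.

Lemma gauss_opsC s t vs ws c f : 0 < s -> 0 < t -> log_lipschitz c f ->
  gauss_ops s vs (gauss_ops t ws f) = gauss_ops t ws (gauss_ops s vs f).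
Proof.
move=> s0 t0 Lf; elim: vs => //= v vs ->.
by rewrite (gauss_op_opsC _ _ s0 t0 (log_lipschitz_gauss_ops vs s0 Lf)).
Qed.

Lemma gauss_ops_semigroup s t vs c f : 0 < s -> 0 < t -> log_lipschitz c f ->
  gauss_ops s vs (gauss_ops t vs f) = gauss_ops (s + t) vs f.
Proof.
move=> s0 t0 Lf; elim: vs => //= v vs IH.
rewrite -(gauss_op_opsC _ _ t0 s0 (log_lipschitz_gauss_ops vs t0 Lf)) IH.
apply/funext => x; apply: (gauss_op_semigroup _ _ s0 t0).
exact: (log_lipschitz_gauss_ops vs (addr_gt0 s0 t0) Lf).
Qed.

Lemma iter_gauss_ops t vs c f n : 0 < t -> log_lipschitz c f ->
  iter n.+1 (gauss_ops t vs) f = gauss_ops (n.+1%:R * t) vs f.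
Proof.
move=> t0 Lf; elim: n => [|n IH]; first by rewrite /= mul1r.
rewrite iterS IH (gauss_ops_semigroup _ t0 _ Lf) ?mulr_gt0//.
by rewrite [n.+2%:R]mulrS mulrDl mul1r.
Qed.

(** The steps along vs are exchanged for steps along ws one at a time: all these operators commute
    and are monotone, so the hypothesis on the bare f propagates through the other steps. *)
Lemma gauss_ops_iter_le t vs ws c f (k : K) n : 0 < t -> 0 <= k ->
  log_lipschitz c f ->
  (forall x, gauss_ops t vs f x <= k * gauss_ops t ws f x) ->
  forall x, iter n (gauss_ops t vs) f x <= k ^+ n * iter n (gauss_ops t ws) f x.
Proof.
move=> t0 k0 Lf H.
have Li us m : log_lipschitz c (iter m (gauss_ops t us) f).
  by elim: m => //= m IH; exact: log_lipschitz_gauss_ops.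
have C m : gauss_ops t vs (iter m (gauss_ops t ws) f) =
    iter m (gauss_ops t ws) (gauss_ops t vs f).
  by elim: m => //= m <-; rewrite (gauss_opsC _ _ t0 t0 (Li ws m)).
elim: n => [|n IH] x; first by rewrite expr0 mul1r.
have kn m : 0 <= k ^+ m by rewrite exprn_ge0.
have := gauss_ops_monotone vs t0 (Li vs n) (log_lipschitzZ (kn n) (Li ws n)) IH x.
rewrite (gauss_opsZ _ t0 (kn n) (Li ws n)) => /le_trans; apply.
rewrite C exprSr -mulrA ler_wpM2l// iterSr.
have Lk m : log_lipschitz c (iter m (gauss_ops t ws) (gauss_ops t vs f)).
  by elim: m => [|m IHm] /=; exact: log_lipschitz_gauss_ops.
have Lw m : log_lipschitz c (iter m (gauss_ops t ws) (gauss_ops t ws f)).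
  by rewrite -iterSr; exact: Li.
elim: (n) x => [|m IHm] x /=; first exact: H.
have := gauss_ops_monotone ws t0 (Lk m) (log_lipschitzZ k0 (Lw m)) IHm x.
by rewrite (gauss_opsZ _ t0 k0 (Lw m)).
Qed.

Definition qform vs (a : V) : K := \sum_(v <- vs) dotr a v ^+ 2.

Lemma gauss_ops_expR t vs a : 0 < t ->
  gauss_ops t vs (fun x => expR (dotr a x)) =
  fun x => expR (t * qform vs a / 2) * expR (dotr a x).
Proof.
move=> t0; have La := @log_lipschitz_expR K J a.
elim: vs => [|v vs IH] /=.
  by apply/funext => x; rewrite /qform big_nil mulr0 mul0r expR0 mul1r.
rewrite IH; apply/funext => x.
rewrite (gauss_opZ _ _ t0 (expR_ge0 _) La) gauss_op_expR// mulrA -expRD.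
by rewrite /qform big_cons; congr (expR _ * _); ring.
Qed.

Lemma log_lipschitz_expsum (I : finType) (w : I -> K) (A : I -> V) x :
  (forall i, 0 <= w i) ->
  log_lipschitz (\sum_i l1 (A i)) (fun y => \sum_i w i * expR (dotr (A i) (y - x))).
Proof.
move=> w0; apply: log_lipschitz_sum => i; apply: log_lipschitzZ => //.
apply: (@log_lipschitzW _ _ (l1 (A i))).
  by rewrite (bigD1 i)//= lerDl sumr_ge0// => ? _; exact: l1_ge0.
case: (log_lipschitz_expR (A i)) => L0 L1; split=> [y|y h]; first exact: expR_ge0.
by rewrite addrAC L1.
Qed.

(** The exponentials are centred at the point x of evaluation, as are the local bounds on the soft
    maximum to which this is applied. *)
Lemma gauss_ops_expsum t vs (I : finType) (w : I -> K) (A : I -> V) x : 0 < t ->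
  (forall i, 0 <= w i) ->
  gauss_ops t vs (fun y => \sum_i w i * expR (dotr (A i) (y - x))) x =
  \sum_i w i * expR (t * qform vs (A i) / 2).
Proof.
move=> t0 w0.
have wE i : 0 <= w i * expR (- dotr (A i) x) by rewrite mulr_ge0 ?expR_ge0.
have -> : (fun y => \sum_i w i * expR (dotr (A i) (y - x))) =
    (fun y => \sum_i (w i * expR (- dotr (A i) x)) * expR (dotr (A i) y)).
  apply/funext => y; apply: eq_bigr => i _; rewrite -mulrA -expRD.
  by rewrite dotrDr -scaleN1r dotrZr mulN1r addrC.
have LE i : log_lipschitz (\sum_i l1 (A i))
    (fun y => w i * expR (- dotr (A i) x) * expR (dotr (A i) y)).
  apply: log_lipschitzZ => //.
  apply: (@log_lipschitzW _ _ (l1 (A i))); last exact: log_lipschitz_expR.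
  by rewrite (bigD1 i)//= lerDl sumr_ge0// => ? _; exact: l1_ge0.
rewrite (gauss_ops_sum _ _ t0 LE).
apply: eq_bigr => i _; rewrite (gauss_opsZ _ t0 (wE i) (log_lipschitz_expR _)).
by rewrite gauss_ops_expR// -mulrA; congr (_ * _); rewrite mulrCA -expRD addNr expR0 mulr1.
Qed.

End GaussOps.

(** * Exponential bounds for the soft maximum *)

Section SoftMax.
Variables (K : realType) (J : nat).
Local Notation V := 'rV[K]_J.

(** Multiply by 1 - u: the left side becomes at most 1 because 1 - u <= exp (- u), and the right
    side becomes 1 + u^2 (1 - 2 u). *)
Lemma expR_le1D2sqr (u : K) : 0 <= u -> u <= 1 / 2 -> expR u <= 1 + u + 2 * u ^+ 2.
Proof.
move=> u0 u1.
have h : 1 - u <= expR (- u) by have := expR_ge1Dx (- u).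
have e0 := expR_gt0 (- u).
have E : expR u * expR (- u) = 1 by rewrite -expRD subrr expR0.
have := ler_wpM2l (expR_ge0 u) h; rewrite E.
move: (expR u) => e H.
have : e * (1 - u) <= (1 + u + 2 * u ^+ 2) * (1 - u).
  apply: (le_trans H).
  suff : 0 <= u ^+ 2 * (1 - 2 * u) by lra.
  by rewrite mulr_ge0 ?sqr_ge0//; lra.
by rewrite ler_pM2r//; lra.
Qed.

(** Convexity of the exponential between 0 and y, from its tangent at [th * y]. With y = ln S it
    bounds S^th by a function affine in S. *)
Lemma expR_le_interp (th y : K) : 0 < th < 1 ->
  expR (th * y) <= 1 - th + th * expR y.
Proof.
move=> /andP[t0 t1].
have e0 := expR_ge0 (th * y).
have -> : expR y = expR (th * y) * expR ((1 - th) * y).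
  by rewrite -expRD; congr expR; ring.
have E : 1 = expR (th * y) * expR (- th * y).
  by rewrite -expRD -[LHS]expR0; congr expR; ring.
have h1 := expR_ge1Dx ((1 - th) * y).
have h2 := expR_ge1Dx (- th * y).
have := ler_wpM2l e0 h1; have := ler_wpM2l e0 h2; rewrite -E.
move: (expR (th * y)) (expR ((1 - th) * y)) => e f H1 H2.
have := ler_wpM2l (ltW t0) H2; have : (1 - th) * (e * (1 + - th * y)) <= (1 - th) * 1.
  by rewrite ler_wpM2l//; lra.
lra.
Qed.

(** The converse bound on S^th, from ln S >= 1 - 1 / S. In its use S - 1 is of second order in the
    displacement, so the loss (S - 1)^2 is of fourth order and harmless. *)
Lemma expR_ln_ge (th S : K) : 0 < th < 1 -> 1 <= S ->
  1 + th * (S - 1) - (S - 1) ^+ 2 <= expR (th * ln S).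
Proof.
move=> /andP[t0 t1] S1; have S0 : 0 < S by lra.
apply: le_trans (expR_ge1Dx _); rewrite -addrA lerD2l.
have : 1 - S^-1 <= ln S.
  have := @le_ln1Dx K (S^-1 - 1); rewrite subrKC lnV ?posrE//.
  by have := invr_gt0 S; rewrite S0 => iS0; move/(_ ltac:(lra)); lra.
have -> : 1 - S^-1 = (S - 1) - (S - 1) ^+ 2 / S by field; rewrite gt_eqF.
have : (S - 1) ^+ 2 / S <= (S - 1) ^+ 2.
  by rewrite ler_pdivrMr// ler_peMr ?sqr_ge0.
have := sqr_ge0 (S - 1).
set q := _ / S; set Q := _ ^+ 2; set L := ln S => Q0 qQ H.
have : th * (S - 1 - q) <= th * L by rewrite ler_wpM2l// ltW.
have : th * q <= th * Q by rewrite ler_wpM2l// ltW.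
have : th * Q <= 1 * Q by rewrite ler_wpM2r// ltW.
lra.
Qed.

Variables (be th : K).
Hypotheses (J0 : (0 < J)%N) (be0 : 0 < be) (th01 : 0 < th < 1).
Implicit Types (x y v : V).

Definition partition_fun x : K := \sum_j expR (be * x 0 j).
Definition soft_max x : K := expR (th * ln (partition_fun x)).
Definition gibbs x : V := \row_j (expR (be * x 0 j) / partition_fun x).

Lemma partition_fun_gt0 x : 0 < partition_fun x.
Proof.
rewrite /partition_fun (bigD1 (Ordinal J0))//= ltr_pwDl ?expR_gt0//.
by apply: sumr_ge0 => j _; exact: expR_ge0.
Qed.

Lemma gibbs_ge0 x j : 0 <= gibbs x 0 j.
Proof. by rewrite mxE divr_ge0 ?expR_ge0// ltW// partition_fun_gt0. Qed.

Lemma sum_gibbs x : \sum_j gibbs x 0 j = 1.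
Proof.
under eq_bigr do rewrite mxE.
by rewrite -mulr_suml divff// gt_eqF// partition_fun_gt0.
Qed.

Lemma log_lipschitz_soft_max : log_lipschitz (th * be) soft_max.
Proof.
have /andP[t0 t1] := th01.
split=> [x|x h]; first exact: expR_ge0.
have H : partition_fun (x + h) <= expR (be * l1 h) * partition_fun x.
  rewrite mulr_sumr; apply: ler_sum => j _; rewrite mxE mulrDr expRD mulrC.
  rewrite ler_wpM2r ?expR_ge0// ler_expR ler_pM2l//.
  apply: (le_trans (ler_norm _)).
  by rewrite /l1 big_ord1 (bigD1 j)//= lerDl sumr_ge0.
rewrite /soft_max -expRD ler_expR -mulrA -mulrDr ler_pM2l//.
rewrite -[X in _ <= X + _]expRK -lnM ?posrE ?expR_gt0 ?partition_fun_gt0//.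
by rewrite ler_ln ?posrE ?mulr_gt0 ?expR_gt0 ?partition_fun_gt0.
Qed.

Lemma partition_funD x h :
  partition_fun (x + h) = partition_fun x * \sum_j gibbs x 0 j * expR (be * h 0 j).
Proof.
rewrite mulr_sumr; apply: eq_bigr => j _.
rewrite !mxE mulrDr expRD mulrA [_ * (_ / _)]mulrC divfK//.
by rewrite gt_eqF// partition_fun_gt0.
Qed.

(** The gradient of [ln (soft_max x)]. *)
Definition tilt x : V := (th * be) *: gibbs x.
(** Centred so that the average of [dev x j] over the weights [gibbs x 0 j] vanishes. *)
Definition dev x (j : 'I_J) : V := be *: (delta_mx 0 j - gibbs x).

Lemma dotrE (a v : V) : dotr a v = \sum_j a 0 j * v 0 j. Proof. by []. Qed.

Lemma dotrDl (a b v : V) : dotr (a + b) v = dotr a v + dotr b v.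
Proof. by rewrite /dotr -big_split; apply: eq_bigr => j _; rewrite mxE mulrDl. Qed.

Lemma dotrZl (a : K) (b v : V) : dotr (a *: b) v = a * dotr b v.
Proof. by rewrite /dotr mulr_sumr; apply: eq_bigr => j _; rewrite mxE mulrA. Qed.

Lemma dotr_delta (j : 'I_J) v : dotr (delta_mx 0 j) v = v 0 j.
Proof.
rewrite /dotr (bigD1 j)//= mxE !eqxx mul1r big1 ?addr0// => i /negPf ij.
by rewrite mxE eqxx ij mul0r.
Qed.

Lemma dotr_dev x j v : dotr (dev x j) v = be * (v 0 j - dotr (gibbs x) v).
Proof. by rewrite dotrZl dotrDl -scaleN1r dotrZl dotr_delta mulN1r. Qed.

(** The first-order change is factored out as the exponential of [tilt x]. By the centring of [dev],
    the linear terms of S cancel: hence [1 <= S], and S - 1 is of second order in h. *)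
Lemma soft_maxD x h (S := \sum_j gibbs x 0 j * expR (dotr (dev x j) h)) :
  1 <= S /\ soft_max (x + h) = soft_max x * expR (dotr (tilt x) h) * expR (th * ln S).
Proof.
have S1 : 1 <= S.
  apply: (@le_trans _ _ (\sum_j gibbs x 0 j * (1 + dotr (dev x j) h))); last first.
    by apply: ler_sum => j _; rewrite ler_wpM2l ?gibbs_ge0// expR_ge1Dx.
  under eq_bigr do rewrite mulrDr mulr1 dotr_dev.
  rewrite big_split /= sum_gibbs lerDl.
  under eq_bigr do rewrite mulrCA mulrBr.
  by rewrite -mulr_sumr sumrB -mulr_suml sum_gibbs mul1r -dotrE subrr mulr0.
split=> //; have S0 : 0 < S by lra.
have m0 := partition_fun_gt0 x.
rewrite /soft_max partition_funD.
have -> : \sum_j gibbs x 0 j * expR (be * h 0 j) = expR (be * dotr (gibbs x) h) * S.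
  rewrite mulr_sumr; apply: eq_bigr => j _; rewrite mulrCA -expRD; congr (_ * expR _).
  by rewrite dotr_dev; ring.
rewrite lnM ?posrE ?mulr_gt0 ?expR_gt0// lnM ?posrE ?mulr_gt0 ?expR_gt0// expRK.
by rewrite -!expRD dotrZl; congr expR; ring.
Qed.

(** Weights and forms that write 1 - th + th S as a sum of exponentials, after multiplication by the
    common factor of [tilt x]; [None] stands for the constant term. *)
Definition upper_weight x (i : option 'I_J) : K :=
  if i is Some j then th * gibbs x 0 j else 1 - th.
Definition upper_form x (i : option 'I_J) : V :=
  if i is Some j then tilt x + dev x j else tilt x.

(** Since 1 + th (S - 1) - (S - 1)^2 = (1 - th) + (2 + th) S - (1 + S^2), the positive part gives
    these weights. The part 1 + S^2 is moved to the other side as [corr_weight], because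
    log-Lipschitz functions must be nonnegative. *)
Definition lower_weight x (i : option 'I_J) : K :=
  if i is Some j then (2 + th) * gibbs x 0 j else 1 - th.
Definition corr_weight x (i : option ('I_J * 'I_J)) : K :=
  if i is Some (j, k) then gibbs x 0 j * gibbs x 0 k else 1.
Definition corr_form x (i : option ('I_J * 'I_J)) : V :=
  if i is Some (j, k) then tilt x + dev x j + dev x k else tilt x.

Lemma big_option (I : finType) (F : option I -> K) :
  \sum_i F i = F None + \sum_i F (Some i).
Proof.
rewrite (bigD1 None)//=; congr (_ + _).
rewrite (reindex_omap (@Some I) id)/=; first by apply: eq_bigl => i; rewrite eqxx.
by case.
Qed.

Lemma soft_max_upper x y : soft_max y <= soft_max x *
  \sum_i upper_weight x i * expR (dotr (upper_form x i) (y - x)).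
Proof.
have [S1 E] := soft_maxD x (y - x); rewrite addrC subrK in E; rewrite {}E.
set S := (\sum_j _) in S1 *; have S0 : 0 < S by lra.
rewrite -mulrA ler_wpM2l ?expR_ge0// big_option /=.
have -> : \sum_i th * gibbs x 0 i * expR (dotr (tilt x + dev x i) (y - x)) =
    th * S * expR (dotr (tilt x) (y - x)).
  rewrite mulrAC mulr_sumr; apply: eq_bigr => j _; rewrite dotrDl expRD; ring.
rewrite -mulrDl [X in X <= _]mulrC ler_wpM2r ?expR_ge0//.
have := expR_le_interp (ln S) th01.
by rewrite (lnK (x := S))// posrE.
Qed.

Lemma soft_max_lower x y :
  soft_max x * \sum_i lower_weight x i * expR (dotr (upper_form x i) (y - x)) <=
  soft_max y + soft_max x *
  \sum_i corr_weight x i * expR (dotr (corr_form x i) (y - x)).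
Proof.
have [S1 E] := soft_maxD x (y - x); rewrite addrC subrK in E; rewrite {}E.
set S := (\sum_j _) in S1 *; have S0 : 0 < S by lra.
rewrite -[X in _ <= X + _]mulrA -mulrDr ler_wpM2l ?expR_ge0//.
rewrite [X in _ <= _ + X]big_option big_option [lower_weight x None]/=.
rewrite [corr_weight x None]/= [upper_form x None]/= [corr_form x None]/=.
set e := expR (dotr (tilt x) _).
have -> : \sum_i lower_weight x (Some i) * expR (dotr (upper_form x (Some i)) (y - x)) =
    (2 + th) * e * S.
  rewrite mulr_sumr; apply: eq_bigr => j _; rewrite /= dotrDl expRD -/e; ring.
have EE : \sum_i corr_weight x (Some i) * expR (dotr (corr_form x (Some i)) (y - x)) =
    e * (S * S).
  rewrite [X in _ = e * X]mulr_suml mulr_sumr.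
  under [RHS]eq_bigr do rewrite mulr_sumr mulr_sumr.
  rewrite pair_big /=; apply: eq_bigr => -[j k] _ /=.
  by rewrite !dotrDl !expRD -/e; ring.
rewrite {}EE.
have e0 : 0 <= e by exact: expR_ge0.
have := ler_wpM2l e0 (expR_ln_ge th01 S1).
move: (expR (th * ln S)) => f; lra.
Qed.

End SoftMax.

(** * Comparison of Gaussian processes *)

Section Slepian.
Variables (K : realType) (J : nat) (be th : K).
Hypotheses (J0 : (0 < J)%N) (be0 : 0 < be) (th01 : 0 < th < 1).
Local Notation V := 'rV[K]_J.
Local Notation F := (@soft_max K J be th).
Local Notation p x := (gibbs be x).
Implicit Types (x y v : V) (vs ws : seq V) (t : K).

Let th0 : 0 < th. Proof. by case/andP: th01. Qed.
Let th1 : th < 1. Proof. by case/andP: th01. Qed.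

Lemma l1D m n (A B : 'M[K]_(m, n)) : l1 (A + B) <= l1 A + l1 B.
Proof.
rewrite /l1 -big_split; apply: ler_sum => i _; rewrite -big_split.
by apply: ler_sum => j _; rewrite mxE ler_normD.
Qed.

Lemma dotr_le_l1 (a v : V) : `|dotr a v| <= l1 a * l1 v.
Proof.
apply: (le_trans (ler_norm_sum _ _ _)).
rewrite /l1 !big_ord1 mulr_suml; apply: ler_sum => j _; rewrite normrM.
by rewrite ler_wpM2l// (bigD1 j)//= lerDl sumr_ge0.
Qed.

Lemma l1_gibbs x : l1 (p x) = 1.
Proof.
rewrite /l1 big_ord1 -(sum_gibbs be J0 x); apply: eq_bigr => j _.
by rewrite ger0_norm// gibbs_ge0.
Qed.

Lemma l1_delta (j : 'I_J) : l1 (delta_mx 0 j : V) = 1.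
Proof.
rewrite /l1 big_ord1 (bigD1 j)//= mxE !eqxx normr1 big1 ?addr0// => i /negPf ij.
by rewrite mxE eqxx ij normr0.
Qed.

Lemma l1_dev x j : l1 (dev be x j) <= 2 * be.
Proof.
rewrite l1Z gtr0_norm// mulrC ler_pM2r//.
by apply: (le_trans (l1D _ _)); rewrite l1N l1_gibbs l1_delta.
Qed.

Lemma l1_tilt x : l1 (tilt be th x) <= be.
Proof.
rewrite l1Z l1_gibbs mulr1 ger0_norm; first by rewrite ler_piMl ?ltW.
by rewrite mulr_ge0 ?ltW.
Qed.

Lemma l1_upper_form x i : l1 (upper_form be th x i) <= 5 * be.
Proof.
case: i => [j|]; rewrite [upper_form _ _ _ _]/=; last first.
  by have := l1_tilt x; move: be0; lra.
by have := l1D (tilt be th x) (dev be x j); have := l1_tilt x; have := l1_dev x j; move: be0; lra.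
Qed.

Lemma l1_corr_form x i : l1 (corr_form be th x i) <= 5 * be.
Proof.
case: i => [[j k]|]; rewrite [corr_form _ _ _ _]/=; last first.
  by have := l1_tilt x; move: be0; lra.
have := l1D (tilt be th x + dev be x j) (dev be x k).
have := l1D (tilt be th x) (dev be x j).
have := l1_tilt x; have := l1_dev x j; have := l1_dev x k; move: be0; lra.
Qed.

(** Here 5 = 1 + 2 + 2: a form in use consists of one [tilt], of l1 norm at most be, and at most two
    [dev], each of l1 norm at most 2 be. *)
Definition form_bound vs : K := \sum_(v <- vs) (5 * be * l1 v) ^+ 2.

Lemma qform_le vs (a : V) : l1 a <= 5 * be -> 0 <= qform vs a <= form_bound vs.
Proof.
move=> la; apply/andP; split; first by apply: sumr_ge0 => v _; exact: sqr_ge0.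
apply: ler_sum => v _; rewrite -[leLHS]real_normK ?num_real// lerXn2r ?nnegrE//.
  by rewrite mulr_ge0 ?l1_ge0// mulr_ge0// ltW.
by apply: (le_trans (dotr_le_l1 _ _)); rewrite ler_wpM2r// l1_ge0.
Qed.

Definition cov vs (j k : 'I_J) : K := \sum_(v <- vs) v 0 j * v 0 k.

(** The Hessian of [soft_max] at x, divided by its value and contracted with [cov vs]; half of it is
    the logarithmic derivative at time 0 of the convolution. The factor - (1 - th) of the
    off-diagonal covariances gives the direction of the comparison. *)
Definition second_order vs x : K := th * be ^+ 2 *
  (\sum_j p x 0 j * cov vs j j -
   (1 - th) * \sum_j \sum_k p x 0 j * p x 0 k * cov vs j k).

Lemma second_orderE vs x : second_order vs x = \sum_(v <- vs) th * be ^+ 2 *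
  (\sum_j p x 0 j * v 0 j ^+ 2 - (1 - th) * dotr (p x) v ^+ 2).
Proof.
rewrite /second_order -mulr_sumr; congr (_ * _).
rewrite sumrB -mulr_sumr; congr (_ - _ * _).
  rewrite exchange_big /=; apply: eq_bigr => j _; rewrite mulr_sumr.
  by apply: eq_bigr => v _; rewrite expr2.
under eq_bigr do (under eq_bigr do rewrite mulr_sumr; rewrite exchange_big /=).
rewrite exchange_big /=; apply: eq_bigr => v _.
rewrite expr2 mulr_suml; apply: eq_bigr => j _; rewrite mulr_sumr.
by apply: eq_bigr => k _; rewrite mulrACA.
Qed.

Lemma sum_gibbs_sqr x v (a : K) : \sum_j p x 0 j * (a + be * v 0 j) ^+ 2 =
  a ^+ 2 + 2 * a * be * dotr (p x) v + be ^+ 2 * \sum_j p x 0 j * v 0 j ^+ 2.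
Proof.
have -> : a ^+ 2 = \sum_j p x 0 j * a ^+ 2.
  by rewrite -mulr_suml sum_gibbs ?mul1r.
rewrite dotrE 2!mulr_sumr.
by rewrite -!big_split /=; apply: eq_bigr => j _; ring.
Qed.

Lemma upper_second_order vs x :
  \sum_i upper_weight be th x i * qform vs (upper_form be th x i) =
  second_order vs x.
Proof.
under eq_bigr do rewrite mulr_sumr.
rewrite exchange_big second_orderE; apply: eq_bigr => v _.
rewrite big_option /=.
set m := dotr (p x) v.
under eq_bigr => j _.
  rewrite dotrDl dotr_dev dotrZl -/m -mulrA.
  rewrite (_ : _ + be * (_ - m) = ((th - 1) * be * m) + be * v 0 j); last by ring.
  over.
by rewrite -mulr_sumr sum_gibbs_sqr -/m dotrZl -/m; ring.
Qed.

(** Together with [upper_second_order]: the upper and the lower bound have exactly the same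
    second-order term, so each time step loses only a quantity quadratic in t. *)
Lemma lower_second_order vs x :
  \sum_i lower_weight be th x i * qform vs (upper_form be th x i) -
  \sum_i corr_weight be x i * qform vs (corr_form be th x i) =
  second_order vs x.
Proof.
under eq_bigr do rewrite mulr_sumr.
under [X in _ - X]eq_bigr do rewrite mulr_sumr.
rewrite exchange_big [X in _ - X]exchange_big -sumrB second_orderE.
apply: eq_bigr => v _; rewrite /= big_option [X in _ - X]big_option /=.
set m := dotr (p x) v; set q := \sum_j p x 0 j * v 0 j ^+ 2.
under eq_bigr => j _.
  rewrite dotrDl dotr_dev dotrZl -/m -mulrA.
  rewrite (_ : _ + be * (_ - m) = ((th - 1) * be * m) + be * v 0 j); last by ring.
  over.
rewrite -mulr_sumr sum_gibbs_sqr -/m -/q dotrZl -/m.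
have -> : \sum_i corr_weight be x (Some i) * dotr (corr_form be th x (Some i)) v ^+ 2
    = ((th - 2) * be * m) ^+ 2 + 4 * ((th - 2) * be * m) * be * m +
      2 * be ^+ 2 * q + 2 * be ^+ 2 * m ^+ 2.
  transitivity (\sum_j p x 0 j * \sum_k p x 0 k *
      (((th - 2) * be * m + be * v 0 j) + be * v 0 k) ^+ 2).
    under [RHS]eq_bigr do rewrite mulr_sumr.
    rewrite pair_big /=; apply: eq_bigr => -[j k] _ /=.
    rewrite !dotrDl !dotr_dev dotrZl -/m mulrA; congr (_ * _ ^+ 2); ring.
  set c := (th - 2) * be * m.
  transitivity (\sum_j (p x 0 j * (c + be * v 0 j) ^+ 2 +
      (2 * be * m * c + be ^+ 2 * q) * p x 0 j + 2 * be ^+ 2 * m * (p x 0 j * v 0 j))).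
    by apply: eq_bigr => j _; rewrite sum_gibbs_sqr -/m -/q; ring.
  rewrite !big_split /= sum_gibbs_sqr -/m -/q -!mulr_sumr.
  by rewrite sum_gibbs// -dotrE -/m; ring.
by rewrite /=; ring.
Qed.

Lemma upper_weight_ge0 x i : 0 <= upper_weight be th x i.
Proof.
case: i => [j|]; rewrite [upper_weight _ _ _ _]/=; last by rewrite subr_ge0 ltW.
by rewrite mulr_ge0 ?(ltW th0) ?gibbs_ge0.
Qed.

Lemma lower_weight_ge0 x i : 0 <= lower_weight be th x i.
Proof.
case: i => [j|]; rewrite [lower_weight _ _ _ _]/=; last by rewrite subr_ge0 ltW.
by rewrite mulr_ge0 ?addr_ge0 ?(ltW th0) ?gibbs_ge0.
Qed.

Lemma corr_weight_ge0 x i : 0 <= corr_weight be x i.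
Proof.
by case: i => [[j k]|]; rewrite [corr_weight _ _ _]/= ?mulr_ge0 ?gibbs_ge0.
Qed.

Lemma sum_upper_weight x : \sum_i upper_weight be th x i = 1.
Proof. by rewrite big_option /= -mulr_sumr sum_gibbs//; ring. Qed.

Lemma sum_lower_weight x : \sum_i lower_weight be th x i = 3.
Proof. by rewrite big_option /= -mulr_sumr sum_gibbs//; ring. Qed.

Lemma sum_corr_weight x : \sum_i corr_weight be x i = 2.
Proof.
rewrite big_option.
have -> : \sum_i corr_weight be x (Some i) = \sum_j \sum_k p x 0 j * p x 0 k.
  by rewrite pair_big; apply: eq_bigr => -[].
under eq_bigr do rewrite -mulr_sumr sum_gibbs// mulr1.
by rewrite sum_gibbs//=; ring.
Qed.

Lemma gauss_ops_soft_max_upper t vs x : 0 < t ->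
  gauss_ops t vs F x <= F x *
    \sum_i upper_weight be th x i * expR (t * qform vs (upper_form be th x i) / 2).
Proof.
move=> t0; have LF := log_lipschitz_soft_max J0 be0 th01.
have LU := log_lipschitz_expsum (upper_form be th x) x (upper_weight_ge0 x).
have F0 : 0 <= F x by exact: expR_ge0.
rewrite -(gauss_ops_expsum vs _ x t0 (upper_weight_ge0 x)).
rewrite -[leRHS](congr1 (fun f => f x) (gauss_opsZ vs t0 F0 LU)).
apply: (gauss_ops_monotone vs t0 LF (log_lipschitzZ F0 LU)) => y.
exact: soft_max_upper.
Qed.

Lemma gauss_ops_soft_max_lower t vs x : 0 < t ->
  F x * \sum_i lower_weight be th x i * expR (t * qform vs (upper_form be th x i) / 2)
  <= gauss_ops t vs F x +
  F x * \sum_i corr_weight be x i * expR (t * qform vs (corr_form be th x i) / 2).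
Proof.
move=> t0; have LF := log_lipschitz_soft_max J0 be0 th01.
have LU := log_lipschitz_expsum (upper_form be th x) x (lower_weight_ge0 x).
have LC := log_lipschitz_expsum (corr_form be th x) x (corr_weight_ge0 x).
have F0 : 0 <= F x by exact: expR_ge0.
rewrite -(gauss_ops_expsum vs _ x t0 (lower_weight_ge0 x)).
rewrite -(gauss_ops_expsum vs _ x t0 (corr_weight_ge0 x)).
rewrite -[leLHS](congr1 (fun f => f x) (gauss_opsZ vs t0 F0 LU)).
rewrite -[X in _ <= _ + X](congr1 (fun f => f x) (gauss_opsZ vs t0 F0 LC)).
set c := \sum_i l1 (corr_form be th x i) in LC *.
have LFc : log_lipschitz (th * be + c) F.
  by apply: log_lipschitzW LF; rewrite lerDl sumr_ge0// => i _; exact: l1_ge0.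
have LCc : log_lipschitz (th * be + c) (fun y => F x *
   \sum_i corr_weight be x i * expR (dotr (corr_form be th x i) (y - x))).
  apply: log_lipschitzW (log_lipschitzZ F0 LC).
  by rewrite lerDr mulr_ge0 ?ltW.
rewrite -[leRHS](congr1 (fun f => f x) (gauss_opsD vs t0 LFc LCc)).
apply: (gauss_ops_monotone vs t0 (log_lipschitzZ F0 LU) (log_lipschitzD LFc LCc)) => y.
exact: soft_max_lower.
Qed.

Lemma sum_expR_le (I : finType) (w Q : I -> K) t B : 0 < t -> (forall i, 0 <= w i) ->
  (forall i, 0 <= Q i <= B) -> t * B / 2 <= 1 / 4 ->
  \sum_i w i * expR (t * Q i / 2) <=
  \sum_i w i + t / 2 * (\sum_i w i * Q i) + 2 * (t * B / 2) ^+ 2 * \sum_i w i.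
Proof.
move=> t0 w0 QB tB; rewrite 2!mulr_sumr -!big_split /=; apply: ler_sum => i _.
have /andP[Q0 QB'] := QB i.
have u0 : 0 <= t * Q i / 2 by rewrite divr_ge0// mulr_ge0// ltW.
have uB : t * Q i / 2 <= t * B / 2 by rewrite ler_pM2r// ler_pM2l.
have H : t * Q i / 2 <= 1 / 2 by lra.
apply: (le_trans (ler_wpM2l (w0 i) (expR_le1D2sqr u0 H))).
have : (t * Q i / 2) ^+ 2 <= (t * B / 2) ^+ 2 by rewrite lerXn2r// nnegrE; lra.
move=> /(ler_wpM2l (w0 i)).
move: ((t * B / 2) ^+ 2) => b; lra.
Qed.

Lemma sum_expR_ge (I : finType) (w Q : I -> K) t : (forall i, 0 <= w i) ->
  \sum_i w i + t / 2 * (\sum_i w i * Q i) <= \sum_i w i * expR (t * Q i / 2).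
Proof.
move=> w0; rewrite mulr_sumr -big_split /=; apply: ler_sum => i _.
have := ler_wpM2l (w0 i) (expR_ge1Dx (t * Q i / 2)); lra.
Qed.

Section Comparison.
Variables vs ws : seq V.
Hypothesis cov_diag : forall j, cov vs j j = cov ws j j.
Hypothesis cov_le : forall j k, cov ws j k <= cov vs j k.

Let B := form_bound vs + form_bound ws.

Lemma second_order_le x : second_order vs x <= second_order ws x.
Proof.
rewrite /second_order ler_pM2l ?mulr_gt0 ?exprn_gt0//.
under eq_bigr do rewrite cov_diag.
rewrite lerD2l lerN2 ler_pM2l ?subr_gt0//.
apply: ler_sum => j _; apply: ler_sum => k _.
by rewrite ler_wpM2l// mulr_ge0 ?gibbs_ge0.
Qed.

Lemma form_bound_ge0 us : 0 <= form_bound us.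
Proof. by apply: sumr_ge0 => v _; exact: sqr_ge0. Qed.

(** With e = (t B / 2)^2 and A half of t times the second-order term of vs, the upper bound is 1 + A
    + 2 e, and the lower bound for ws is at least 1 + A - 4 e. *)
Lemma gauss_ops_soft_max_step t x : 0 < t -> t * B / 2 <= 1 / 4 ->
  gauss_ops t vs F x <= (1 + 12 * (t * B / 2) ^+ 2) * gauss_ops t ws F x.
Proof.
move=> t0 tB; have Bv := form_bound_ge0 vs; have Bw := form_bound_ge0 ws.
have QB us a : us = vs \/ us = ws -> l1 a <= 5 * be -> 0 <= qform us a <= B.
  move=> H /(qform_le us) /andP[-> H']; apply: (le_trans H').
  by rewrite /B; case: H => ->; lra.
have U := sum_expR_le t0 (upper_weight_ge0 x)
  (fun i => QB vs _ (or_introl erefl) (l1_upper_form x i)) tB.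
have C := sum_expR_le t0 (corr_weight_ge0 x)
  (fun i => QB ws _ (or_intror erefl) (l1_corr_form x i)) tB.
have L := sum_expR_ge (fun i => qform ws (upper_form be th x i)) t (lower_weight_ge0 x).
have gU := gauss_ops_soft_max_upper vs x t0.
have gL := gauss_ops_soft_max_lower ws x t0.
move: U C L gU gL; rewrite sum_upper_weight sum_lower_weight sum_corr_weight.
rewrite upper_second_order; have := lower_second_order ws x.
have := second_order_le x.
have F0 : 0 < F x by exact: expR_gt0.
have AV0 : 0 <= second_order vs x.
  rewrite -upper_second_order; apply: sumr_ge0 => i _; rewrite mulr_ge0 ?upper_weight_ge0//.
  by case/andP: (QB vs _ (or_introl erefl) (l1_upper_form x i)).
have e1 : (t * B / 2) ^+ 2 <= 1 / 16.
  have -> : 1 / 16 = (1 / 4) ^+ 2 :> K by field.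
  have B0 : 0 <= B by rewrite /B; lra.
  have tB0 : 0 <= t * B / 2 by rewrite divr_ge0// mulr_ge0// ltW.
  by rewrite lerXn2r// nnegrE; lra.
have e0 := sqr_ge0 (t * B / 2).
move: ((t * B / 2) ^+ 2) e0 e1 => e e0 e1.
set LQ := \sum_i _ * qform _ _; set CQ := \sum_i _ * qform _ _.
set US := \sum_i _ * expR _; set CS := \sum_i _ * expR _; set LS := \sum_i _ * expR _.
move=> A1 A2 U C L gU gL.
have tA : t / 2 * second_order vs x <= t / 2 * second_order ws x.
  by rewrite ler_wpM2l// divr_ge0// ltW.
have tA2 : t / 2 * LQ = t / 2 * CQ + t / 2 * second_order ws x by rewrite -A2; ring.
have tA0 : 0 <= t / 2 * second_order vs x by rewrite mulr_ge0// divr_ge0// ltW.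
apply: (le_trans gU).
have k0 : 0 <= 1 + 12 * e by lra.
have gL' : F x * (LS - CS) <= gauss_ops t ws F x by rewrite mulrBr; lra.
apply: le_trans (ler_wpM2l k0 gL').
rewrite mulrCA ler_wpM2l ?(ltW F0)//.
have H1 : LS - CS >= 1 + t / 2 * second_order vs x - 4 * e by lra.
apply: le_trans (ler_wpM2l k0 H1).
(* Multiplying 1 + A - 4 e by 1 + 12 e gains 8 e + 12 e A - 48 e^2, and 48 e^2 <= 3 e, so the
   required 2 e is covered. *)
have : 0 <= e * (1 / 16 - e) by rewrite mulr_ge0//; lra.
have : 0 <= e * (t / 2 * second_order vs x) by rewrite mulr_ge0.
move: (t / 2 * second_order vs x) U => A U; lra.
Qed.

(* The factor 2 could be removed by letting the number of steps tend to
   infinity. *)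
Lemma gauss_ops_slepian t x : 0 < t ->
  gauss_ops t vs F x <= 2 * gauss_ops t ws F x.
Proof.
move=> t0; have Bv := form_bound_ge0 vs; have Bw := form_bound_ge0 ws.
have LF := log_lipschitz_soft_max J0 be0 th01.
have B0 : 0 <= B by rewrite /B; lra.
(* The first term makes each step short enough for [gauss_ops_soft_max_step]; the second makes the
   exponents of all steps sum to at most 1 / 2, and exp (1 / 2) <= 2. *)
pose y := 2 * t * B + 6 * t ^+ 2 * B ^+ 2.
have y0 : 0 <= y.
  by rewrite /y addr_ge0// !mulr_ge0 ?sqr_ge0// ltW.
have [n yn] : exists n : nat, y < n.+1%:R.
  by exists (Num.bound y); apply: (lt_trans (archi_boundP y0)); rewrite ltr_nat.
have n0 : 0 < n.+1%:R :> K by rewrite ltr0n.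
pose s := t / n.+1%:R.
have s0 : 0 < s by rewrite divr_gt0.
have sE : n.+1%:R * s = t by rewrite mulrC divfK// gt_eqF.
have tB0 : 0 <= t * B by rewrite mulr_ge0// ltW.
have t2 : 0 <= t ^+ 2 * B ^+ 2 by rewrite mulr_ge0 ?sqr_ge0.
have sB : s * B / 2 <= 1 / 4.
  suff : s * B <= 1 / 2 by lra.
  rewrite /s mulrAC ler_pdivrMr//; move: yn; rewrite /y; lra.
have step := fun z => gauss_ops_soft_max_step z s0 sB.
have k0 : 0 <= 1 + 12 * (s * B / 2) ^+ 2 by have := sqr_ge0 (s * B / 2); lra.
have := gauss_ops_iter_le n.+1 s0 k0 LF step x.
rewrite !(iter_gauss_ops _ _ s0 LF) sE => /le_trans; apply.
have [G0 _] := log_lipschitz_gauss_ops ws t0 LF.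
rewrite ler_wpM2r//.
have eE : (s * B / 2) ^+ 2 = t ^+ 2 * B ^+ 2 / 4 / n.+1%:R / n.+1%:R.
  by rewrite /s; field; rewrite gt_eqF.
apply: (@le_trans _ _ (expR (12 * (s * B / 2) ^+ 2) ^+ n.+1)).
  by rewrite lerXn2r ?nnegrE ?expR_ge0// expR_ge1Dx.
rewrite -expRM_natl.
have u0 : 0 <= n.+1%:R * (12 * (s * B / 2) ^+ 2).
  by rewrite mulr_ge0 ?(ltW n0)// mulr_ge0// sqr_ge0.
have u1 : n.+1%:R * (12 * (s * B / 2) ^+ 2) <= 1 / 2.
  have -> : n.+1%:R * (12 * (s * B / 2) ^+ 2) = 3 * (t ^+ 2 * B ^+ 2) / n.+1%:R.
    by rewrite eE; field; rewrite gt_eqF.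
  by rewrite ler_pdivrMr//; move: yn; rewrite /y -mulrA; lra.
apply: (le_trans (expR_le1D2sqr u0 u1)).
move: (n.+1%:R * _) u0 u1 => u u0 u1.
have : 0 <= (1 / 2 - u) * u by rewrite mulr_ge0//; lra.
lra.
Qed.

End Comparison.
End Slepian.

Section GaussOpsBound.
Variables (K : realType) (J : nat).
Local Notation V := 'rV[K]_J.
Implicit Types (t c k : K) (x v : V) (us : seq V).

Lemma gauss_op_le_sqr t v c (f : V -> K) x k ka : 0 < t -> 2 * ka * t < 1 ->
  0 <= k -> log_lipschitz c f ->
  (forall z, f (x + z *: v) <= k * expR (ka * z ^+ 2)) ->
  gauss_op t v f x <= k * (Num.sqrt (1 - 2 * ka * t))^-1.
Proof.
move=> t0 kt k0 Lf H; rewrite -lee_fin (gauss_opE v x t0 Lf).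
have mE : measurable_fun [set: K] (fun z : K => (expR (ka * z ^+ 2))%:E).
  by apply/measurable_EFinP/measurableT_comp => //; apply: measurable_funM => //.
have -> : (k * (Num.sqrt (1 - 2 * ka * t))^-1)%:E =
    (\int[normal_prob 0 (Num.sqrt t)]_z (k%:E * (expR (ka * z ^+ 2))%:E))%E.
  rewrite ge0_integralZl ?integral_normal_expR_sqr//.
apply: ge0_le_integral => //.
- by move=> z _; rewrite lee_fin; case: Lf.
- exact: measurable_line Lf.
- by apply: emeasurable_funM => //.
- by move=> z _; rewrite -EFinM lee_fin.
Qed.

(** The directions are integrated one at a time, each contributing one factor. Coefficients are
    indexed by [nat] so that the induction can prepend a coordinate. *)
Lemma gauss_ops_le_sqr t us c (f : V -> K) x k ka : 0 < t -> 2 * ka * t < 1 ->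
  0 <= k -> log_lipschitz c f ->
  (forall z : nat -> K, f (x + \sum_(i < size us) z i *: us`_i) <=
     k * expR (ka * \sum_(i < size us) z i ^+ 2)) ->
  gauss_ops t us f x <= k * ((Num.sqrt (1 - 2 * ka * t))^-1) ^+ size us.
Proof.
move=> t0 kt; elim: us x k => [|u us IH] x k k0 Lf H.
  by have := H (fun=> 0); rewrite /= !big_ord0 addr0 mulr0 expR0 expr0.
rewrite /= exprS mulrCA mulrC.
set A := _ ^+ size us in IH *.
have A0 : 0 <= A by rewrite exprn_ge0// invr_ge0 sqrtr_ge0.
rewrite -mulrA mulrA; apply: (gauss_op_le_sqr t0 kt) => //.
- by rewrite mulr_ge0.
- exact: log_lipschitz_gauss_ops Lf.
move=> z; rewrite mulrAC; apply: IH => //.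
  by rewrite mulr_ge0 ?expR_ge0.
move=> w; have := H (fun i => if i is i'.+1 then w i' else z).
rewrite /= !big_ord_recl /= addrA => /le_trans; apply.
by rewrite -mulrA -expRD mulrDr.
Qed.

End GaussOpsBound.

(** * Chevet's inequality for finitely many pairs of unit vectors *)

Section Chevet.
Variable K : realType.

(** For a Gaussian vector g in dimension M with variance t, la |g| <= ka |g|^2 + la^2 / (4 ka), so
    the left-hand side dominates the mean of exp (la |g|). The witness ka makes 1 - 2 ka t equal to
    1 / (1 + a), where a = la sqrt (t / M); hence a M = la sqrt (t M). *)
Lemma chi_bound (M : nat) (t a la : K) : 0 < t -> 0 < a -> 0 < la ->
  la ^+ 2 * t = a ^+ 2 * M%:R ->
  exists2 ka : K, 0 < ka /\ 2 * ka * t < 1 &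
  expR (la ^+ 2 / (4 * ka)) * ((Num.sqrt (1 - 2 * ka * t))^-1) ^+ M <=
  expR (a * M%:R + la ^+ 2 * t / 2).
Proof.
move=> t0 a0 l0 E; have a1 : 0 < 1 + a by lra.
exists (a / (1 + a) / (2 * t)).
  split; first by rewrite !divr_gt0// mulr_gt0.
  have -> : 2 * (a / (1 + a) / (2 * t)) * t = a / (1 + a).
    by field; rewrite !gt_eqF.
  by rewrite ltr_pdivrMr//; lra.
have -> : 1 - 2 * (a / (1 + a) / (2 * t)) * t = (1 + a)^-1.
  by field; rewrite !gt_eqF.
have -> : la ^+ 2 / (4 * (a / (1 + a) / (2 * t))) = a * M%:R * (1 + a) / 2.
  have -> : la ^+ 2 / (4 * (a / (1 + a) / (2 * t))) = la ^+ 2 * t * (1 + a) / (2 * a).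
    by field; rewrite !gt_eqF.
  by rewrite E; field; rewrite gt_eqF.
rewrite sqrtrV ?(ltW a1)// invrK.
have : Num.sqrt (1 + a) <= expR (a / 2).
  rewrite -(@ler_pXn2r _ 2) ?nnegrE ?sqrtr_ge0 ?expR_ge0// sqr_sqrtr ?(ltW a1)//.
  rewrite -expRM_natl (_ : 2 * (a / 2) = a); last by field.
  exact: expR_ge1Dx.
move=> /(lerXn2r M); rewrite !nnegrE sqrtr_ge0 expR_ge0 => /(_ isT isT) H.
apply: (le_trans (ler_wpM2l (expR_ge0 _) H)).
rewrite -expRM_natl -expRD ler_expR E.
suff -> : a * M%:R * (1 + a) / 2 + M%:R * (a / 2) = a * M%:R + a ^+ 2 * M%:R / 2 by [].
by field.
Qed.

Variables (M N J : nat) (x : 'I_J -> 'I_M -> K) (y : 'I_J -> 'I_N -> K).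
Hypotheses (M0 : (0 < M)%N) (N0 : (0 < N)%N) (J0 : (0 < J)%N).
Hypotheses (x1 : forall j, \sum_a x j a ^+ 2 = 1) (y1 : forall j, \sum_b y j b ^+ 2 = 1).
Local Notation V := 'rV[K]_J.

(** The coefficients of the entry (a, b) of a matrix Z in the family of values x_j Z y_j^T. *)
Definition bilinear_dir (ab : 'I_M * 'I_N) : V := \row_j (x j ab.1 * y j ab.2).
Definition bilinear_dirs : seq V := [seq bilinear_dir ab | ab <- enum {: 'I_M * 'I_N}].
Definition left_dirs : seq V := [seq \row_j x j a | a <- enum 'I_M].
Definition right_dirs : seq V := [seq \row_j y j b | b <- enum 'I_N].

Lemma cov_bilinear j k : cov (const_mx 1 :: bilinear_dirs) j k =
  1 + (\sum_a x j a * x k a) * (\sum_b y j b * y k b).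
Proof.
rewrite /cov big_cons !mxE mulr1 big_map big_enum /=; congr (_ + _).
rewrite mulr_suml; under [RHS]eq_bigr do rewrite mulr_sumr.
by rewrite pair_big /=; apply: eq_bigr => -[a b] _; rewrite !mxE /= mulrACA.
Qed.

Lemma cov_linear j k : cov (left_dirs ++ right_dirs) j k =
  (\sum_a x j a * x k a) + (\sum_b y j b * y k b).
Proof.
rewrite /cov big_cat /=.
by congr (_ + _); rewrite big_map big_enum; apply: eq_bigr => i _; rewrite !mxE.
Qed.

Lemma unit_dot_le1 (I : finType) (f g : I -> K) :
  \sum_i f i ^+ 2 = 1 -> \sum_i g i ^+ 2 = 1 -> \sum_i f i * g i <= 1.
Proof.
move=> f1 g1; have : 0 <= \sum_i (f i - g i) ^+ 2 by apply: sumr_ge0 => i _; exact: sqr_ge0.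
have -> : \sum_i (f i - g i) ^+ 2 =
    \sum_i f i ^+ 2 + \sum_i g i ^+ 2 - 2 * \sum_i f i * g i.
  by rewrite mulr_sumr -big_split -sumrB; apply: eq_bigr => i _ /=; ring.
rewrite f1 g1; lra.
Qed.

Variables (t la : K).
Hypotheses (t0 : 0 < t) (la0 : 0 < la).
(** Small enough that J^th <= exp (1 / 4) <= 2, by ln J <= J. With [be = la / th], the soft maximum
    then lies between exp (la max) and twice that value. *)
Let th : K := (4 * J%:R)^-1.
Let be : K := la / th.
Local Notation F := (@soft_max K J be th).

Lemma chevet_exponent : [/\ 0 < th < 1, 0 < be & th * be = la].
Proof.
have J1 : 1 <= J%:R :> K by rewrite ler1n.
have th0 : 0 < th by rewrite invr_gt0; lra.
rewrite th0 /be divr_gt0// invf_lt1; last by lra.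
split=> //; first by lra.
by rewrite mulrC divfK// gt_eqF.
Qed.

Lemma soft_max_le (v : V) m : (forall j, la * v 0 j <= m) -> F v <= 2 * expR m.
Proof.
move=> H; have [th01 be0 tb] := chevet_exponent; have /andP[th0 _] := th01.
have Z0 := partition_fun_gt0 be J0 v.
have J1 : 1 <= J%:R :> K by rewrite ler1n.
have Jp : 0 < J%:R :> K by lra.
have Zle : partition_fun be v <= J%:R * expR (m / th).
  rewrite /partition_fun (_ : J%:R * _ = \sum_(j < J) expR (m / th)); last first.
    by rewrite sumr_const card_ord mulr_natl.
  apply: ler_sum => j _; rewrite ler_expR ler_pdivlMr//.
  by rewrite mulrAC [be * th]mulrC tb.
have : ln (partition_fun be v) <= ln (J%:R : K) + m / th.
  rewrite -[X in _ <= _ + X]expRK -lnM ?posrE ?expR_gt0//.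
  by rewrite ler_ln ?posrE ?mulr_gt0 ?expR_gt0.
move=> /(ler_wpM2l (ltW th0)); rewrite mulrDr.
have -> : th * (m / th) = m by rewrite mulrC divfK// gt_eqF.
move=> H1; apply: (@le_trans _ _ (expR (1 / 4 + m))).
  rewrite ler_expR; apply: (le_trans H1); rewrite lerD2r.
  have : ln (J%:R : K) <= J%:R.
    have := @le_ln1Dx K (J%:R - 1); rewrite subrKC => /(_ ltac:(lra)); lra.
  move=> /(ler_wpM2l (ltW th0)) /le_trans; apply.
  by rewrite /th invfM mulrAC -mulrA divff ?gt_eqF// mulr1 div1r.
rewrite expRD ler_wpM2r ?expR_ge0//.
have h0 : 0 <= 1 / 4 :> K by lra.
have h1 : 1 / 4 <= 1 / 2 :> K by lra.
by apply: (le_trans (expR_le1D2sqr h0 h1)); lra.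
Qed.

Lemma soft_max_ge (v : V) j : expR (la * v 0 j) <= F v.
Proof.
have [th01 be0 tb] := chevet_exponent; have /andP[th0 _] := th01.
rewrite /soft_max ler_expR -tb -mulrA ler_pM2l//.
rewrite -[leLHS]expRK ler_ln ?posrE ?expR_gt0 ?partition_fun_gt0//.
by rewrite /partition_fun (bigD1 j)//= lerDl sumr_ge0// => i _; exact: expR_ge0.
Qed.

(** A shift by w of all coordinates multiplies F by exp (la w), so the auxiliary variable g
    contributes an exact scalar factor. *)
Lemma gauss_op_soft_max_const z : gauss_op t (const_mx 1) F z = expR (t * la ^+ 2 / 2) * F z.
Proof.
have [th01 be0 tb] := chevet_exponent.
have LF := log_lipschitz_soft_max J0 be0 th01.
apply: EFin_inj; apply: (etrans (gauss_opE _ z t0 LF)).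
transitivity (\int[normal_prob 0 (Num.sqrt t)]_w ((F z)%:E * (expR (la * w))%:E))%E.
  apply: eq_integral => w _; rewrite -EFinM; congr EFin.
  rewrite /soft_max -expRD; congr expR.
  have -> : partition_fun be (z + w *: const_mx 1) = expR (be * w) * partition_fun be z.
    rewrite mulr_sumr; apply: eq_bigr => j _.
    by rewrite !mxE mulr1 mulrDr expRD mulrC.
  rewrite lnM ?posrE ?expR_gt0 ?partition_fun_gt0// expRK -tb; ring.
rewrite ge0_integralZl ?integral_normal_expR//.
- by rewrite -EFinM mulrC.
- by apply/measurable_EFinP/measurableT_comp => //; apply: measurable_funM.
- by rewrite lee_fin; case: LF.
Qed.

Lemma amgm_weight (ka g u : K) : 0 < ka ->
  la * (g * u) <= ka * g ^+ 2 + la ^+ 2 / (4 * ka) * u ^+ 2.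
Proof.
move=> k0; rewrite -subr_ge0.
have -> : ka * g ^+ 2 + la ^+ 2 / (4 * ka) * u ^+ 2 - la * (g * u) =
    ka * (g - la * u / (2 * ka)) ^+ 2 by field; rewrite gt_eqF.
by rewrite mulr_ge0 ?sqr_ge0 ?ltW.
Qed.

Lemma sum_dirs (n : nat) (u : 'I_J -> 'I_n -> K) (z : nat -> K) j :
  (\sum_(i < size [seq \row_j u j a | a <- enum 'I_n])
    z i *: [seq (\row_j u j a : V) | a <- enum 'I_n]`_i) 0 j = \sum_(a < n) z a * u j a.
Proof.
rewrite summxE size_map size_enum_ord; apply: eq_bigr => a _.
rewrite mxE (nth_map a) ?size_enum_ord//.
by rewrite mxE nth_ord_enum.
Qed.

Lemma sum_dirs_le n (u : 'I_J -> 'I_n -> K) (z : nat -> K) ka j : 0 < ka ->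
  \sum_a u j a ^+ 2 = 1 ->
  la * (\sum_(a < n) z a * u j a) <=
  ka * (\sum_(a < n) z a ^+ 2) + la ^+ 2 / (4 * ka).
Proof.
move=> k0 u1.
have -> : la ^+ 2 / (4 * ka) = \sum_a la ^+ 2 / (4 * ka) * u j a ^+ 2.
  by rewrite -mulr_sumr u1 mulr1.
rewrite 2!mulr_sumr -big_split /=.
by apply: ler_sum => a _; exact: amgm_weight.
Qed.

(** The factor 4 is 2 from the comparison times 2 from [soft_max_le]. Each of the two linear parts
    brings a term la^2 t / 2 in the exponent; cancelling the factor of g removes one of them. *)
Lemma chevet_exp_moment :
  gauss_ops t bilinear_dirs F 0 <=
  4 * expR (la * Num.sqrt t * (Num.sqrt M%:R + Num.sqrt N%:R) + la ^+ 2 * t / 2).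
Proof.
have [th01 be0 tb] := chevet_exponent.
have LF := log_lipschitz_soft_max J0 be0 th01.
have sq n : (0 < n)%N -> exists2 a : K, 0 < a & la ^+ 2 * t = a ^+ 2 * n%:R /\
    a * n%:R = la * Num.sqrt t * Num.sqrt n%:R.
  move=> n0; have s0 : 0 < Num.sqrt (n%:R : K) by rewrite sqrtr_gt0 ltr0n.
  have tt : Num.sqrt t ^+ 2 = t by rewrite sqr_sqrtr// ltW.
  have nn : Num.sqrt (n%:R : K) ^+ 2 = n%:R by rewrite sqr_sqrtr.
  exists (la * Num.sqrt t / Num.sqrt n%:R).
    by rewrite divr_gt0// mulr_gt0// sqrtr_gt0.
  split; first by rewrite -{1}tt -{2}nn; field; rewrite gt_eqF.
  by rewrite -{2}nn; field; rewrite gt_eqF.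
have [a a0 [aE aM]] := sq M M0; have [b b0 [bE bN]] := sq N N0.
have [k1 [k10 k11] H1] := chi_bound t0 a0 la0 aE.
have [k2 [k20 k21] H2] := chi_bound t0 b0 la0 bE.
set c1 := expR (la ^+ 2 / (4 * k1)) in H1; set c2 := expR (la ^+ 2 / (4 * k2)) in H2.
set A1 := _ ^+ M in H1; set A2 := _ ^+ N in H2.
have W : gauss_ops t (left_dirs ++ right_dirs) F 0 <= 2 * (c1 * A1) * (c2 * A2).
  have -> : gauss_ops t (left_dirs ++ right_dirs) F = gauss_ops t left_dirs (gauss_ops t right_dirs F).
    by elim: left_dirs => //= u us ->.
  have -> : 2 * (c1 * A1) * (c2 * A2) = 2 * c1 * c2 * A2 * A1 by ring.
  have A20 : 0 <= A2 by rewrite exprn_ge0// invr_ge0 sqrtr_ge0.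
  have e0 : 0 <= 2 * c1 * c2 * A2 by rewrite !mulr_ge0 ?expR_ge0.
  have sl : size left_dirs = M by rewrite size_map size_enum_ord.
  have sr : size right_dirs = N by rewrite size_map size_enum_ord.
  rewrite /A1 -[X in _ ^+ X]sl.
  apply: (gauss_ops_le_sqr t0 k11 e0 (log_lipschitz_gauss_ops _ t0 LF)) => g.
  rewrite add0r mulrAC /A2 -[X in _ ^+ X]sr.
  apply: (gauss_ops_le_sqr t0 k21 _ LF) => [|h].
    by rewrite !mulr_ge0 ?expR_ge0.
  rewrite -!mulrA -!expRD; apply: soft_max_le => j.
  rewrite mxE !sum_dirs mulrDr sl sr.
  have := sum_dirs_le g k10 (x1 j); have := sum_dirs_le h k20 (y1 j).
  lra.
have S : gauss_ops t (const_mx 1 :: bilinear_dirs) F 0 <=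
    2 * gauss_ops t (left_dirs ++ right_dirs) F 0.
  apply: gauss_ops_slepian => // [j|j k].
    rewrite cov_bilinear cov_linear.
    have -> : \sum_a x j a * x j a = 1.
      by rewrite -(x1 j); apply: eq_bigr => i _; rewrite expr2.
    have -> : \sum_a y j a * y j a = 1.
      by rewrite -(y1 j); apply: eq_bigr => i _; rewrite expr2.
    by rewrite mulr1.
  rewrite cov_bilinear cov_linear.
  have := unit_dot_le1 (x1 j) (x1 k); have := unit_dot_le1 (y1 j) (y1 k).
  move: (\sum_a _) (\sum_b _) => p q p1 q1.
  (* The difference of the covariances is 1 + p q - p - q. *)
  have : 0 <= (1 - p) * (1 - q) by rewrite mulr_ge0//; lra.
  lra.
move: S; rewrite /= (gauss_op_opsC _ _ t0 t0 LF).
rewrite (_ : gauss_op t (const_mx 1) F = fun z => expR (t * la ^+ 2 / 2) * F z); last first.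
  by apply/funext => z; exact: gauss_op_soft_max_const.
rewrite (gauss_opsZ _ t0 (expR_ge0 _) LF) => S.
have e0 := expR_gt0 (t * la ^+ 2 / 2).
rewrite -(ler_pM2l e0); apply: (le_trans S).
have cA2 : 0 <= c2 * A2.
  by rewrite mulr_ge0 ?expR_ge0// exprn_ge0// invr_ge0 sqrtr_ge0.
have cA1 : 0 <= c1 * A1.
  by rewrite mulr_ge0 ?expR_ge0// exprn_ge0// invr_ge0 sqrtr_ge0.
apply: (@le_trans _ _ (4 * ((c1 * A1) * (c2 * A2)))); first by lra.
rewrite [leRHS]mulrCA ler_pM2l// -expRD.
apply: (le_trans (ler_pM cA1 cA2 H1 H2)); rewrite -expRD ler_expR aM bN; lra.
Qed.

End Chevet.

(** * Operator norm of a Gaussian matrix *)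

Section EuclideanNorm.
Variable K : realType.

Definition enorm n (x : 'rV[K]_n) : K := Num.sqrt (\sum_j x 0 j ^+ 2).

Lemma enorm_ge0 n (x : 'rV_n) : 0 <= enorm x. Proof. exact: sqrtr_ge0. Qed.

Lemma sumsqr_ge0 n (x : 'rV[K]_n) : 0 <= \sum_j x 0 j ^+ 2.
Proof. by apply: sumr_ge0 => j _; exact: sqr_ge0. Qed.

Lemma enorm_sqr n (x : 'rV_n) : enorm x ^+ 2 = \sum_j x 0 j ^+ 2.
Proof. by rewrite sqr_sqrtr// sumsqr_ge0. Qed.

Lemma enorm_eq0 n (x : 'rV_n) : (enorm x == 0) = (x == 0).
Proof.
apply/idP/eqP => [|->]; last first.
  by rewrite /enorm big1 ?sqrtr0// => j _; rewrite mxE expr0n.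
rewrite sqrtr_eq0 => H.
have : \sum_j x 0 j ^+ 2 == 0 by rewrite eq_le H sumsqr_ge0.
rewrite psumr_eq0 => [/allP H'|j _]; last exact: sqr_ge0.
apply/rowP => j; rewrite mxE; apply/eqP.
by rewrite -sqrf_eq0; apply: H'; rewrite mem_index_enum.
Qed.

Lemma enormZ n (a : K) (x : 'rV_n) : enorm (a *: x) = `|a| * enorm x.
Proof.
rewrite /enorm -sqrtr_sqr -sqrtrM ?sqr_ge0// mulr_sumr.
by congr Num.sqrt; apply: eq_bigr => j _; rewrite mxE exprMn.
Qed.

Lemma enormN n (x : 'rV_n) : enorm (- x) = enorm x.
Proof. by rewrite -scaleN1r enormZ normrN1 mul1r. Qed.

Lemma sum_normalized_sqr n (x : 'rV_n) : enorm x != 0 ->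
  \sum_j (x 0 j / enorm x) ^+ 2 = 1.
Proof.
move=> x0; under eq_bigr do rewrite exprMn.
by rewrite -mulr_suml -enorm_sqr -exprMn divff// expr1n.
Qed.

Lemma cauchy_schwarz n (x y : 'rV_n) : dotr x y <= enorm x * enorm y.
Proof.
have [/eqP|x0] := eqVneq (enorm x) 0.
  rewrite enorm_eq0 => /eqP ->; rewrite /dotr big1 ?mulr_ge0 ?enorm_ge0// => j _.
  by rewrite mxE mul0r.
have [/eqP|y0] := eqVneq (enorm y) 0.
  rewrite enorm_eq0 => /eqP ->; rewrite /dotr big1 ?mulr_ge0 ?enorm_ge0// => j _.
  by rewrite mxE mulr0.
have := unit_dot_le1 (sum_normalized_sqr x0) (sum_normalized_sqr y0).
have -> : \sum_i x 0 i / enorm x * (y 0 i / enorm y) =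
    dotr x y / (enorm x * enorm y).
  by rewrite mulr_suml; apply: eq_bigr => j _; rewrite mulrACA invfM.
by rewrite ler_pdivrMr ?mul1r// mulr_gt0// lt0r enorm_ge0 ?x0 ?y0.
Qed.

Lemma enormD n (x y : 'rV_n) : enorm (x + y) <= enorm x + enorm y.
Proof.
rewrite -(@ler_pXn2r _ 2) ?nnegrE ?addr_ge0 ?enorm_ge0//.
rewrite enorm_sqr sqrrD !enorm_sqr.
have -> : \sum_j (x + y) 0 j ^+ 2 =
    \sum_j x 0 j ^+ 2 + 2 * dotr x y + \sum_j y 0 j ^+ 2.
  rewrite /dotr mulr_sumr -!big_split; apply: eq_bigr => j _ /=.
  by rewrite mxE; ring.
rewrite lerD2r lerD2l -[leRHS]mulr_natl ler_pM2l//; exact: cauchy_schwarz.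
Qed.

Lemma enorm_le_l1 n (x : 'rV_n) : enorm x <= l1 x.
Proof.
rewrite -(@ler_pXn2r _ 2) ?nnegrE ?l1_ge0 ?enorm_ge0// enorm_sqr.
rewrite /l1 big_ord1 expr2 mulr_suml; apply: ler_sum => j _.
rewrite -[leLHS]real_normK ?num_real// expr2 ler_wpM2l//.
by rewrite (bigD1 j)//= lerDl sumr_ge0.
Qed.

Lemma rat_approx_gt0 m n (g : 'M[K]_(m, n) -> K) (c : K) A :
  (forall B, g A <= g B + c * l1 (A - B)) -> 0 < g A ->
  exists Q : 'M[rat]_(m, n), 0 < g (map_mx ratr Q).
Proof.
move=> H gA; pose c' := `|c| + 1.
have c0 : 0 < c' by rewrite ltr_wpDl.
have e0 : 0 < g A / c' by rewrite divr_gt0.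
have [Q] := rat_matrix_dense A e0; rewrite ltr_pdivlMr// => HQ.
exists Q; have := H (map_mx ratr Q).
have : c * l1 (A - map_mx ratr Q) <= c' * l1 (A - map_mx ratr Q).
  by rewrite ler_wpM2r ?l1_ge0// /c'; have := ler_norm c; lra.
lra.
Qed.

(** The operator norm bound in bilinear form; no absolute value is needed because x may be replaced
    by its opposite. *)
Definition op_le m n (E : 'M[K]_(m, n)) (s : K) : Prop :=
  forall (x : 'rV_m) (y : 'rV_n), dotr (x *m E) y <= s * (enorm x * enorm y).

Lemma op_le_enorm m n (E : 'M[K]_(m, n)) s x : 0 <= s -> op_le E s ->
  enorm (x *m E) <= s * enorm x.
Proof.
move=> s0 H; have := H x (x *m E).
rewrite (_ : dotr _ _ = enorm (x *m E) ^+ 2); last first.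
  by rewrite enorm_sqr; apply: eq_bigr => j _; rewrite expr2.
have [->|e0] := eqVneq (enorm (x *m E)) 0; last first.
  by rewrite expr2 mulrA ler_pM2r// lt0r e0 enorm_ge0.
by rewrite mulr_ge0// enorm_ge0.
Qed.

(** Reduces the norm bound to countably many conditions, so that its failure is covered by a
    countable union of events. A violating pair is perturbed to a rational one, first in x and then
    in y. *)
Lemma rat_op_le m n (E : 'M[K]_(m, n)) s : 0 <= s ->
  (forall (p : 'rV[rat]_m) (q : 'rV[rat]_n),
    dotr (map_mx ratr p *m E) (map_mx ratr q) <=
    s * (enorm (map_mx ratr p) * enorm (map_mx ratr q))) ->
  op_le E s.
Proof.
move=> s0 H x y; rewrite leNgt; apply/negP => Hxy.
pose g (x : 'rV[K]_m) (y : 'rV[K]_n) := dotr (x *m E) y - s * (enorm x * enorm y).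
have enB k (a b : 'rV[K]_k) : enorm b <= enorm a + l1 (a - b).
  apply: (@le_trans _ _ (enorm a + enorm (b - a))).
    by rewrite -{1}(subrK a b) addrC enormD.
  by rewrite lerD2l -enormN opprB enorm_le_l1.
have l1M (a : 'rV[K]_m) : l1 (a *m E) <= l1 a * l1 E.
  rewrite {1 2}/l1 !big_ord1 /l1.
  apply: (@le_trans _ _ (\sum_j \sum_i `|a 0 i| * `|E i j|)).
    apply: ler_sum => j _; rewrite mxE; apply: (le_trans (ler_norm_sum _ _ _)).
    by apply: ler_sum => i _; rewrite normrM.
  rewrite exchange_big /= mulr_suml; apply: ler_sum => i _.
  rewrite -mulr_sumr ler_wpM2l// (bigD1 i)//= lerDl sumr_ge0// => k _.
  exact: sumr_ge0.
have Lx z a b : g a z <= g b z + (l1 E * l1 z + s * enorm z) * l1 (a - b).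
  have h1 : dotr (a *m E) z <= dotr (b *m E) z + l1 (a - b) * l1 E * l1 z.
    rewrite -lerBlDl -[- dotr _ _]mulN1r -dotrZl -dotrDl scaleN1r -mulNmx -mulmxDl.
    apply: (le_trans (ler_norm _)); apply: (le_trans (dotr_le_l1 _ _)).
    by rewrite ler_wpM2r ?l1_ge0.
  have h2 : s * (enorm b * enorm z) <= s * (enorm a * enorm z) + s * enorm z * l1 (a - b).
    rewrite -mulrA -mulrDr ler_wpM2l// [_ * l1 _]mulrC -mulrDl ler_wpM2r ?enorm_ge0//.
  by rewrite /g; lra.
have Ly z a b : g z a <= g z b + (l1 (z *m E) + s * enorm z) * l1 (a - b).
  have h1 : dotr (z *m E) a <= dotr (z *m E) b + l1 (z *m E) * l1 (a - b).
    rewrite -lerBlDl -[- dotr _ _]mulN1r -dotrZr -dotrDr scaleN1r.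
    by apply: (le_trans (ler_norm _)); exact: dotr_le_l1.
  have h2 : s * (enorm z * enorm b) <= s * (enorm z * enorm a) + s * enorm z * l1 (a - b).
    by rewrite -mulrA -!mulrDr ler_wpM2l// ler_wpM2l ?enorm_ge0.
  by rewrite /g; lra.
have gxy : 0 < g x y by rewrite /g; lra.
have [p gp] := rat_approx_gt0 (Lx y x) gxy.
have [q gq] := rat_approx_gt0 (Ly _ y) gp.
have := H p q; move: gq; rewrite /g; lra.
Qed.

End EuclideanNorm.

(** * Laws of independent Gaussian families *)

Section Independence.
Context {K : realType} {disp : measure_display} {Omega : measurableType disp}.
Variable P : probability Omega K.

(* [measurableTypeR K] and [K] carry the same sigma-algebra with different
   displays. *)
Lemma independent_integral d' (T' : measurableType d') (X : {mfun Omega >-> T'})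
    (Z : Omega -> measurableTypeR K) (N : probability (measurableTypeR K) K)
    (F : T' * measurableTypeR K -> \bar K) :
  measurable_fun [set: Omega] Z ->
  (forall A B, measurable A -> measurable B ->
     P (X @^-1` A `&` Z @^-1` B) = P (X @^-1` A) * N B)%E ->
  measurable_fun [set: T' * measurableTypeR K] F -> (forall u, 0 <= F u)%E ->
  (\int[P]_w F (X w, Z w) = \int[P]_w \int[N]_z F (X w, z))%E.
Proof.
move=> mZ H mF F0.
have mXZ : measurable_fun [set: Omega] (fun w => (X w, Z w)).
  by apply/measurable_fun_pairP; split => //=; exact: measurable_funPT.
pose XZ : {mfun Omega >-> (T' * measurableTypeR K)%type} :=
  HB.pack (fun w => (X w, Z w)) (isMeasurableFun.Build _ _ _ _ _ mXZ).
transitivity (\int[distribution P XZ]_u F u)%E.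
  by rewrite ge0_integral_distribution.
transitivity (\int[distribution P X \x N]_u F u)%E.
  apply: eq_measure_integral => A mA _; apply/esym.
  by apply: product_measure_unique => // B C mB mC; rewrite -H.
rewrite fubini_tonelli1// ge0_integral_distribution//.
- exact: measurable_fun_fubini_tonelli_F.
- by move=> x; apply: integral_ge0.
Qed.

Variables (I : choiceType) (Z : I -> {mfun Omega >-> K}).
Hypothesis Zind : mutually_independent P (fun i => Z i : Omega -> K).

Definition cylinders (l : seq I) : set (set Omega) :=
  [set A | exists2 B : I -> set K, (forall i, measurable (B i)) &
    A = \big[setI/setT]_(i <- l) (Z i @^-1` B i)].

Lemma measurable_preimage_mfun (f : {mfun Omega >-> K}) (B : set K) :
  measurable B -> measurable (f @^-1` B).
Proof. by move=> mB; rewrite -[_ @^-1` _]setTI; exact: measurable_funPT. Qed.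

Lemma measurable_cylinders l A : cylinders l A -> measurable A.
Proof.
case=> B mB ->; elim: l => [|i l IH]; first by rewrite big_nil.
by rewrite big_cons; apply: measurableI => //; exact: measurable_preimage_mfun.
Qed.

Lemma setI_closed_cylinders l : setI_closed (cylinders l).
Proof.
move=> _ _ [B mB ->] [C mC ->]; exists (fun i => B i `&` C i).
  by move=> i; exact: measurableI.
by rewrite -big_split; apply: eq_bigr => i _; rewrite preimage_setI.
Qed.

(** A Dynkin argument: cylinders are stable under intersection, and for them the claim is mutual
    independence applied to [i :: l] and to l. *)
Lemma cylinders_independent l i A C : uniq (i :: l) -> <<s cylinders l >> A ->
  measurable C -> P (A `&` Z i @^-1` C) = (P A * P (Z i @^-1` C))%E.
Proof.
move=> /= /andP[il ul] sA mC; set E := Z i @^-1` C.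
have mE : measurable E by exact: measurable_preimage_mfun.
have sm : <<s cylinders l >> `<=` measurable.
  apply: smallest_sub; last by move=> B; exact: measurable_cylinders.
  exact: sigma_algebra_measurable.
have PE : P E \is a fin_num by exact: fin_num_measure.
pose Q : set_system Omega := fun S => P (S `&` E) = (P S * P E)%E.
apply: (@dynkin_induction _ (g_sigma_algebraType (cylinders l)) (cylinders l) Q) => //.
- exact: setI_closed_cylinders.
- by rewrite /Q setTI probability_setT mul1e.
- move=> _ [B mB ->].
  pose B' j := if j == i then C else B j.
  have := Zind (s := i :: l) (B := B'); rewrite /= il ul => /(_ isT).
  have mB' j : measurable (B' j) by rewrite /B'; case: eqP.
  move=> /(_ mB'); rewrite !big_cons /B' eqxx.
  have Eq : forall F : (set K -> I -> set Omega), \big[setI/setT]_(j <- l) F (if j == i then C else B j) j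
      = \big[setI/setT]_(j <- l) F (B j) j.
    move=> F; rewrite big_seq [RHS]big_seq; apply: eq_bigr => j jl.
    by case: eqP => // ji; rewrite ji (negPf il) in jl.
  rewrite (Eq (fun S j => Z j @^-1` S)) /Q setIC => ->; rewrite muleC; congr (_ * _)%E.
  have := Zind (s := l) (B := B) ul mB => ->.
  rewrite big_seq [RHS]big_seq; apply: eq_bigr => j jl.
  by case: eqP => // ji; rewrite ji (negPf il) in jl.
- move=> S mS; rewrite /Q => QS.
  have mS' : measurable (S : set Omega) by exact: sm.
  have PS : P S \is a fin_num by exact: fin_num_measure.
  rewrite probability_setC// muleBl ?fin_num_adde_defl ?fin_numN// mul1e -QS.
  rewrite setIC -setDE measureD//.
    by rewrite setIC.
  by rewrite (le_lt_trans (probability_le1 _ _)) ?ltry.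
- move=> F mF tF QF; rewrite /Q setI_bigcupl.
  have mF' n : measurable (F n : set Omega) by apply: sm; exact: mF.
  have mFE n : measurable (F n `&` E : set Omega) by apply: measurableI; [exact: mF'|exact: mE].
  have S1 : P (\bigcup_n (F n `&` E)) = (\sum_(0 <= n <oo) P (F n `&` E))%E.
    by rewrite measure_bigcup//; [apply: eq_eseriesl => n; rewrite in_setT|exact: trivIset_setIr].
  have S2 : P (\bigcup_n F n) = (\sum_(0 <= n <oo) P (F n))%E.
    by rewrite measure_bigcup//; apply: eq_eseriesl => n; rewrite in_setT.
  rewrite S1 S2 muleC -(fineK PE) -nneseriesZl => [|n _]; last exact: measure_ge0.
  by apply: eq_eseriesr => n _; rewrite QF muleC fineK.
Qed.

End Independence.

Section GaussianFamily.
Context {K : realType} {disp : measure_display} {Omega : measurableType disp}.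
Variable P : probability Omega K.

Lemma mutually_independent_inj (I J : choiceType) (X : I -> Omega -> K) (g : J -> I) :
  injective g -> mutually_independent P X ->
  mutually_independent P (fun j => X (g j)).
Proof.
move=> ginj H s B us mB.
(* The sets are carried along g by their rank in s; the default [setT] covers the indices outside
   the image of s. *)
pose B' i := nth setT [seq B j | j <- s] (index i [seq g j | j <- s]).
have mB' i : measurable (B' i).
  rewrite /B'; have [k_lt|k_ge] := ltnP (index i [seq g j | j <- s]) (size s).
    have [j _] : exists j : J, True by case: s k_lt {us B'} => // j; exists j.
    by rewrite (nth_map j).
  by rewrite nth_default ?size_map.
have := H [seq g j | j <- s] B'; rewrite map_inj_uniq// => /(_ us mB').
have E j : j \in s -> B' (g j) = B j.
  by move=> js; rewrite /B' index_map// (nth_map j) ?index_mem// nth_index.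
rewrite !big_map => H'.
rewrite big_seq in H'; rewrite [RHS]big_seq_cond in H'.
rewrite [X in P X]big_seq [RHS]big_seq.
under eq_bigr => j js do rewrite -E//.
under [RHS]eq_bigr => j js do rewrite -E//.
by rewrite H'; apply: eq_bigl => j; rewrite andbT.
Qed.

Variables (I : choiceType) (Z : I -> {mfun Omega >-> K}) (t : K).
Hypothesis t0 : 0 < t.
Hypothesis Zind : mutually_independent P (fun i => Z i : Omega -> K).
Hypothesis Zlaw : forall i (B : set K), measurable B ->
  P (Z i @^-1` B) = normal_prob 0 (Num.sqrt t) B.

Lemma measurable_cylinders_coord l i : uniq l -> i \in l ->
  measurable_fun [set: g_sigma_algebraType (cylinders Z l)] (Z i : Omega -> K).
Proof.
move=> ul il _ B mB; rewrite setTI; apply: sub_sigma_algebra.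
exists (fun j => if j == i then B else setT).
  by move=> j; case: eqP.
rewrite (bigD1_seq i)//= eqxx big1 ?setIT// => j /negPf ->.
by rewrite preimage_setT.
Qed.

(** One variable at a time is integrated out: it is independent of the sigma-algebra of the others,
    so f is replaced by its convolution in that direction. *)
Lemma gaussian_family_law J (v : I -> 'rV[K]_J) (l : seq I) c (f : 'rV[K]_J -> K) :
  uniq l -> log_lipschitz c f ->
  (\int[P]_w (f (\sum_(i <- l) Z i w *: v i))%:E =
   (gauss_ops t [seq v i | i <- l] f 0)%:E)%E.
Proof.
elim: l f => [|i l IH] f uil Lf.
  under eq_integral do rewrite big_nil.
  by rewrite integral_cst//= probability_setT mule1.
have /= /andP[il ul] := uil.
(* Omega with the sigma-algebra of the remaining variables. The identity map X into it plays the
   role of the random vector of these variables. *)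
pose O' := g_sigma_algebraType (cylinders Z l).
pose S (w : O') : 'rV[K]_J := \sum_(i <- l) Z i w *: v i.
have mS j : measurable_fun [set: O'] (fun w => S w 0 j).
  (* [measurable_sum] asks for measurability of the term at every index, which for this
     sigma-algebra is known only on l. *)
  have -> : (fun w => S w 0 j) = (fun w => \sum_(k <- l) (if k \in l then Z k w * v k 0 j else 0)).
    by apply/funext => w; rewrite /S summxE !big_seq; apply: eq_bigr => k kl; rewrite mxE kl.
  apply: measurable_sum => k; have [kl|kl] := boolP (k \in l) => //.
  by apply: measurable_funM => //; exact: measurable_cylinders_coord.
have sm : <<s cylinders Z l >> `<=` @measurable _ Omega.
  apply: smallest_sub; last by move=> B; exact: measurable_cylinders.
  exact: sigma_algebra_measurable.
have mid : measurable_fun [set: Omega] (fun w => w : O').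
  by move=> _ B mB; rewrite setTI; exact: sm.
pose X : {mfun Omega >-> O'} := HB.pack (fun w : Omega => w : O')
  (isMeasurableFun.Build _ _ _ _ _ mid).
pose F (u : O' * K) : \bar K := (f (S u.1 + u.2 *: v i))%:E.
have mF : measurable_fun [set: O' * K] F.
  apply/measurable_EFinP.
  apply: (measurable_log_lipschitz (X := fun u : O' * K => S u.1 + u.2 *: v i) Lf) => j.
  have -> : (fun u : O' * K => (S u.1 + u.2 *: v i) 0 j) =
      (fun u => S u.1 0 j + u.2 * v i 0 j).
    by apply/funext => u; rewrite !mxE.
  apply: measurable_funD; first exact: (measurableT_comp (mS j)).
  by apply: measurable_funM.
have F0 u : (0 <= F u)%E by rewrite lee_fin; case: Lf.
transitivity (\int[P]_w F (X w, Z i w))%E.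
  by apply: eq_integral => w _; rewrite big_cons addrC.
have mZi : measurable_fun [set: Omega] (Z i : Omega -> measurableTypeR K).
  exact: (measurable_funPT (Z i)).
rewrite (@independent_integral _ _ _ P _ _ X (Z i) (normal_prob 0 (Num.sqrt t)) F mZi)//; last first.
  move=> A B mA mB; transitivity (P (X @^-1` A) * P (Z i @^-1` B))%E.
    exact: (cylinders_independent Zind uil).
  by congr (_ * _)%E; exact: Zlaw.
transitivity (\int[P]_w (gauss_op t (v i) f (S w))%:E)%E.
  by apply: eq_integral => w _; apply: esym; exact: (gauss_opE _ _ t0 Lf).
rewrite IH//; last exact: log_lipschitz_gauss_op.
by rewrite -(gauss_op_opsC _ _ t0 t0 Lf).
Qed.

End GaussianFamily.

Section GaussianMatrix.
Context {K : realType} {disp : measure_display} {Omega : measurableType disp}.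
Variable P : probability Omega K.
Variables (M N : nat) (Z : 'I_M * 'I_N -> {mfun Omega >-> K}) (s : K).
Hypotheses (M0 : (0 < M)%N) (N0 : (0 < N)%N) (s0 : 0 < s).
Hypothesis Zind : mutually_independent P (fun i => Z i : Omega -> K).
Hypothesis Zlaw : forall i (B : set K), measurable B ->
  P (Z i @^-1` B) = normal_prob 0 s B.

Definition random_matrix (w : Omega) : 'M[K]_(M, N) := \matrix_(a, b) Z (a, b) w.

Lemma measurable_bilinear (x : 'rV[K]_M) (y : 'rV[K]_N) :
  measurable_fun [set: Omega] (fun w => dotr (x *m random_matrix w) y).
Proof.
have -> : (fun w => dotr (x *m random_matrix w) y) =
    (fun w => \sum_b (\sum_a x 0 a * Z (a, b) w) * y 0 b).
  apply/funext => w; apply: eq_bigr => b _; rewrite mxE; congr (_ * _).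
  by apply: eq_bigr => a _; rewrite mxE.
apply: measurable_sum => b; apply: measurable_funM => //.
by apply: measurable_sum => a; apply: measurable_funM.
Qed.

Lemma measurable_gt (g : Omega -> K) (u : K) : measurable_fun [set: Omega] g ->
  measurable [set w | u < g w].
Proof.
move=> mg; have := mg measurableT `]u, +oo[%classic (measurable_itv _).
by rewrite setTI; congr measurable; apply/seteqP; split => w /=; rewrite in_itv /= andbT.
Qed.

(** Markov's inequality for the exponential moment of [chevet_exp_moment]. The bound is free of J,
    which allows the passage to countably many pairs. *)
Lemma finite_max_tail J (x : 'I_J -> 'rV[K]_M) (y : 'I_J -> 'rV[K]_N) (tau : K) :
  0 < tau -> (forall j, enorm (x j) = 1) -> (forall j, enorm (y j) = 1) ->
  (P [set w | exists j, (s * (Num.sqrt M%:R + Num.sqrt N%:R + tau) <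
                        dotr (x j *m random_matrix w) (y j))%R] <=
   (4 * expR (- (tau ^+ 2 / 2)))%:E)%E.
Proof.
move=> tau0 x1 y1; set u := s * _; set A := [set w | _].
have [J0|J0] := posnP J.
  suff -> : A = set0 by rewrite measure0 lee_fin mulr_ge0// expR_ge0.
  by apply/seteqP; split=> w //= -[[j jJ] _]; exfalso; rewrite J0 in jJ.
pose t := s ^+ 2; have t0 : 0 < t by rewrite exprn_gt0.
have st : Num.sqrt t = s by rewrite sqrtr_sqr gtr0_norm.
(* The minimizer of la^2 s^2 / 2 - la s tau, with minimum - tau^2 / 2. *)
pose la := tau / s; have la0 : 0 < la by rewrite divr_gt0.
pose xs j a := x j 0 a; pose ys j b := y j 0 b.
have xs1 j : \sum_a xs j a ^+ 2 = 1 by rewrite -enorm_sqr x1 expr1n.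
have ys1 j : \sum_b ys j b ^+ 2 = 1 by rewrite -enorm_sqr y1 expr1n.
have [th01 be0 _] := chevet_exponent J0 la0.
have LF := log_lipschitz_soft_max J0 be0 th01.
set F := soft_max _ _ in LF.
pose S w : 'rV[K]_J := \sum_(i <- enum {: 'I_M * 'I_N}) Z i w *: bilinear_dir xs ys i.
have SE w j : S w 0 j = dotr (x j *m random_matrix w) (y j).
  rewrite /S summxE big_enum /=.
  transitivity (\sum_a \sum_b x j 0 a * Z (a, b) w * y j 0 b).
    by rewrite pair_big /=; apply: eq_bigr => -[a b] _; rewrite !mxE /= /xs /ys; ring.
  rewrite exchange_big; apply: eq_bigr => b _; rewrite mxE mulr_suml.
  by apply: eq_bigr => a _; rewrite mxE.
have law : (\int[P]_w (F (S w))%:E = (gauss_ops t (bilinear_dirs xs ys) F 0)%:E)%E.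
  apply: (gaussian_family_law t0 Zind _ _ (enum_uniq _) LF) => i B mB.
  by rewrite st Zlaw.
have mFS : measurable_fun [set: Omega] (fun w => (F (S w))%:E).
  apply/measurable_EFinP; apply: (measurable_log_lipschitz LF) => j.
  under eq_fun do rewrite SE; exact: measurable_bilinear.
have mA : measurable A.
  rewrite (_ : A = \bigcup_j [set w | u < dotr (x j *m random_matrix w) (y j)]).
    apply: countable_bigcupT_measurable; first exact: countableP.
    by move=> j; apply: measurable_gt; exact: measurable_bilinear.
  by apply/seteqP; split=> w; [case=> j H; exists j|case=> j _ H; exists j].
have F0 w : (0 <= (F (S w))%:E)%E by rewrite lee_fin; case: LF.
have H1 : (\int[P]_(w in A) (expR (la * u))%:E <= \int[P]_(w in A) (F (S w))%:E)%E.
  apply: ge0_le_integral => //.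
  - exact: measurable_funTS mFS.
  - move=> w [j H]; rewrite lee_fin.
    apply: le_trans (soft_max_ge J0 la0 (S w) j).
    by rewrite ler_expR ler_pM2l// SE ltW.
have H2 : (\int[P]_(w in A) (F (S w))%:E <= \int[P]_w (F (S w))%:E)%E.
  by apply: ge0_subset_integral.
have H3 := le_trans H1 H2; move: H3; rewrite law integral_cst//=.
have := chevet_exp_moment M0 N0 J0 xs1 ys1 t0 la0.
rewrite -/F st => H4 H5.
have PA : P A \is a fin_num by exact: fin_num_measure.
have e0 := expR_gt0 (la * u).
rewrite -(fineK PA) -EFinM lee_fin in H5.
rewrite -(fineK PA) lee_fin -(ler_pM2l e0); apply: (le_trans (le_trans H5 H4)).
rewrite [leRHS]mulrCA ler_pM2l// -expRD ler_expR.
have ls : la * s = tau by rewrite /la divfK// gt_eqF.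
have -> : la ^+ 2 * t = tau ^+ 2 by rewrite /t -exprMn ls.
by rewrite /u mulrA ls; lra.
Qed.

Definition op_exceeds (u : K) (pq : 'rV[rat]_M * 'rV[rat]_N) : set Omega :=
  [set w | u * (enorm (map_mx ratr pq.1) * enorm (map_mx ratr pq.2)) <
           dotr (map_mx ratr pq.1 *m random_matrix w) (map_mx ratr pq.2)].

(** The pairs of rational vectors are exhausted by finite sets; normalizing the vectors makes
    [finite_max_tail] applicable, and continuity from below passes to the union. *)
Lemma gaussian_op_norm_tail (tau : K) : 0 < tau ->
  exists A : set Omega, [/\ measurable A,
    (P A <= (4 * expR (- (tau ^+ 2 / 2)))%:E)%E &
    forall w, ~ A w -> op_le (random_matrix w) (s * (Num.sqrt M%:R + Num.sqrt N%:R + tau))].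
Proof.
move=> tau0; set u := s * _.
have u0 : 0 <= u by rewrite mulr_ge0 ?(ltW s0)// !addr_ge0 ?sqrtr_ge0// ltW.
have mD pq : measurable (op_exceeds u pq).
  by apply: measurable_gt; exact: measurable_bilinear.
exists (\bigcup_pq op_exceeds u pq); split.
- by apply: countable_bigcupT_measurable; first exact: countableP.
- pose D n : set Omega := if unpickle n is Some pq then op_exceeds u pq else set0.
  pose B n := \bigcup_(k in `I_n) D k.
  have mDn n : measurable (D n) by rewrite /D; case: unpickle.
  have mB n : measurable (B n) by exact: bigcup_measurable.
  have -> : \bigcup_pq op_exceeds u pq = \bigcup_n B n.
    apply/seteqP; split=> w.
      case=> pq _ H; exists (pickle pq).+1 => //; exists (pickle pq) => //=.
      by rewrite /D pickleK.
    case=> n _ [k _]; rewrite /D; case: unpickle => // pq H; by exists pq.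
  have cv : P \o B @ \oo --> P (\bigcup_n B n).
    apply: nondecreasing_cvg_mu => //; first exact: bigcup_measurable.
    move=> m n mn; apply/subsetPset => w [k /= km H]; exists k => //=.
    exact: leq_trans km mn.
  rewrite -(cvg_lim _ cv)//; apply: lime_le; first by apply/cvg_ex; eexists; exact: cv.
  apply: nearW => n /=.
  (* A zero vector, also the one assigned to a number that codes no pair, is sent to a fixed unit
     vector. This is harmless since [op_exceeds] never holds when one of the two vectors is zero. *)
  pose unit m (x0 : 'rV[K]_m) (x : 'rV[K]_m) := if enorm x == 0 then x0 else (enorm x)^-1 *: x.
  pose e m (m0 : (0 < m)%N) : 'rV[K]_m := delta_mx 0 (Ordinal m0).
  have e1 m m0 : enorm (@e m m0) = 1.
    rewrite /enorm (bigD1 (Ordinal m0))//= mxE !eqxx expr1n big1 ?addr0 ?sqrtr1// => j /negPf H.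
    by rewrite mxE H andbF expr0n.
  have u1 m (x0 x : 'rV[K]_m) : enorm x0 = 1 -> enorm (unit m x0 x) = 1.
    rewrite /unit; case: eqP => // /eqP x_n0 _.
    by rewrite enormZ normfV ger0_norm ?enorm_ge0// mulVf.
  pose x (j : 'I_n) := unit M (e M M0)
    (if unpickle j is Some pq then map_mx ratr (pq : 'rV[rat]_M * 'rV[rat]_N).1 else 0).
  pose y (j : 'I_n) := unit N (e N N0)
    (if unpickle j is Some pq then map_mx ratr (pq : 'rV[rat]_M * 'rV[rat]_N).2 else 0).
  have x1 j : enorm (x j) = 1 by apply: u1.
  have y1 j : enorm (y j) = 1 by apply: u1.
  apply: le_trans (finite_max_tail tau0 x1 y1); apply: le_measure.
  + by rewrite inE; exact: mB.
  + rewrite inE (_ : [set w | _] =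
      \bigcup_j [set w | u < dotr (x j *m random_matrix w) (y j)]).
      apply: countable_bigcupT_measurable; first exact: countableP.
      by move=> j; apply: measurable_gt; exact: measurable_bilinear.
    by apply/seteqP; split=> w; [case=> j H; exists j|case=> j _ H; exists j].
  + move=> w [k /= kn]; rewrite /D.
    case E: (unpickle k) => [[p q]|//]; rewrite /op_exceeds /= => H.
    exists (Ordinal kn); rewrite -/u /x /y /= E /= /unit.
    set P' := map_mx ratr p in H *; set Q' := map_mx ratr q in H *.
    have [/eqP|p0] := eqVneq (enorm P') 0.
      rewrite enorm_eq0 => /eqP P0; move: H; rewrite P0 mul0mx /dotr big1 => [|j _].
        by rewrite ltNge mulr_ge0// mulr_ge0 ?enorm_ge0.
      by rewrite mxE mul0r.
    have [/eqP|q0] := eqVneq (enorm Q') 0.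
      rewrite enorm_eq0 => /eqP Q0; move: H; rewrite Q0 /dotr big1 => [|j _].
        by rewrite ltNge mulr_ge0// mulr_ge0 ?enorm_ge0.
      by rewrite [X in _ * X]mxE mulr0.
    have pp : 0 < enorm P' by rewrite lt0r p0 enorm_ge0.
    have qq : 0 < enorm Q' by rewrite lt0r q0 enorm_ge0.
    rewrite -scalemxAl dotrZl dotrZr mulrA -invfM mulrC ltr_pdivlMr ?mulr_gt0//.
- move=> w nA; apply: rat_op_le => // p q; rewrite leNgt; apply/negP => H.
  by apply: nA; exists (p, q).
Qed.

End GaussianMatrix.

(** * Singular values *)

Section RealSpectral.
Variable K : realType.

Definition sqn n (x : 'rV[K]_n) : K := (x *m x^T) 0 0.

Lemma sqnE n (x : 'rV_n) : sqn x = \sum_j x 0 j ^+ 2.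
Proof. by rewrite /sqn mxE; apply: eq_bigr => j _; rewrite mxE expr2. Qed.

Lemma sqn_enorm n (x : 'rV_n) : sqn x = enorm x ^+ 2.
Proof. by rewrite sqnE enorm_sqr. Qed.

(* The imaginary part of the eigenvalue vanishes because S is symmetric. *)
Lemma symmetric_eigenvector n (S : 'M[K]_n.+1) : S^T = S ->
  exists a, exists2 v : 'rV_n.+1, v != 0 & v *m S = a *: v.
Proof.
move=> symS; pose toC (x : K) : complex.complex K := complex.Complex x 0.
have [l /eigenvalueP [v vS v0]] :=
  spectral.eigenvalue_closed
    ((\matrix_(i, j) toC (S i j)) : 'M[complex.complex K]_n.+1) isT.
case: l vS => x y vS.
pose p : 'rV[K]_n.+1 := \row_j complex.Re (v 0 j).
pose q : 'rV[K]_n.+1 := \row_j complex.Im (v 0 j).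
have ReS (F : 'I_n.+1 -> complex.complex K) : complex.Re (\sum_i F i) = \sum_i complex.Re (F i).
  by elim/big_rec2: _ => // i z w _ <-; case: (F i) w => a b [c d].
have ImS (F : 'I_n.+1 -> complex.complex K) : complex.Im (\sum_i F i) = \sum_i complex.Im (F i).
  by elim/big_rec2: _ => // i z w _ <-; case: (F i) w => a b [c d].
have pS : p *m S = x *: p - y *: q.
  apply/rowP => j; have := congr1 (@complex.Re K) (congr1 (fun M : 'rV_n.+1 => M 0 j) vS).
  rewrite !mxE ReS /=; case: (v 0 j) => a b /= <-.
  by apply: eq_bigr => i _; rewrite !mxE /toC; case: (v 0 i) => a' b' /=; rewrite mulr0 subr0.
have qS : q *m S = x *: q + y *: p.
  apply/rowP => j; have := congr1 (@complex.Im K) (congr1 (fun M : 'rV_n.+1 => M 0 j) vS).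
  rewrite !mxE ImS /=; case: (v 0 j) => a b /= <-.
  by apply: eq_bigr => i _; rewrite !mxE /toC; case: (v 0 i) => a' b' /=; rewrite mulr0 add0r.
have E : (p *m S *m q^T) 0 0 = (q *m S *m p^T) 0 0.
  have -> : q *m S *m p^T = (p *m S *m q^T)^T by rewrite !trmx_mul trmxK symS mulmxA.
  by rewrite [RHS]mxE.
have pq : (p *m q^T) 0 0 = (q *m p^T) 0 0.
  by rewrite -[q *m p^T]trmxK trmx_mul trmxK [RHS]mxE.
have y0 : y * (sqn p + sqn q) = 0.
  move: E; rewrite pS qS mulmxBl mulmxDl -!scalemxAl.
  have e (a b c d : 'M[K]_1) : (x *: a - y *: b) 0 0 = (x *: c + y *: d) 0 0 ->
     x * a 0 0 - y * b 0 0 = x * c 0 0 + y * d 0 0 by rewrite !mxE.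
  move/e; rewrite -/(sqn q) -/(sqn p) pq; lra.
have pq0 : p = 0 -> q = 0 -> False.
  move=> p0 q0; move/eqP: v0; apply; apply/rowP => j; rewrite mxE.
  have := congr1 (fun M : 'rV_n.+1 => M 0 j) p0; have := congr1 (fun M : 'rV_n.+1 => M 0 j) q0.
  by rewrite !mxE; case: (v 0 j) => a b /= -> ->.
have y00 : y = 0.
  apply/eqP; move/eqP: y0; rewrite mulf_eq0 => /orP[//|].
  rewrite paddr_eq0 ?sqn_enorm ?sqr_ge0// !sqrf_eq0 !enorm_eq0 => /andP[/eqP p0 /eqP q0].
  by case: (pq0 p0 q0).
(* Once the eigenvalue is real, the real and the imaginary part of v both satisfy the eigenvector
   equation, and one of them is nonzero. *)
exists x; have [p0|p0] := eqVneq p 0.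
  exists q; last by rewrite qS y00 scale0r addr0.
  by apply/eqP => q0; exact: (pq0 p0 q0).
by exists p => //; rewrite pS y00 scale0r subr0.
Qed.

(** The reflection along w = e - v exchanges the unit vectors e and v. Its coefficient 2 / |w|^2
    equals 1 / (1 - v_0) because |w|^2 = 2 (1 - v_0). *)
Lemma householder n (v : 'rV[K]_n.+1) : sqn v = 1 ->
  exists H : 'M[K]_n.+1, [/\ H^T = H, H *m H = 1%:M & delta_mx 0 0 *m H = v].
Proof.
move=> v1; pose e : 'rV[K]_n.+1 := delta_mx 0 0; pose w := e - v.
have [w0|w0] := eqVneq w 0.
  exists 1%:M; rewrite trmx1 mulmx1; split=> //.
  by apply/eqP; rewrite mulmx1 -subr_eq0 -/e -/w w0.
have ee : e *m e^T = 1%:M.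
  by rewrite /e trmx_delta mul_delta_mx; apply/matrixP => i j; rewrite !ord1 !mxE eqxx.
have sc (A : 'M[K]_1) : A = (A 0 0)%:M.
  by apply/matrixP => i j; rewrite !ord1 !mxE eqxx mulr1n.
have vv : v *m v^T = 1%:M by rewrite [LHS]sc -/(sqn v) v1.
have ev : e *m v^T = (v 0 0)%:M.
  rewrite [LHS]sc mxE (bigD1 0)//= !mxE !eqxx mul1r big1 ?addr0// => j /negPf j0.
  by rewrite !mxE j0 mul0r.
have ve : v *m e^T = (v 0 0)%:M.
  by rewrite -[LHS]trmxK trmx_mul trmxK ev tr_scalar_mx.
have ww : w *m w^T = (2 * (1 - v 0 0))%:M.
  rewrite /w linearB /= mulmxBl !mulmxBr ee vv ev ve -!raddfB /=.
  by congr _%:M; ring.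
have ew : e *m w^T = (1 - v 0 0)%:M.
  by rewrite /w linearB /= mulmxBr ee ev -raddfB.
have c0 : 1 - v 0 0 != 0.
  apply: contra_neq w0 => c0; apply/eqP; rewrite -enorm_eq0 -sqrf_eq0 -sqn_enorm.
  by rewrite /sqn ww c0 mulr0 mxE mul0rn.
pose k := (1 - v 0 0)^-1.
have wE : w = e - v by []; clearbody w.
exists (1%:M - k *: (w^T *m w)); split.
- by rewrite linearB linearZ /= trmx1 trmx_mul trmxK.
- rewrite mulmxBl mul1mx mulmxBr mulmx1 -scalemxAl -scalemxAr.
  have -> : w^T *m w *m (w^T *m w) = (2 * (1 - v 0 0)) *: (w^T *m w).
    by rewrite mulmxA -(mulmxA w^T w w^T) ww mul_mx_scalar -scalemxAl.
  rewrite !scalerA.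
  have -> : k * k * (2 * (1 - v 0 0)) = k + k by rewrite /k; field.
  by rewrite scalerDl opprB addrK subrK.
- rewrite mulmxBr mulmx1 -scalemxAr mulmxA ew mul_scalar_mx scalerA mulVf// scale1r.
  by rewrite wE subKr.
Qed.

(** Deflation: a reflection takes a unit eigenvector to the first basis vector, and by symmetry the
    conjugated matrix is block diagonal, with a smaller symmetric block. *)
Lemma real_spectral n (S : 'M[K]_n) : S^T = S ->
  exists (Q : 'M[K]_n) (d : 'rV[K]_n),
    Q *m Q^T = 1%:M /\ S = Q^T *m diag_mx d *m Q.
Proof.
elim: n S => [|n IH] S symS.
  by exists 1%:M, 0; rewrite trmx1 mulmx1; split=> //; apply/matrixP => -[].
have [a [v v0 vS]] := symmetric_eigenvector symS.
have nv : enorm v != 0 by rewrite enorm_eq0.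
pose u := (enorm v)^-1 *: v.
have u1 : sqn u = 1.
  by rewrite sqn_enorm enormZ normfV ger0_norm ?enorm_ge0// mulVf// expr1n.
have uS : u *m S = a *: u by rewrite -scalemxAl vS scalerA mulrC -scalerA.
have [H [Ht HH eH]] := householder u1.
pose T : 'M[K]_(1 + n) := H *m S *m H.
have Tt : T^T = T by rewrite /T !trmx_mul Ht symS mulmxA.
have Trow : (delta_mx 0 0 : 'rV[K]_n.+1) *m T = a *: delta_mx 0 0.
  by rewrite /T !mulmxA eH uS -scalemxAl -eH -mulmxA HH mulmx1.
have T0 j : T 0 j = a * (j == 0)%:R.
  have := congr1 (fun M : 'rV_n.+1 => M 0 j) Trow; rewrite -rowE !mxE eqxx /=.
  by move=> <-.
have TD : T = H *m S *m H by []; clearbody T.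
have TE : T = block_mx a%:M 0 0 (drsubmx T).
  rewrite -[LHS]submxK; congr block_mx.
  - apply/matrixP => i j; rewrite !ord1 !mxE /= mulr1n.
    have -> : lshift n (0 : 'I_1) = 0 by apply: val_inj.
    by rewrite T0 eqxx mulr1.
  - apply/matrixP => i j; rewrite !ord1 !mxE.
    have -> : lshift n (0 : 'I_1) = 0 by apply: val_inj.
    by rewrite T0 (_ : (rshift 1 j == 0) = false) ?mulr0.
  - apply/matrixP => i j; rewrite !ord1 !mxE.
    have -> : lshift n (0 : 'I_1) = 0 by apply: val_inj.
    by rewrite -Tt mxE T0 (_ : (rshift 1 i == 0) = false) ?mulr0.
have drt : (drsubmx T)^T = drsubmx T by rewrite trmx_drsub Tt.
have [Q [d [QQ dE]]] := IH _ drt.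
pose B : 'M[K]_(1 + n) := block_mx 1%:M 0 0 Q.
pose d2 : 'rV[K]_(1 + n) := row_mx a%:M d.
have Bt : B^T = block_mx 1%:M 0 0 Q^T by rewrite /B tr_block_mx !trmx0 trmx1.
have BB : B *m B^T = 1%:M.
  by rewrite Bt mulmx_block !mulmx0 !mul0mx !addr0 !add0r mulmx1 QQ -scalar_mx_block.
have TB : T = B^T *m diag_mx d2 *m B.
  rewrite /d2 diag_mx_row Bt !mulmx_block !mulmx0 !mul0mx !addr0 !add0r mul1mx mulmx1.
  rewrite -dE {1}TE; congr block_mx; rewrite ?mul0mx//.
  by apply/matrixP => i j; rewrite !ord1 !mxE eqxx.
pose H' : 'M[K]_(1 + n) := H.
exists (B *m H'), d2; split.
  rewrite trmx_mul (Ht : H'^T = H') mulmxA -[_ *m H' *m H']mulmxA.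
  by rewrite (HH : H' *m H' = 1%:M) mulmx1.
transitivity (H' *m T *m H'); first by rewrite TD !mulmxA HH mul1mx -mulmxA HH mulmx1.
by rewrite TB trmx_mul (Ht : H'^T = H') !mulmxA.
Qed.

Lemma char_poly_orthogonal n (S Q : 'M[K]_n) d : Q *m Q^T = 1%:M ->
  S = Q^T *m diag_mx d *m Q -> char_poly S = \prod_(i < n) ('X - (d 0 i)%:P).
Proof.
move=> QQ SE; have QQ' : Q^T *m Q = 1%:M by exact: mulmx1C.
have -> : char_poly S = char_poly (diag_mx d).
  rewrite /char_poly.
  have -> : char_poly_mx S = map_mx polyC Q^T *m char_poly_mx (diag_mx d) *m map_mx polyC Q.
    rewrite /char_poly_mx mulmxBr mulmxBl mul_mx_scalar -scalemxAl -map_mxM QQ'.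
    by rewrite map_mx1 scalemx1 -!map_mxM -SE.
  rewrite !det_mulmx mulrAC -det_mulmx -map_mxM QQ' map_mx1 det1 mul1r.
  by [].
rewrite char_poly_trig ?diag_mx_is_trig//.
by apply: eq_bigr => i _; rewrite mxE eqxx mulr1n.
Qed.

(** [eigenvalues] is defined by choice: sorting the diagonal shows that a valid list exists, and
    unique factorization of the characteristic polynomial identifies the chosen list up to order. *)
Lemma eigenvalues_spectral n (S Q : 'M[K]_n) d : Q *m Q^T = 1%:M ->
  S = Q^T *m diag_mx d *m Q ->
  sorted >=%R (eigenvalues S) /\ perm_eq (eigenvalues S) [seq d 0 i | i <- enum 'I_n].
Proof.
move=> QQ SE; have cS := char_poly_orthogonal QQ SE.
have pE : \prod_(i < n) ('X - (d 0 i)%:P) =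
    \prod_(x <- [seq d 0 i | i <- enum 'I_n]) ('X - x%:P).
  by rewrite big_map big_enum.
have ex : exists s : seq K, sorted >=%R s /\ char_poly S = \prod_(x <- s) ('X - x%:P).
  exists (sort >=%R [seq d 0 i | i <- enum 'I_n]); split.
    by apply: sort_sorted => x y; exact: ge_total.
  rewrite cS pE; apply: perm_big; rewrite perm_sym; exact: permEl (perm_sort _ _).
have [s1 s2] := xgetPex [::] ex.
split=> //; apply: prod_XsubC_eq; rewrite -pE -cS; exact: esym.
Qed.

(** In a decreasing list the entries that are at least c form an initial segment. This turns a bound
    on the k-th singular value into a count of eigenvalues. *)
Lemma count_sorted_ge (s : seq K) (c : K) k : sorted >=%R s -> (k < size s)%N ->
  (c <= nth 0 s k) = (k < count (fun x => (c <= x)%R) s)%N.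
Proof.
elim: s k => // x s IH k /= ps; have ss := path_sorted ps.
case: k => [_|k ks] /=.
  have [cx|cx] := boolP (c <= x); first by [].
  rewrite add0n -has_count; apply/esym/negbTE/hasPn => y ys; have := order_path_min (@ge_trans _ _) ps.
  move=> /allP /(_ y ys) /= yx; apply: contra cx => cy; exact: le_trans cy yx.
rewrite IH//; have [cx|cx] := boolP (c <= x) => /=; first by rewrite add1n ltnS.
rewrite add0n.
have -> : count (fun y => c <= y) s = 0%N; last by [].
apply/eqP; rewrite -leqn0 leqNgt -has_count; apply/hasPn => y ys.
have := order_path_min (@ge_trans _ _) ps.
move=> /allP /(_ y ys) /= yx; apply: contra cx => cy; exact: le_trans cy yx.
Qed.

Lemma sqn_orthogonal n (Q : 'M[K]_n) (x : 'rV_n) : Q *m Q^T = 1%:M ->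
  sqn (x *m Q) = sqn x.
Proof. by move=> QQ; rewrite /sqn trmx_mul mulmxA -(mulmxA x) QQ mulmx1. Qed.

Lemma quadratic_form_spectral m n (M : 'M[K]_(m, n)) (Q : 'M[K]_n) d (x : 'rV_n) :
  M^T *m M = Q^T *m diag_mx d *m Q ->
  sqn (x *m M^T) = \sum_j d 0 j * (x *m Q^T) 0 j ^+ 2.
Proof.
move=> SE; rewrite /sqn trmx_mul trmxK mulmxA -[x *m _ *m _]mulmxA SE.
have -> : x *m (Q^T *m diag_mx d *m Q) *m x^T =
    (x *m Q^T) *m diag_mx d *m (x *m Q^T)^T.
  by rewrite trmx_mul trmxK !mulmxA.
rewrite mxE; apply: eq_bigr => j _.
by rewrite mul_mx_diag [_^T _ _]mxE [X in X * _]mxE; ring.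
Qed.

(* Courant-Fischer, as a criterion for the k-th singular value to be at least c. *)
Lemma singular_value_geP m n (M : 'M[K]_(m, n)) (k : nat) (c : K) :
  (0 < k <= n)%N -> 0 < c ->
  (c <= singular_value k M) <->
  exists2 V : 'M[K]_(k, n), row_free V &
    forall u : 'rV_k, c ^+ 2 * sqn (u *m V) <= sqn (u *m V *m M^T).
Proof.
move=> /andP[k0 kn] c0; set S := M^T *m M.
have symS : S^T = S by rewrite trmx_mul trmxK.
have [Q [d [QQ SE]]] := real_spectral symS.
have QQ' : Q^T *m Q = 1%:M by exact: mulmx1C.
have [se pe] := eigenvalues_spectral QQ SE.
have sz : size (eigenvalues S) = n by rewrite (perm_size pe) size_map size_enum_ord.
have k1 : (k.-1 < size (eigenvalues S))%N by rewrite sz prednK.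
have quad x := quadratic_form_spectral x SE.
have QtQt : Q^T *m Q^T^T = 1%:M by rewrite trmxK.
pose B := [set j | c ^+ 2 <= d 0 j]%SET.
have -> : (c <= singular_value k M) = (k <= #|B|)%N.
  rewrite /singular_value (nth_map 0)// -/S.
  have -> : (c <= Num.sqrt (nth 0 (eigenvalues S) k.-1)) =
      (c ^+ 2 <= nth 0 (eigenvalues S) k.-1).
    have [x0|x0] := leP 0 (nth 0 (eigenvalues S) k.-1).
      by rewrite -[RHS](ler_sqrt _ x0) sqrtr_sqr gtr0_norm.
    rewrite ler0_sqrtr ?(ltW x0)// leNgt c0 /=; apply/esym/negbTE; rewrite -ltNge.
    by apply: lt_le_trans x0 (sqr_ge0 _).
  rewrite count_sorted_ge// prednK// (seq.permP pe) count_map cardE size_filter enumT.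
  by congr (_ <= _)%N; apply: eq_count => j; rewrite /= inE.
split=> [kB|[V Vfree HV]].
  have kE : (k <= size (enum B))%N by rewrite -cardE.
  have n0 : (0 < n)%N by exact: leq_trans k0 kn.
  pose g (i : 'I_k) : 'I_n := nth (Ordinal n0) (enum B) i.
  have gB i : g i \in B.
    by rewrite -mem_enum mem_nth// (leq_trans (ltn_ord i)).
  have ginj : injective g.
    move=> i j /eqP; rewrite nth_uniq ?enum_uniq ?(leq_trans (ltn_ord _))//.
    by move=> /eqP/val_inj.
  (* The rows of [W *m Q] are k orthonormal eigenvectors of S whose eigenvalues are at least
     [c ^+ 2]. *)
  pose W : 'M[K]_(k, n) := rowsub g 1%:M.
  have WW : W *m W^T = 1%:M.
    apply/matrixP => i j; rewrite mxE (bigD1 (g i))//= big1 ?addr0 => [|l lg].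
      by rewrite !mxE eqxx mul1r (inj_eq ginj) eq_sym.
    by rewrite !mxE eq_sym (negPf lg) mul0r.
  exists (W *m Q).
    apply/row_freeP; exists (Q^T *m W^T).
    by rewrite mulmxA -[W *m Q *m _]mulmxA QQ mulmx1.
  move=> u; rewrite quad !mulmxA sqn_orthogonal// -[_ *m Q *m _]mulmxA QQ mulmx1.
  rewrite sqnE mulr_sumr; apply: ler_sum => j _.
  have [jB|jB] := boolP (j \in B).
    by rewrite ler_wpM2r ?sqr_ge0//; move: jB; rewrite inE.
  suff -> : (u *m W) 0 j = 0 by rewrite expr0n !mulr0.
  rewrite mxE big1// => i _; rewrite !mxE.
  by rewrite (_ : (g i == j) = false) ?mulr0//; apply: contraNF jB => /eqP <-.
rewrite leqNgt; apply/negP => Bk.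
(* A dimension count yields a nonzero vector of the row space of V which is
   orthogonal to the eigenvectors of the large eigenvalues. *)
pose W : 'M[K]_(#|B|, n) := rowsub enum_val 1%:M.
pose Y : 'M[K]_(k, #|B|) := V *m Q^T *m W^T.
have [u u0 uY] : exists2 u : 'rV_k, u != 0 & u *m Y = 0.
  have : (\rank (kermx Y) > 0)%N.
    by rewrite mxrank_ker subn_gt0 (leq_ltn_trans (rank_leq_col _)).
  rewrite lt0n mxrank_eq0 => /rowV0Pn[u /sub_kermxP uY u0].
  by exists u.
set x := u *m V; set y := x *m Q^T.
have x0 : x != 0.
  by apply: contra u0 => /eqP x0; apply/eqP/(row_free_inj Vfree); rewrite mul0mx.
have yB j : j \in B -> y 0 j = 0.
  move=> jB; have := congr1 (fun M : 'rV_#|B| => M 0 (enum_rank_in jB j)) uY.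
  rewrite !mulmxA -/x -/y !mxE (bigD1 j)//= big1 => [|l lj].
    by rewrite !mxE enum_rankK_in// eqxx mulr1 addr0.
  by rewrite !mxE enum_rankK_in// eq_sym (negPf lj) mulr0.
have := HV u; rewrite -/x quad -/y.
have -> : sqn x = sqn y by rewrite /y sqn_orthogonal.
rewrite sqnE mulr_sumr leNgt => /negP; apply.
have y0 : y != 0.
  apply: contra x0 => /eqP y0; rewrite -[x]mulmx1 -QQ' mulmxA -/y y0 mul0mx.
  by [].
have /rV0Pn[j0 yj0] := y0.
have dlt j : y 0 j != 0 -> d 0 j < c ^+ 2.
  by rewrite ltNge; apply: contra => cd; rewrite yB ?inE.
rewrite (bigD1 j0)//= [ltRHS](bigD1 j0)//= ltr_leD//.
  by rewrite ltr_pM2r ?dlt// exprn_even_gt0.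
apply: ler_sum => j _; have [->|yj] := eqVneq (y 0 j) 0.
  by rewrite expr0n !mulr0.
by rewrite ler_wpM2r ?sqr_ge0// ltW// dlt.
Qed.

Lemma singular_value_ge0 m n (M : 'M[K]_(m, n)) k : 0 <= singular_value k M.
Proof.
rewrite /singular_value; set s := eigenvalues _.
have [ks|ks] := ltnP k.-1 (size s); last by rewrite nth_default// size_map.
by rewrite (nth_map 0)// sqrtr_ge0.
Qed.

(** If the singular value were positive, [singular_value_geP] at that very value would give a
    k-dimensional space on which [M^T] is injective. *)
Lemma singular_value_rank m n (M : 'M[K]_(m, n)) k : (0 < k <= n)%N ->
  (\rank M < k)%N -> singular_value k M = 0.
Proof.
move=> kn rk; apply/eqP; rewrite eq_le singular_value_ge0 andbT leNgt.
apply/negP => c0.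
have [V Vf HV] := (singular_value_geP M kn c0).1 (lexx _).
have : row_free (V *m M^T).
  apply: inj_row_free => u; rewrite mulmxA => uVM.
  have := HV u; rewrite uVM {2}/sqn mul0mx [X in _ <= X]mxE.
  rewrite pmulr_rle0 ?exprn_gt0// => s0.
  have /eqP : sqn (u *m V) = 0.
    by apply/eqP; rewrite eq_le s0 sqn_enorm sqr_ge0.
  rewrite sqn_enorm sqrf_eq0 enorm_eq0 => /eqP uV.
  by apply: (row_free_inj Vf); rewrite uV mul0mx.
rewrite /row_free => /eqP rV; have := mxrankM_maxr V M^T.
by rewrite rV mxrank_tr leqNgt rk.
Qed.

(* Weyl's inequality. *)
Lemma singular_value_perturb m n (M E : 'M[K]_(m, n)) k s : (0 < k <= n)%N ->
  0 <= s -> op_le E s -> singular_value k M - s <= singular_value k (M + E).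
Proof.
move=> kn s0 HE.
have [c0|c0] := leP (singular_value k M - s) 0.
  exact: le_trans c0 (singular_value_ge0 _ _).
have a0 : 0 < singular_value k M by lra.
have [V Vf HV] := (singular_value_geP M kn a0).1 (lexx _).
(* The space that is optimal for M also serves for M + E. *)
apply/(singular_value_geP _ kn c0); exists V => // u.
have := HV u; set x := u *m V; rewrite !sqn_enorm -!exprMn.
have h y z : 0 <= y -> 0 <= z -> (y ^+ 2 <= z ^+ 2) = (y <= z) :> bool.
  by move=> y0 z0; rewrite ler_pXn2r.
rewrite !h ?mulr_ge0 ?enorm_ge0 ?(ltW a0) ?(ltW c0)// => H.
have Et : op_le E^T s.
  move=> a b; have := HE b a; rewrite [_ * enorm a]mulrC; congr (_ <= _).
  have dE p q (A : 'M[K]_(p, q)) (c : 'rV_p) (e : 'rV_q) :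
      dotr (c *m A) e = (c *m A *m e^T) 0 0.
    by rewrite mxE; apply: eq_bigr => i _; rewrite [RHS]mulrC [e^T _ _]mxE mulrC.
  rewrite !dE; have -> : a *m E^T *m b^T = (b *m E *m a^T)^T.
    by rewrite !trmx_mul trmxK mulmxA.
  by rewrite [RHS]mxE.
have := op_le_enorm x s0 Et.
have : enorm (x *m M^T) <= enorm (x *m (M + E)^T) + enorm (x *m E^T).
  rewrite -[X in _ <= _ + X]enormN; apply: le_trans (enormD _ _).
  by rewrite linearD /= mulmxDr addrK.
by rewrite mulrBl; lra.
Qed.

End RealSpectral.

(** * Ranks of the matricizations *)

Section CyclicOrder.
Variable d' : nat.
Local Notation d := d'.+1.
Implicit Types (tau : {perm 'I_d}).
Local Open Scope nat_scope.

(* Up to reversal, a, b, c, e occur in this order on a circle. *)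
Definition cyclic4 (a b c e : nat) : bool :=
  [|| [&& a < b, b < c & c < e], [&& b < c, c < e & e < a],
      [&& c < e, e < a & a < b], [&& e < a, a < b & b < c],
      [&& b < a, c < b & e < c], [&& c < b, e < c & a < e],
      [&& e < c, a < e & b < a] | [&& a < e, b < a & c < b]].

Lemma correct_orderE tau i1 i2 i3 i4 : correct_order tau i1 i2 i3 i4 =
  cyclic4 (tau^-1 i1)%g (tau^-1 i2)%g (tau^-1 i3)%g (tau^-1 i4)%g.
Proof.
rewrite /correct_order; set f := (tau^-1)%g.
apply/andP/idP => [[_ /existsP[[[|[|[|[|s]]]] hs] //=]]|H].
- by rewrite /cyclic4 !andbT => /orP[/and3P[]|/and3P[]]; lia.
- by rewrite /cyclic4 !andbT => /orP[/and3P[]|/and3P[]]; lia.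
- by rewrite /cyclic4 !andbT => /orP[/and3P[]|/and3P[]]; lia.
- by rewrite /cyclic4 !andbT => /orP[/and3P[]|/and3P[]]; lia.
split.
  have finj : injective f by exact: perm_inj.
  rewrite -(map_inj_uniq finj) -(map_inj_uniq val_inj) /= !inE !negb_or !andbT.
  by move: H; rewrite /cyclic4; lia.
apply/existsP; move: H; rewrite /cyclic4.
case/or4P => [H|H|H|H].
- by exists (inord 0); rewrite inordK//= !andbT H.
- by exists (inord 1); rewrite inordK//= !andbT H.
- by exists (inord 2); rewrite inordK//= !andbT H.
case/or4P: H => [H|H|H|].
- by exists (inord 3); rewrite inordK//= !andbT H.
- by exists (inord 0); rewrite inordK//= !andbT H orbT.
- by exists (inord 1); rewrite inordK//= !andbT H orbT.
case/orP => H.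
- by exists (inord 2); rewrite inordK//= !andbT H orbT.
- by exists (inord 3); rewrite inordK//= !andbT H orbT.
Qed.

End CyclicOrder.

Section TensorRank.
Variables (K : realType) (m : nat).

(* Padding by zeros gives all cores the same format and removes the casts. *)
Definition pad_mx p q (A : 'M[K]_(p, q)) : 'M[K]_m := \matrix_(i, j)
  if insub (val i) is Some i' then
    if insub (val j) is Some j' then A i' j' else 0 else 0.

Lemma pad_mxE p q (A : 'M[K]_(p, q)) (pm : (p <= m)%N) (qm : (q <= m)%N) i j :
  pad_mx A (widen_ord pm i) (widen_ord qm j) = A i j.
Proof.
rewrite mxE /= (insubT (fun k => k < p)%N (ltn_ord i)) (insubT (fun k => k < q)%N (ltn_ord j)).
by congr (A _ _); exact: val_inj.
Qed.

Lemma pad_mxM p q s (A : 'M[K]_(p, q)) (B : 'M[K]_(q, s)) : (q <= m)%N ->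
  pad_mx (A *m B) = pad_mx A *m pad_mx B.
Proof.
move=> qm; apply/matrixP => i j; rewrite [RHS]mxE (bigID (fun k : 'I_m => (k < q)%N)) /=.
rewrite [X in _ = _ + X]big1 ?addr0 => [|k kq]; last first.
  by rewrite [X in _ * X]mxE insubF ?mulr0//; apply: negbTE.
rewrite (big_ord_narrow qm) mxE.
case: insubP => [i' _ ii'|ip]; last first.
  by rewrite big1// => k _; rewrite !mxE insubF ?mul0r//; exact: negbTE.
case: insubP => [j' _ jj'|js]; last first.
  rewrite big1// => k _; rewrite [X in _ * X]mxE [insub (val j)]insubF; last exact: negbTE.
  by case: insubP => *; rewrite mulr0.
by rewrite mxE; apply: eq_bigr => k _; rewrite !mxE /= -ii' -jj' !valK.
Qed.

Lemma pad_castmx p q p' q' (e : (p = p') * (q = q')) (A : 'M[K]_(p, q)) :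
  pad_mx (castmx e A) = pad_mx A.
Proof. by case: e => e1 e2; case: p' / e1; case: q' / e2; rewrite castmx_id. Qed.

Lemma mxtrace_pad p (A : 'M[K]_p) : (p <= m)%N -> \tr (pad_mx A) = \tr A.
Proof.
move=> pm; rewrite /mxtrace (bigID (fun k : 'I_m => (k < p)%N)) /=.
rewrite [X in _ + X]big1 ?addr0 => [|k kp]; last first.
  by rewrite mxE insubF//; exact: negbTE.
by rewrite (big_ord_narrow pm); apply: eq_bigr => k _; rewrite pad_mxE.
Qed.

(** The trace of a product is an inner product of vectorized matrices, so A factors through
    dimension [m * m]. *)
Lemma mxrank_trace_mul M N (X : 'I_M -> 'M[K]_m) (Y : 'I_N -> 'M[K]_m)
    (A : 'M[K]_(M, N)) : (forall k l, A k l = \tr (X k *m Y l)) ->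
  (\rank A <= m * m)%N.
Proof.
move=> AE.
have -> : A = (\matrix_k mxvec (X k)) *m (\matrix_l mxvec (Y l)^T)^T.
  apply/matrixP => k l; rewrite AE mxE /mxtrace.
  transitivity (\sum_i \sum_j X k i j * Y l j i).
    by apply: eq_bigr => i _; rewrite mxE.
  rewrite pair_big [RHS](reindex (uncurry (@mxvec_index m m))) /=; last exact: curry_mxvec_bij.
  by apply: eq_bigr => -[i j] _; rewrite !mxE !mxvecE /= mxE.
by apply: leq_trans (mxrankM_maxl _ _) (rank_leq_col _).
Qed.

Variables (d' : nat).
Local Notation d := d'.+1.
Variables (r n : 'I_d -> nat) (tau : {perm 'I_d}) (u : ring_cores K r n tau).
Hypothesis rm : forall j, (r j <= m)%N.

Definition core (x : multi_index n) (i : 'I_d) : 'M[K]_m := pad_mx (u (x i)).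

Definition core_prod (x : multi_index n) (s : seq 'I_d) : 'M[K]_m :=
  foldr (fun j B => core x (tau j) *m B) 1%:M s.

Lemma core_prod_cat x s1 s2 : core_prod x (s1 ++ s2) = core_prod x s1 *m core_prod x s2.
Proof. by elim: s1 => [|j s IH] /=; rewrite ?mul1mx// IH mulmxA. Qed.

Lemma eq_core_prod (x y : multi_index n) s :
  (forall j, j \in s -> x (tau j) = y (tau j)) -> core_prod x s = core_prod y s.
Proof.
elim: s => //= j s IH H; rewrite IH => [|k ks]; last by rewrite H// inE ks orbT.
by rewrite /core H// mem_head.
Qed.

(** The padded empty product is a projection and not the identity of size m, so it stays as a factor
    at the bond where the product starts. *)
Definition border : 'M[K]_m := pad_mx (1%:M : 'M[K]_(r ord0)).

Lemma val_iter_ordS k : val (iter k (@ordS d) ord0) = (k %% d)%N.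
Proof.
elim: k => [|k IHk]; first by rewrite mod0n.
by rewrite iterS /= IHk -[X in (X %% _)%N]addn1 modnDml addn1.
Qed.

Lemma pad_chain_mx (A : forall j : 'I_d, 'M[K]_(r j, r (ordS j))) x k :
  (forall j, pad_mx (A j) = core x (tau j)) ->
  pad_mx (chain_mx A ord0 k) =
  border *m core_prod x [seq iter i (@ordS d) ord0 | i <- iota 0 k].
Proof.
move=> AE; elim: k => [|k IH]; first by rewrite /= mulmx1.
rewrite [LHS]/= pad_mxM// IH AE -(addn1 k) iotaD map_cat core_prod_cat /= mulmx1.
by rewrite mulmxA.
Qed.

Lemma tr_tensorE x : tr_tensor u x = \tr (border *m core_prod x (enum 'I_d)).
Proof.
rewrite /tr_tensor /ring_trace.
set A := fun j : 'I_d => _.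
rewrite -mxtrace_pad// pad_castmx (@pad_chain_mx A x d) => [|j]; last first.
  by rewrite /A pad_castmx.
congr (\tr (_ *m core_prod x _)).
apply: (inj_map val_inj); rewrite val_enum_ord -map_comp.
rewrite -[RHS]map_id; apply/eq_in_map => i; rewrite mem_iota add0n /= => id.
by rewrite val_iter_ordS modn_small.
Qed.

Lemma set_coordsE (y : multi_index n) (a b c e : 'I_d)
    (xa : 'I_(n a)) (xb : 'I_(n b)) (xc : 'I_(n c)) (xe : 'I_(n e)) i :
  set_coords y xa xb xc xe i =
  eqtype.dfwith (eqtype.dfwith (eqtype.dfwith (eqtype.dfwith (fun i => y i) xa) xb) xc) xe i.
Proof. by rewrite /set_coords ffunE. Qed.

Lemma set_coords_notin (y : multi_index n) (a b c e : 'I_d)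
    (xa : 'I_(n a)) (xb : 'I_(n b)) (xc xc' : 'I_(n c)) (xe xe' : 'I_(n e)) i :
  i != c -> i != e ->
  set_coords y xa xb xc xe i = set_coords y xa xb xc' xe' i.
Proof.
move=> ic ie; rewrite !set_coordsE.
by do 2!(rewrite eqtype.dfwith_out; last by rewrite eq_sym); symmetry;
   do 2!(rewrite eqtype.dfwith_out; last by rewrite eq_sym).
Qed.

Lemma set_coords_in (y : multi_index n) (a b c e : 'I_d)
    (xa xa' : 'I_(n a)) (xb xb' : 'I_(n b)) (xc : 'I_(n c)) (xe : 'I_(n e)) i :
  i != a -> i != b ->
  set_coords y xa xb xc xe i = set_coords y xa' xb' xc xe i.
Proof.
move=> ia ib; rewrite !set_coordsE.
have [->|ie] := eqVneq i e; first by rewrite !eqtype.dfwith_in.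
rewrite eqtype.dfwith_out 1?eq_sym// [RHS]eqtype.dfwith_out 1?eq_sym//.
have [->|ic] := eqVneq i c; first by rewrite !eqtype.dfwith_in.
rewrite eqtype.dfwith_out 1?eq_sym// [RHS]eqtype.dfwith_out 1?eq_sym//.
do 2!(rewrite eqtype.dfwith_out; last by rewrite eq_sym); symmetry.
by do 2!(rewrite eqtype.dfwith_out; last by rewrite eq_sym).
Qed.

(* Cutting the ring at two bonds. *)
Lemma mxrank_matricization (y : multi_index n) (a b c e : 'I_d) (p q : nat) :
  let S j := (p <= (tau^-1)%g j < q)%N in
  (p <= q <= d)%N -> S a = S b -> S c = S e -> S a != S c ->
  (\rank (matricization (tr_tensor u) y a b c e) <= m * m)%N.
Proof.
move=> S /andP[pq qd] Sab Sce Sac.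
pose s := enum 'I_d.
pose s1 := take p s; pose s2 := take (q - p) (drop p s); pose s3 := drop (q - p) (drop p s).
have sE : s = s1 ++ s2 ++ s3 by rewrite /s2 /s3 !cat_take_drop.
have s2E j : (j \in s2) = (p <= j < q)%N.
  rewrite -(mem_map val_inj) /s2 map_take map_drop val_enum_ord drop_iota take_iota.
  rewrite mem_iota add0n (minn_idPl _); last by rewrite leq_sub2r.
  by rewrite subnKC.
have s13E j : (j \in s1 ++ s3) -> ~~ (p <= j < q)%N.
  rewrite mem_cat -!(mem_map val_inj) /s1 /s3 map_take 2!map_drop val_enum_ord.
  rewrite !drop_iota take_iota !mem_iota /=; lia.
have SE i (j : 'I_d) : S i -> ~~ (p <= j < q)%N -> tau j != i.
  by move=> Si; apply: contra => /eqP tj; move: Si; rewrite -tj /S permK.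
have SE' i (j : 'I_d) : ~~ S i -> (p <= j < q)%N -> tau j != i.
  by move=> Si jS; apply: contra Si => /eqP <-; rewrite /S permK.
(* X collects the arc of positions in [p, q), and Y the complementary arc, whose two pieces are
   joined by cyclicity of the trace. *)
pose X x := core_prod x s2; pose Y x := core_prod x s3 *m border *m core_prod x s1.
have TE x : tr_tensor u x = \tr (X x *m Y x).
  rewrite tr_tensorE -/s sE !core_prod_cat mxtrace_mulC -!mulmxA /Y /X.
  rewrite mxtrace_mulC -!mulmxA mxtrace_mulC -!mulmxA.
  done.
have YE (x x' : multi_index n) : (forall j, j \in s1 ++ s3 -> x (tau j) = x' (tau j)) -> Y x = Y x'.
  move=> H; rewrite /Y.
  rewrite (@eq_core_prod x x' s3) => [|j js]; last by rewrite H// mem_cat js orbT.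
  by rewrite (@eq_core_prod x x' s1) => [//|j js]; rewrite H// mem_cat js.
case Sa : (S a) Sac Sab => Sac Sab.
  have Sb : S b by rewrite -Sab.
  have Sc : ~~ S c by move: Sac; case: (S c).
  have Se : ~~ S e by rewrite -Sce.
  pose x1 (k : 'I_(n a * n b)) := set_coords y (index_pair k).1 (index_pair k).2 (y c) (y e).
  pose x2 (l : 'I_(n c * n e)) := set_coords y (y a) (y b) (index_pair l).1 (index_pair l).2.
  apply: (@mxrank_trace_mul _ _ (X \o x1) (Y \o x2)) => k l.
  have X1 : X (set_coords y (index_pair k).1 (index_pair k).2
      (index_pair l).1 (index_pair l).2) = X (x1 k).
    by apply: eq_core_prod => j; rewrite s2E => jS; apply: set_coords_notin; exact: SE'.
  have Y2 : Y (set_coords y (index_pair k).1 (index_pair k).2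
      (index_pair l).1 (index_pair l).2) = Y (x2 l).
    by apply: YE => j /s13E js; apply: set_coords_in; exact: SE.
  by rewrite mxE TE X1 Y2.
have Sb : ~~ S b by rewrite -Sab.
have Sc : S c by move: Sac; case: (S c).
have Se : S e by rewrite -Sce.
have Sa' : ~~ S a by rewrite Sa.
pose x1 (k : 'I_(n a * n b)) := set_coords y (index_pair k).1 (index_pair k).2 (y c) (y e).
pose x2 (l : 'I_(n c * n e)) := set_coords y (y a) (y b) (index_pair l).1 (index_pair l).2.
apply: (@mxrank_trace_mul _ _ (Y \o x1) (X \o x2)) => k l.
have Y1 : Y (set_coords y (index_pair k).1 (index_pair k).2
    (index_pair l).1 (index_pair l).2) = Y (x1 k).
  by apply: YE => j /s13E js; apply: set_coords_notin; exact: SE.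
have X2 : X (set_coords y (index_pair k).1 (index_pair k).2
    (index_pair l).1 (index_pair l).2) = X (x2 l).
  by apply: eq_core_prod => j; rewrite s2E => jS; apply: set_coords_in; exact: SE'.
by rewrite mxE TE X2 Y1 mxtrace_mulC.
Qed.

(** In both pairings the two pairs do not cross on the circle, so an interval of positions contains
    one pair and misses the other. *)
Lemma mxrank_correct_order (y : multi_index n) (i1 i2 i3 i4 : 'I_d) :
  correct_order tau i1 i2 i3 i4 ->
  (\rank (matricization (tr_tensor u) y i1 i2 i3 i4) <= m * m)%N /\
  (\rank (matricization (tr_tensor u) y i1 i4 i2 i3) <= m * m)%N.
Proof.
rewrite correct_orderE => H.
have sep (a b c e : 'I_d) (f := fun i => nat_of_ord ((tau^-1)%g i)) :
    [\/ (maxn (f a) (f b) < minn (f c) (f e))%N,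
       (maxn (f c) (f e) < minn (f a) (f b))%N,
       (minn (f a) (f b) < minn (f c) (f e))%N && (maxn (f c) (f e) < maxn (f a) (f b))%N |
       (minn (f c) (f e) < minn (f a) (f b))%N && (maxn (f a) (f b) < maxn (f c) (f e))%N] ->
  (\rank (matricization (tr_tensor u) y a b c e) <= m * m)%N.
  have := ltn_ord ((tau^-1)%g a); have := ltn_ord ((tau^-1)%g b).
  have := ltn_ord ((tau^-1)%g c); have := ltn_ord ((tau^-1)%g e).
  rewrite /f => he hc hb ha H'.
  (* The interval spanned by a and b separates the pairs unless c and e lie inside it; then the
     interval spanned by c and e does. *)
  have [abS|abS] := boolP [|| (maxn (f a) (f b) < minn (f c) (f e))%N,
      (maxn (f c) (f e) < minn (f a) (f b))%N |
      (minn (f c) (f e) < minn (f a) (f b))%N && (maxn (f a) (f b) < maxn (f c) (f e))%N].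
    apply: (@mxrank_matricization y a b c e (minn (f a) (f b)) (maxn (f a) (f b)).+1);
      move: abS; rewrite /f /=; lia.
  apply: (@mxrank_matricization y a b c e (minn (f c) (f e)) (maxn (f c) (f e)).+1);
    move: H' abS => /or4P; rewrite /f /=; lia.
move: H; rewrite /cyclic4 => H; split; apply: sep => /=; apply/or4P; move: H; lia.
Qed.

End TensorRank.

(** * Ring recovery from right answers *)

Section RingClass.
Variable d' : nat.
Local Notation d := d'.+1.
Implicit Types (tau : {perm 'I_d}).
Local Open Scope nat_scope.

Lemma perm_ordS_iter k (j : 'I_d) :
  val ((perm (@ordS_inj d) ^+ k)%g j) = ((j + k) %% d)%N.
Proof.
elim: k => [|k IH]; first by rewrite expg0 perm1 addn0 modn_small.
rewrite expgSr permM permE /= IH -[X in (X %% _)%N]addn1 modnDml addn1 addnS.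
by [].
Qed.

Lemma cyclic4_rot a b c e : cyclic4 a b c e = cyclic4 b c e a.
Proof.
rewrite /cyclic4.
move: [&& a < b, _ & _] [&& b < c, _ & _] [&& c < e, _ & _] [&& e < a, _ & _]
  [&& b < a, _ & _] [&& c < b, _ & _] [&& e < c, _ & _] [&& a < e, _ & _].
by do 8!case.
Qed.

Lemma cyclic4_wrap m a b c : a < m -> b < m -> c < m ->
  cyclic4 a.+1 b.+1 c.+1 0 = cyclic4 a b c m.
Proof.
move=> am bm cm.
have [am' bm' cm'] : [/\ (m < a) = false, (m < b) = false & (m < c) = false].
  by split; lia.
rewrite /cyclic4 !ltnS !ltn0 ?am' ?bm' ?cm' ?am ?bm ?cm /= ?andbT ?andbF /=.
by move: (a < b) (b < c) (c < a) (b < a) (c < b) (a < c); do 6!case.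
Qed.

Lemma cyclic4_shift a b c e : cyclic4 a.+1 b.+1 c.+1 e.+1 = cyclic4 a b c e.
Proof. by []. Qed.

Lemma cyclic4_rev m a b c e : a < m -> b < m -> c < m -> e < m ->
  cyclic4 (m - a.+1) (m - b.+1) (m - c.+1) (m - e.+1) = cyclic4 a b c e.
Proof.
move=> am bm cm em.
have E x y : x < m -> y < m -> (m - x.+1 < m - y.+1) = (y < x) by lia.
rewrite /cyclic4 !E//.
move: [&& a < b, _ & _] [&& b < c, _ & _] [&& c < e, _ & _] [&& e < a, _ & _]
  [&& b < a, _ & _] [&& c < b, _ & _] [&& e < c, _ & _] [&& a < e, _ & _].
by do 8!case.
Qed.

Lemma cyclic4_distinct a b c e : cyclic4 a b c e -> uniq [:: a; b; c; e].
Proof. rewrite /cyclic4 /= !inE. lia. Qed.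

(** Among four distinct positions at most one is the last, the only one that wraps; rotating it to
    the fourth slot reduces to [cyclic4_wrap]. With a repetition both sides are false. *)
Lemma cyclic4_ordS (a b c e : 'I_d) :
  cyclic4 (ordS a) (ordS b) (ordS c) (ordS e) = cyclic4 a b c e.
Proof.
have ltd (i : 'I_d) : nat_of_ord i != d' -> i < d' /\ nat_of_ord (ordS i) = i.+1.
  move=> id; have id' : i < d' by have := ltn_ord i; move: id; lia.
  by split=> //=; rewrite modn_small// ltnS.
have eqd (i : 'I_d) : nat_of_ord i = d' -> nat_of_ord (ordS i) = 0.
  by move=> /= ->; rewrite modnn.
have injS (i j : 'I_d) : (nat_of_ord (ordS i) == ordS j) = (nat_of_ord i == j).
  by rewrite !val_eqE (inj_eq (@ordS_inj d)).
have [U|U] := boolP (uniq [:: nat_of_ord a; nat_of_ord b; nat_of_ord c; nat_of_ord e]); last first.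
  rewrite [RHS](contraNF (@cyclic4_distinct _ _ _ _) U); apply: contraNF U.
  by move/cyclic4_distinct; rewrite /= !inE !injS.
set X := cyclic4 (ordS a) _ _ _.
move: U; rewrite /= !inE !negb_or andbT -!andbA {}/X.
move=> /and5P[ab ac ae bc /andP[be ce]].
have [ad|/ltd[ad ->]] := eqVneq (nat_of_ord a) d'.
  move: ab ac ae; rewrite ad (eqd _ ad) !(eq_sym d').
  move=> /ltd[? ->] /ltd[? ->] /ltd[? ->].
  by rewrite cyclic4_rot (cyclic4_wrap (m := d'))// [RHS]cyclic4_rot.
have [bd|/ltd[bd ->]] := eqVneq (nat_of_ord b) d'.
  move: bc be; rewrite bd (eqd _ bd) !(eq_sym d').
  move=> /ltd[? ->] /ltd[? ->].
  rewrite [LHS]cyclic4_rot [LHS]cyclic4_rot (cyclic4_wrap (m := d'))//.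
  by rewrite [RHS]cyclic4_rot [RHS]cyclic4_rot.
have [cd|/ltd[cd ->]] := eqVneq (nat_of_ord c) d'.
  move: ce; rewrite cd (eqd _ cd) !(eq_sym d').
  move=> /ltd[? ->].
  by rewrite -[LHS]cyclic4_rot (cyclic4_wrap (m := d'))// -[RHS]cyclic4_rot.
have [ed|/ltd[ed ->]] := eqVneq (nat_of_ord e) d'; last by rewrite cyclic4_shift.
by rewrite ed (eqd _ ed) (cyclic4_wrap (m := d')).
Qed.

Lemma correct_order_ordS tau a b c e :
  correct_order (perm (@ordS_inj d) * tau)%g a b c e = correct_order tau a b c e.
Proof.
have E i : (tau^-1)%g i = ordS (((perm (@ordS_inj d) * tau)^-1)%g i).
  by rewrite invMg permM -{1}[(tau^-1)%g i](permKV (perm (@ordS_inj d))) permE.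
by rewrite !correct_orderE !E cyclic4_ordS.
Qed.

Lemma correct_order_rev tau a b c e :
  correct_order (perm (@rev_ord_inj d) * tau)%g a b c e = correct_order tau a b c e.
Proof.
have E i : (tau^-1)%g i = rev_ord (((perm (@rev_ord_inj d) * tau)^-1)%g i).
  by rewrite invMg permM -{1}[(tau^-1)%g i](permKV (perm (@rev_ord_inj d))) permE.
by rewrite !correct_orderE !E /= cyclic4_rev.
Qed.

Lemma correct_order_ring_class tau tau' a b c e : tau' \in ring_class tau ->
  correct_order tau' a b c e = correct_order tau a b c e.
Proof.
case/imset2P => k l _ _ ->; rewrite -mulgA.
have A (j : nat) s :
    correct_order (perm (@ordS_inj d) ^+ j * s)%g a b c e = correct_order s a b c e.
  elim: j => [|j IH]; first by rewrite expg0 mul1g.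
  by rewrite expgS -mulgA correct_order_ordS.
case: l => -[|[|//]] l2 /=; first by rewrite expg0 mul1g A.
by rewrite expg1 correct_order_rev A.
Qed.

(** Normalizes the unknown rotation and reversal: relative to this representative, the algorithm
    merely has to keep a list sorted by position, with first position 0. *)
Lemma exists_sorted_representative tau q0 q1 q2 q3 :
  correct_order tau q0 q1 q2 q3 ->
  exists2 tau' : {perm 'I_d}, tau' \in ring_class tau &
    val ((tau'^-1)%g q0) = 0 /\
    [&& (tau'^-1)%g q0 < (tau'^-1)%g q1, (tau'^-1)%g q1 < (tau'^-1)%g q2 &
        (tau'^-1)%g q2 < (tau'^-1)%g q3].
Proof.
set f := (tau^-1)%g => H.
have finj : injective f by exact: perm_inj.
pose t1 := (perm (@rev_ord_inj d) ^+ 0 * perm (@ordS_inj d) ^+ (f q0) * tau)%g.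
(* The reversal sends position 0 to d - 1, so one more rotation step is needed to bring q0 to the
   front. *)
have k0d : (f q0).+1 %% d < d by rewrite ltn_mod.
pose t2 := (perm (@rev_ord_inj d) ^+ 1 * perm (@ordS_inj d) ^+ (Ordinal k0d) * tau)%g.
have t1C : t1 \in ring_class tau.
  by apply/imset2P; exists (f q0) (Ordinal (isT : 0 < 2)); rewrite ?inE.
have t2C : t2 \in ring_class tau.
  by apply/imset2P; exists (Ordinal k0d) (Ordinal (isT : 1 < 2)); rewrite ?inE.
have t1E j : nat_of_ord (f (t1 j)) = (j + f q0) %% d.
  by rewrite /t1 expg0 mul1g permM /f permK [LHS]perm_ordS_iter.
have t2E (j : 'I_d) : nat_of_ord (f (t2 j)) = (d - j.+1 + (f q0).+1) %% d.
  by rewrite /t2 expg1 2!permM /f permK [LHS]perm_ordS_iter permE /= modnDmr.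
have t10 : t1 ord0 = q0.
  by apply: finj; apply: val_inj; rewrite /= t1E add0n modn_small.
have t20 : t2 ord0 = q0.
  apply: finj; apply: val_inj; rewrite /= t2E subn1 /= addnS -addSn.
  by rewrite modnDl modn_small.
have p1 : (t1^-1)%g q0 = ord0 by rewrite -t10 permK.
have p2 : (t2^-1)%g q0 = ord0 by rewrite -t20 permK.
(* Away from q0 the two candidates are mirror images, so if the first does not sort q1, q2, q3, the
   second does. *)
have p12 i : i != q0 -> nat_of_ord ((t1^-1)%g i) = d - (t2^-1)%g i.
  move=> iq; set j := (t2^-1)%g i.
  have j0 : 0 < j.
    rewrite lt0n; apply: contra iq => /eqP j0; rewrite -(permKV t2 i) -/j -t20.
    by apply/eqP; congr (t2 _); exact: val_inj.
  have jd : d - j < d by have := ltn_ord j; lia.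
  suff -> : i = t1 (Ordinal jd) by rewrite permK.
  rewrite -(permKV t2 i) -/j; apply: finj; apply: val_inj; rewrite /= t1E t2E /=.
  by congr (_ %% _); have := ltn_ord j; lia.
have U : uniq [:: q0; q1; q2; q3] by case/andP: H.
have [q10 q20 q30] : [/\ q1 != q0, q2 != q0 & q3 != q0].
  by move: U; rewrite /= !inE !negb_or !(eq_sym _ q0) => /andP[/and3P[]].
have := H; rewrite -(correct_order_ring_class _ _ _ _ t1C) correct_orderE p1.
have z1 : 0 < (t1^-1)%g q1.
  rewrite lt0n; apply: contra q10 => /eqP z; rewrite -(permKV t1 q1) -t10.
  by apply/eqP; congr (t1 _); exact: val_inj.
have [A|A] := boolP (((t1^-1)%g q1 < (t1^-1)%g q2) && ((t1^-1)%g q2 < (t1^-1)%g q3)).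
  by move=> _; exists t1 => //; rewrite p1 z1.
rewrite /cyclic4 [nat_of_ord ord0]/= !ltn0 !andbF z1 (negbTE A) /= !orbF.
move=> /and3P[ba cb c0]; have a0 := ltn_ord ((t1^-1)%g q1).
exists t2; rewrite // p2; split=> //=; move: ba cb c0 a0; rewrite !p12// => ba cb c0 a0.
pose g i := nat_of_ord ((t2^-1)%g i).
have gd i : g i < d by exact: ltn_ord.
suff : [&& 0 < g q1, g q1 < g q2 & g q2 < g q3] by [].
have {}ba : d - g q2 < d - g q1 by [].
have {}cb : d - g q3 < d - g q2 by [].
have {}a0 : d - g q1 < d by [].
by move: (g q1) (g q2) (g q3) (gd q1) (gd q2) (gd q3) ba cb a0 => x y z; lia.
Qed.

(** The cases follow those of [four_index]: the arrangement i1, i3, i2, i4 is the one whose crossing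
    pairing is (i1, i2), (i3, i4), that of the first matrix. *)
Definition right_answer tau (i1 i2 i3 i4 : 'I_d) : option (seq 'I_d) :=
  if correct_order tau i1 i3 i2 i4 then Some [:: i1; i3; i2; i4]
  else if correct_order tau i1 i2 i3 i4 then Some [:: i1; i2; i3; i4]
  else if correct_order tau i1 i2 i4 i3 then Some [:: i1; i2; i4; i3]
  else None.

Lemma equiv_tupleE (x0 x1 x2 x3 : 'I_d) (t : seq 'I_d) :
  equiv_tuple [:: x0; x1; x2; x3] t =
  (t \in [:: [:: x0; x1; x2; x3]; [:: x1; x2; x3; x0]; [:: x2; x3; x0; x1]; [:: x3; x0; x1; x2];
             [:: x3; x2; x1; x0]; [:: x2; x1; x0; x3]; [:: x1; x0; x3; x2]; [:: x0; x3; x2; x1]]).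
Proof.
rewrite /equiv_tuple !inE; apply/existsP/idP.
  by case=> -[[|[|[|[|k]]]] hk] //= /orP[|] ->; rewrite ?orbT.
do 7?[case/orP]; move=> H.
- by exists (inord 0); rewrite inordK//= H.
- by exists (inord 1); rewrite inordK//= H.
- by exists (inord 2); rewrite inordK//= H.
- by exists (inord 3); rewrite inordK//= H.
- by exists (inord 0); rewrite inordK//= H orbT.
- by exists (inord 1); rewrite inordK//= H orbT.
- by exists (inord 2); rewrite inordK//= H orbT.
- by exists (inord 3); rewrite inordK//= H orbT.
Qed.

End RingClass.

Section Insertion.
Variable d' : nat.
Local Notation d := d'.+1.
Implicit Types (tau : {perm 'I_d}).
Local Open Scope nat_scope.

(** The points a, b, e cut the circle into three arcs, and each of the three cyclic orders places x
    in one of them; the arc from e back to a is the complement of the interval from a to e. *)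
Lemma cyclic4_insert (x a b e : nat) : a < b -> b < e ->
  x != a -> x != b -> x != e ->
  [/\ cyclic4 x b a e = (b < x < e), cyclic4 x a b e = ~~ (a < x < e) &
      cyclic4 x a e b = (a < x < b)].
Proof.
move=> ab be xa xb xe; have ae := ltn_trans ab be.
have [ba eb ea] : [/\ (b < a) = false, (e < b) = false & (e < a) = false].
  by split; apply/negbTE; rewrite -leqNgt ltnW.
have C y : x != y -> (y < x) = ~~ (x < y) by move=> xy; rewrite -leqNgt ltn_neqAle eq_sym xy.
have : (x < a) ==> (x < b) by apply/implyP => xa'; exact: ltn_trans xa' ab.
have : (x < b) ==> (x < e) by apply/implyP => xb'; exact: ltn_trans xb' be.
rewrite /cyclic4 ab be ae ba eb ea !(C _ xa) !(C _ xb) !(C _ xe).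
by case: (x < a); case: (x < b); case: (x < e).
Qed.

Lemma right_answer_insert tau (v a b e : 'I_d) (p := fun i => nat_of_ord ((tau^-1)%g i)) :
  p a < p b -> p b < p e -> v \notin [:: a; b; e] ->
  exists2 q, right_answer tau v a b e = Some q &
    equiv_tuple q [:: a; v; b; e] = (p a < p v < p b) /\
    equiv_tuple q [:: a; b; v; e] = (p b < p v < p e).
Proof.
move=> ab be; rewrite !inE !negb_or => /and3P[va vb ve].
have pinj i j : (i == j) = (p i == p j) by rewrite /p val_eqE (inj_eq perm_inj).
have [nab nbe nae] : [/\ (a == b) = false, (b == e) = false & (a == e) = false].
  by rewrite !pinj; split; lia.
have nva := negbTE va; have nvb := negbTE vb; have nve := negbTE ve.
have nav : (a == v) = false by rewrite eq_sym.
have nbv : (b == v) = false by rewrite eq_sym.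
have nev : (e == v) = false by rewrite eq_sym.
have nba : (b == a) = false by rewrite eq_sym.
have neb : (e == b) = false by rewrite eq_sym.
have nea : (e == a) = false by rewrite eq_sym.
have [C1 C2 C3] : [/\ cyclic4 (p v) (p b) (p a) (p e) = (p b < p v < p e),
    cyclic4 (p v) (p a) (p b) (p e) = ~~ (p a < p v < p e) &
    cyclic4 (p v) (p a) (p e) (p b) = (p a < p v < p b)].
  by apply: cyclic4_insert; rewrite -?pinj ?nva ?nvb ?nve.
rewrite /right_answer !correct_orderE C1 C2 C3.
have N := (nab, nbe, nae, nva, nvb, nve, nav, nbv, nev, nba, neb, nea).
have [H2|H2] := boolP (p b < p v < p e).
  exists [:: v; b; a; e] => //; rewrite !equiv_tupleE !inE !eqseq_cons !eqxx !N /=.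
  have /andP[bv _] := H2; split=> //; apply/esym/negbTE/negP => /andP[_].
  by rewrite ltnNge (ltnW bv).
have [H1|H1] := boolP (p a < p v < p b).
  have /andP[av vb'] := H1; rewrite av (ltn_trans vb' be) /=.
  by exists [:: v; a; e; b] => //; rewrite !equiv_tupleE !inE !eqseq_cons !eqxx !N /=.
have -> : (p a < p v < p e) = false.
  apply/negP => /andP[av ve']; move: H1 H2; rewrite av ve' /= andbT -!leqNgt => bv vb'.
  have : p v == p b by rewrite eqn_leq vb' bv.
  by rewrite -pinj nvb.
by exists [:: v; a; b; e] => //; rewrite !equiv_tupleE !inE !eqseq_cons !eqxx !N /=.
Qed.

End Insertion.

(** * The search loop and its list of calls *)

Section Calls.
Variable d' : nat.
Local Notation d := d'.+1.
Implicit Types (tau : {perm 'I_d}).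
Local Open Scope nat_scope.

Definition answers_right tau (F : nat -> 'I_d -> 'I_d -> 'I_d -> 'I_d -> option (seq 'I_d))
    (x : nat * 4.-tuple 'I_d) : Prop :=
  let i j := tnth x.2 (inord j) in
  F x.1 (i 0) (i 1) (i 2) (i 3) = right_answer tau (i 0) (i 1) (i 2) (i 3).

Lemma answers_rightE tau F c (a b e f : 'I_d) :
  answers_right tau F (c, [tuple a; b; e; f]) <-> F c a b e f = right_answer tau a b e f.
Proof. by rewrite /answers_right /= !(tnth_nth a) /= !inordK. Qed.

(** Every reachable branch at least halves the width. The alternative [j2 <= jmin] belongs to the
    probes 1, t - 1, t at width 2: there the interval from j1 to j2 can be long, but v is already
    known to lie behind it. *)
Lemma probesP t jmin jmax j1 j2 j3 : 3 < t -> 0 < jmin -> jmin.+1 < jmax -> jmax <= t.+1 ->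
  probes t jmin jmax = (j1, j2, j3) ->
  [/\ 0 < j1, j1 < j2, j2 < j3, j3 <= t & j1 <= jmin] /\
  [/\ j2 - j1 <= (jmax - jmin)./2 \/ j2 <= jmin, j3 - j2 <= (jmax - jmin)./2,
      j3 <= jmax & jmax - j3 <= (jmax - jmin)./2].
Proof.
move=> t4 j0 jj jt; rewrite /probes; case: ifP => [w3 [<- <- <-]|w2].
  have -> : (jmax - jmin)./2 = (jmax - jmin) %/ 2 by rewrite divn2.
  split; split; try left; lia.
case: ifP => [jm [<- <- <-]|jm [<- <- <-]].
  have -> : (jmax - jmin)./2 = (jmax - jmin) %/ 2 by rewrite divn2.
  split; split; try left; lia.
have -> : (jmax - jmin)./2 = (jmax - jmin) %/ 2 by rewrite divn2.
split; split; try right; lia.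
Qed.

(** The invariant is that v lies between the entries at jmin and jmax; jmax = size s + 1 means that
    there is no right neighbour. The list L of calls is chosen before F, so it is the same for every
    F that answers them rightly. *)
Lemma locate_correct tau (v : 'I_d) (s : seq 'I_d)
    (p := fun i => nat_of_ord ((tau^-1)%g i)) fuel c jmin jmax :
  3 < size s -> sorted ltn [seq p i | i <- s] -> v \notin s ->
  0 < jmin -> jmin < jmax -> jmax <= (size s).+1 ->
  p (nth v s jmin.-1) < p v ->
  (jmax <= size s -> p v < p (nth v s jmax.-1)) ->
  jmax - jmin <= fuel ->
  exists (L : seq (nat * 4.-tuple 'I_d)) c' j,
  [/\ size L <= trunc_log 2 (jmax - jmin), (forall x, x \in L -> uniq (tval x.2)),
      0 < j <= size s /\ p (nth v s j.-1) < p v, (j < size s -> p v < p (nth v s j)) &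
      forall F, (forall x, x \in L -> answers_right tau F x) ->
        locate F (size s) s v fuel c jmin jmax = Some (c', (j, j.+1))].
Proof.
move=> t4 ss vs.
have pinj : injective p by move=> i j /val_inj/perm_inj.
have S i j : i < j -> j < size s -> p (nth v s i) < p (nth v s j).
  move=> ij js; have is_ := ltn_trans ij js.
  have := sorted_ltn_nth ltn_trans 0 ss; rewrite size_map => /(_ i j).
  by rewrite !inE !(nth_map v)//; apply.
elim: fuel c jmin jmax => [|fuel IH] c jmin jmax j0 jj jt pmin pmax wf.
  by exfalso; move: wf jj; clear; lia.
have [w1|w2] := ltnP (jmax - jmin) 2.
  have jE : jmax = jmin.+1 by lia.
  exists [::], c, jmin; split=> //; first by rewrite j0; move: jt; rewrite jE ltnS.
    by move: pmax; rewrite jE.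
  by move=> F _; rewrite /= w1 jE.
case E: (probes (size s) jmin jmax) => [[j1 j2] j3].
have jj' : jmin.+1 < jmax by lia.
have [[h1 h2 h3 h4 h5] [h6 h7 h8 h9]] := probesP t4 j0 jj' jt E.
set w := jmax - jmin in w2 wf h6 h7 h9 *.
have wh : w./2 <= fuel by rewrite -divn2; lia.
(* Halving the width pays for the call just made. *)
have wlog w' : w' <= w./2 -> (trunc_log 2 w').+1 <= trunc_log 2 w.
  by move=> ww; rewrite (trunc_log2S w2) ltnS; apply: leq_trunc_log.
have p12 : p (nth v s j1.-1) < p (nth v s j2.-1) by apply: S; lia.
have p23 : p (nth v s j2.-1) < p (nth v s j3.-1) by apply: S; lia.
have p1v : p (nth v s j1.-1) < p v.
  by move: h5; rewrite leq_eqVlt => /orP[/eqP-> //|lt]; apply: (ltn_trans _ pmin); apply: S; lia.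
have nv i : 0 < i -> i <= size s -> v != nth v s i.-1.
  by move=> i0 ile; apply: contra vs => /eqP->; apply: mem_nth; rewrite prednK.
have vn : v \notin [:: nth v s j1.-1; nth v s j2.-1; nth v s j3.-1].
  by rewrite !inE !negb_or !nv//; clear -h1 h2 h3 h4; lia.
have [q qR [q1 q2]] := right_answer_insert p12 p23 vn.
have U : uniq [:: v; nth v s j1.-1; nth v s j2.-1; nth v s j3.-1].
  rewrite cons_uniq vn /= !inE -!(inj_eq pinj).
  by move: p12 p23; clear; lia.
set x := (c, [tuple v; nth v s j1.-1; nth v s j2.-1; nth v s j3.-1]).
have step F fuel' : answers_right tau F x ->
    locate F (size s) s v fuel'.+1 c jmin jmax =
    if p (nth v s j1.-1) < p v < p (nth v s j2.-1) then locate F (size s) s v fuel' c.+1 j1 j2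
    else if p (nth v s j2.-1) < p v < p (nth v s j3.-1) then locate F (size s) s v fuel' c.+1 j2 j3
    else locate F (size s) s v fuel' c.+1 j3 jmax.
  move=> /answers_rightE Fx; rewrite /= ltnNge w2 /= E Fx qR q1 q2.
  by [].
have finish (b : bool) k1 k2 : b -> 0 < k1 -> k1 < k2 -> k2 <= (size s).+1 ->
    p (nth v s k1.-1) < p v -> (k2 <= size s -> p v < p (nth v s k2.-1)) ->
    k2 - k1 <= w./2 ->
    (forall F, answers_right tau F x ->
       locate F (size s) s v fuel.+1 c jmin jmax = locate F (size s) s v fuel c.+1 k1 k2) ->
    exists (L : seq (nat * 4.-tuple 'I_d)) c' j,
    [/\ size L <= trunc_log 2 w, (forall x, x \in L -> uniq (tval x.2)),
      0 < j <= size s /\ p (nth v s j.-1) < p v, (j < size s -> p v < p (nth v s j)) &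
      forall F, (forall x, x \in L -> answers_right tau F x) ->
        locate F (size s) s v fuel.+1 c jmin jmax = Some (c', (j, j.+1))].
  move=> _ k10 k12 k2s pk1 pk2 kw H.
  have [L [c' [j [Ls Lu j1' j2' LF]]]] := IH c.+1 k1 k2 k10 k12 k2s pk1 pk2 (leq_trans kw wh).
  exists (x :: L), c', j; split=> //.
  - by apply: leq_trans (wlog _ kw); rewrite /= ltnS.
  - by move=> y; rewrite inE => /predU1P[->//|/Lu].
  - move=> F FL; rewrite H; last by apply: FL; rewrite inE eqxx.
    by apply: LF => y yL; apply: FL; rewrite inE yL orbT.
have [c1|c1] := boolP (p (nth v s j1.-1) < p v < p (nth v s j2.-1)).
  case: h6 => [h6|h6].
    apply: (finish _ j1 j2 c1) => //; first by lia.
      by move=> _; case/andP: c1.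
    by move=> F Fx; rewrite step// c1.
  (* A right answer cannot place v before j2 here, since [j2 <= jmin] and v lies behind jmin. *)
  exfalso; move: h6; rewrite leq_eqVlt => /orP[/eqP e|lt].
    by case/andP: c1 => _; rewrite e ltnNge (ltnW pmin).
  have := S j2.-1 jmin.-1; case/andP: c1 => _ c1 H.
  have : p (nth v s j2.-1) < p (nth v s jmin.-1) by apply: H; lia.
  by move: c1 pmin; clear; lia.
have [c2|c2] := boolP (p (nth v s j2.-1) < p v < p (nth v s j3.-1)).
  apply: (finish _ j2 j3 c2) => //; [by lia | by lia | by case/andP: c2 | |].
    by move=> _; case/andP: c2.
  by move=> F Fx; rewrite step// (negbTE c1) c2.
have p3v : p (nth v s j3.-1) < p v.
  have n2 : p v != p (nth v s j2.-1) by rewrite (inj_eq pinj) nv//; lia.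
  have n3 : p v != p (nth v s j3.-1) by rewrite (inj_eq pinj) nv//; lia.
  by move: c1 c2 p1v n2 n3; clear; lia.
(* If j3 were jmax, it would be a genuine entry of s, and the invariant would place v before it. *)
have j3m : j3 < jmax.
  rewrite ltn_neqAle h8 andbT; apply: contraL p3v => /eqP e.
  by rewrite -leqNgt e ltnW// pmax// -e.
apply: (finish true j3 jmax) => //; first by lia.
by move=> F Fx; rewrite step// (negbTE c1) (negbTE c2).
Qed.

End Calls.

Section Recovery.
Variable d' : nat.
Local Notation d := d'.+1.
Implicit Types (tau : {perm 'I_d}).
Local Open Scope nat_scope.

(** The invariant of the outer loop. The first entry must have position 0 because the search starts
    at jmin = 1 and never inserts at the front. *)
Definition partial_order tau (t : nat) (s : seq 'I_d) : Prop :=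
  [/\ size s = t, sorted ltn [seq nat_of_ord ((tau^-1)%g i) | i <- s],
      forall x, nat_of_ord ((tau^-1)%g (nth x s 0)) = 0 & forall x : 'I_d, (x \in s) = (x < t)].

Lemma sorted_insert (T : eqType) (leT : rel T) (v : T) (s : seq T) (j : nat) :
  transitive leT -> sorted leT s -> 0 < j <= size s ->
  leT (nth v s j.-1) v -> (j < size s -> leT v (nth v s j)) ->
  sorted leT (take j s ++ v :: drop j s).
Proof.
move=> tr ss /andP[j0 js] l r.
have := ss; rewrite -{1}(cat_take_drop j s) !(sorted_pairwise tr) !pairwise_cat.
move=> /and3P[AB A B]; rewrite A /= B andbT /=.
apply/andP; split.
  rewrite allrel_consr AB andbT; apply/(all_nthP v) => i.
  rewrite size_takel// => ij; rewrite nth_take// ?j0.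
  have [->//|ne] := eqVneq i j.-1.
  apply: (tr _ _ _ _ l); apply: (sorted_ltn_nth tr v ss); rewrite ?inE; last by move: ij ne; clear; lia.
    by apply: leq_trans js.
  by rewrite prednK.
apply/(all_nthP v) => i; rewrite size_drop nth_drop => ij.
have js' : j < size s by move: ij; clear; lia.
case: i ij => [|i] ij; first by rewrite addn0; exact: r.
apply: (tr _ _ _ (r js')); apply: (sorted_ltn_nth tr v ss); rewrite ?inE//; last by clear; lia.
by move: ij; clear; lia.
Qed.

Lemma insertion_step_correct tau t s c : 3 < t -> t < d -> partial_order tau t s ->
  exists (L : seq (nat * 4.-tuple 'I_d)) c' s',
  [/\ size L <= trunc_log 2 d, (forall x, x \in L -> uniq (tval x.2)),
      partial_order tau t.+1 s' &
      forall F, (forall x, x \in L -> answers_right tau F x) ->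
        insertion_step F (Some (c, s)) t = Some (c', s')].
Proof.
move=> t3 td [st ss s0 sE]; set p := fun i => nat_of_ord ((tau^-1)%g i) in ss s0.
pose v : 'I_d := inord t.
have vt : nat_of_ord v = t by rewrite inordK.
have vs : v \notin s by rewrite sE vt ltnn.
have pv : p (nth v s 0) < p v.
  rewrite /p s0 lt0n -(s0 v) /= val_eqE (inj_eq perm_inj).
  by apply: contra vs => /eqP->; rewrite mem_nth// st (ltn_trans _ t3).
have h1 : 3 < size s by rewrite st.
have h2 : 1 < t.+1 by rewrite ltnS (ltn_trans _ t3).
have h3 : t.+1 <= (size s).+1 by rewrite st.
have h4 : t.+1 <= size s -> p v < p (nth v s t) by rewrite st ltnn.
have h5 : t.+1 - 1 <= 2 * t by rewrite subn1 /= leq_pmull.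
have [L [c' [j [Ls Lu [j1 j2] j3 LF]]]] :=
  @locate_correct _ tau v s (2 * t) c 1 t.+1 h1 ss vs isT h2 h3 pv h4 h5.
exists L, c', (take j s ++ v :: drop j s); split=> //.
- apply: leq_trans Ls _; apply: leq_trunc_log.
  by rewrite subn1 ltnW.
- split.
  + by rewrite size_cat /= addnS -size_cat cat_take_drop st.
  + have := @sorted_insert _ ltn (p v) [seq p i | i <- s] j ltn_trans ss.
    rewrite size_map map_cat map_take /= map_drop; apply=> //.
      by rewrite (nth_map v)//; case/andP: j1; clear; case: j.
    by move=> js; rewrite (nth_map v)//; exact: j3.
  + move=> x; have /andP[j0 js] := j1; rewrite nth_cat size_takel// j0 nth_take//; apply: (s0 x).
  + move=> x; rewrite mem_cat inE orbCA -mem_cat cat_take_drop sE [RHS]ltnS [RHS]leq_eqVlt.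
    by congr (_ || _); rewrite -val_eqE /= vt.
move=> F FL; rewrite /= -/v.
by move: (LF F FL); rewrite st => ->.
Qed.

Lemma insertion_fold_correct tau m t s c : 3 < t -> t + m <= d -> partial_order tau t s ->
  exists (L : seq (nat * 4.-tuple 'I_d)) c' s',
  [/\ size L <= m * trunc_log 2 d, (forall x, x \in L -> uniq (tval x.2)),
      partial_order tau (t + m) s' &
      forall F, (forall x, x \in L -> answers_right tau F x) ->
        foldl (insertion_step F) (Some (c, s)) (iota t m) = Some (c', s')].
Proof.
elim: m t s c => [|m IH] t s c t3 td pt.
  by exists [::], c, s; split=> //; rewrite addn0.
have td' : t < d by move: td; clear; lia.
have [L1 [c1 [s1 [L1s L1u p1 L1F]]]] := insertion_step_correct c t3 td' pt.
have [||L2 [c2 [s2 [L2s L2u p2 L2F]]]] := IH t.+1 s1 c1 _ _ p1.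
- exact: ltnW.
- by rewrite addSnnS.
exists (L1 ++ L2), c2, s2; split.
- by rewrite size_cat mulSn leq_add.
- by move=> x; rewrite mem_cat => /orP[/L1u|/L2u].
- by rewrite -addSnnS.
- move=> F FL; rewrite -[iota t m.+1]/(t :: iota t.+1 m).
  rewrite -[LHS]/(foldl _ (insertion_step F (Some (c, s)) t) _).
  rewrite L1F; last by move=> x xL; apply: FL; rewrite mem_cat xL.
  by apply: L2F => x xL; apply: FL; rewrite mem_cat xL orbT.
Qed.

Lemma partial_order_full tau s : partial_order tau d s -> s = [seq tau j | j <- enum 'I_d].
Proof.
move=> [_ ss _ sE]; apply: (@inj_map _ _ (fun i => nat_of_ord ((tau^-1)%g i))).
  by move=> i j /val_inj/perm_inj.
have E : [seq nat_of_ord ((tau^-1)%g i) | i <- [seq tau j | j <- enum 'I_d]] = iota 0 d.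
  by rewrite -map_comp -val_enum_ord; apply: eq_map => j /=; rewrite permK.
apply: (irr_sorted_eq ltn_trans ltnn ss); first by rewrite E iota_ltn_sorted.
move=> k; rewrite E mem_iota add0n /=; apply/mapP/idP => [[x _ ->] //|kd].
by exists (tau (Ordinal kd)); rewrite ?sE ?permK// ltn_ord.
Qed.

Lemma cyclic4_exists (a b c e : nat) : uniq [:: a; b; c; e] ->
  [|| cyclic4 a c b e, cyclic4 a b c e | cyclic4 a b e c].
Proof.
rewrite /= !inE !negb_or andbT -!andbA /cyclic4 => /and5P[].
by case: (ltngtP a b) => // ab _; case: (ltngtP a c) => // ac _;
  case: (ltngtP a e) => // ae _; case: (ltngtP b c) => // bc _ /andP[];
  case: (ltngtP b e) => // be _; case: (ltngtP c e) => // ce _;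
  rewrite ?orbT//; move: ab ac ae bc be ce; clear; lia.
Qed.

Lemma right_answer_exists tau (a b c e : 'I_d) : uniq [:: a; b; c; e] ->
  exists q0 q1 q2 q3, [/\ right_answer tau a b c e = Some [:: q0; q1; q2; q3],
    correct_order tau q0 q1 q2 q3 & [:: q0; q1; q2; q3] =i [:: a; b; c; e]].
Proof.
move=> U; have := @cyclic4_exists ((tau^-1)%g a) ((tau^-1)%g b) ((tau^-1)%g c) ((tau^-1)%g e).
rewrite -(map_inj_uniq (@perm_inj _ (tau^-1)%g)) -(map_inj_uniq val_inj) in U.
move=> /(_ U); rewrite -!correct_orderE /right_answer.
case: ifP => [H _|_ /=]; first by exists a, c, b, e; split=> // x; rewrite !inE orbCA; do !bool_congr.
case: ifP => [H _|_ /= H]; first by exists a, b, c, e.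
by rewrite H; exists a, b, e, c; split=> // x; rewrite !inE; do !bool_congr.
Qed.

(** The normalized tau' is fixed by the right answer to the first call. Right answers depend only on
    the class of tau, so the insertions can be analysed relative to tau'. *)
Lemma ring_recovery_correct tau : 3 < d ->
  exists (L : seq (nat * 4.-tuple 'I_d)) (tau' : {perm 'I_d}),
  [/\ size L <= d * trunc_log 2 d, (forall x, x \in L -> uniq (tval x.2)),
      tau' \in ring_class tau &
      forall F, (forall x, x \in L -> answers_right tau F x) -> ring_recovery F = Some tau'].
Proof.
move=> d4; pose i k : 'I_d := inord k.
have iE k : k < 4 -> nat_of_ord (i k) = k.
  by move=> k4; rewrite inordK// (leq_trans k4).
have xE k (x : 'I_d) : k < 4 -> (x == i k) = (nat_of_ord x == k).
  by move=> k4; rewrite -{2}(iE k).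
have U : uniq [:: i 0; i 1; i 2; i 3].
  rewrite -[[:: _; _; _; _]]/(map i (iota 0 4)) map_inj_in_uniq ?iota_uniq// => a b.
  by rewrite !mem_iota => a4 b4 /(congr1 (@nat_of_ord d)); rewrite !iE.
have [q0 [q1 [q2 [q3 [qE qc qi]]]]] := right_answer_exists tau U.
have [tau' tauC [t0 /and3P[t01 t12 t23]]] := exists_sorted_representative qc.
have RA a b c e : right_answer tau' a b c e = right_answer tau a b c e.
  by rewrite /right_answer !(correct_order_ring_class _ _ _ _ tauC).
have P4 : partial_order tau' 4 [:: q0; q1; q2; q3].
  split=> //=; first by rewrite t01 t12 t23.
  move=> x; rewrite qi !inE !xE//=.
  by case: (nat_of_ord x) => [|[|[|[|k]]]].
have [|L [c' [s' [Ls Lu p' LF]]]] := insertion_fold_correct 1 (isT : 3 < 4) _ P4 (m := d - 4).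
  by rewrite subnKC.
rewrite subnKC// in p'.
exists ((0, [tuple i 0; i 1; i 2; i 3]) :: L), tau'; split=> //.
(* Only d - 4 elements are inserted, which leaves room for the initial call in the bound. *)
- have : 2 <= trunc_log 2 d by apply: (@leq_trunc_log 2 4 d).
  move: Ls d4; rewrite /= => Ls d4 l2; apply: leq_ltn_trans Ls _.
  by rewrite ltn_mul2r; apply/andP; split; move: l2 d4; clear; lia.
- by move=> x; rewrite inE => /predU1P[->//|/Lu].
move=> F FL; rewrite /ring_recovery.
have /answers_rightE -> : answers_right tau F (0, [tuple i 0; i 1; i 2; i 3]).
  by apply: FL; rewrite inE eqxx.
rewrite qE /= LF; last first.
  move=> x xL; have := FL x; rewrite inE xL orbT => /(_ isT).
  by rewrite /answers_right RA.
have sE := partial_order_full p'.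
case: pickP => [t2 /eqP|/(_ tau')]; last by rewrite sE eqxx.
rewrite sE => /eq_in_map E; congr Some; apply/permP => j.
by apply: E; rewrite mem_enum.
Qed.

End Recovery.

(** The constant 2 comes from ln 2 >= 1 / 2, which follows from exp (- 1 / 2) >= 1 / 2. *)
Lemma trunc_log_le_ln (K : realType) (n : nat) : (0 < n)%N ->
  (trunc_log 2 n)%:R <= 2 * ln n%:R :> K.
Proof.
move=> n0; have n0' : (0 : K) < n%:R by rewrite ltr0n.
have ln2 : 1 / 2 <= ln 2 :> K.
  rewrite -ler_expR lnK ?posrE//.
  have := @expR_ge1Dx K (- (1 / 2)); rewrite expRN => H.
  have e0 := expR_gt0 (1 / 2 : K).
  have : expR (1 / 2) * (expR (1 / 2))^-1 = 1 :> K by rewrite mulfV// gt_eqF.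
  by move: H; set e := expR _; nra.
have : (trunc_log 2 n)%:R * ln 2 <= ln n%:R :> K.
  rewrite mulr_natl -lnXn// ler_ln ?posrE ?exprn_gt0//.
  by rewrite -natrX ler_nat trunc_logP.
have : (0 : K) <= (trunc_log 2 n)%:R by [].
by nra.
Qed.

(** * Noisy calls *)

Section FourIndex.
Variables (K : realType) (d' : nat).
Local Notation d := d'.+1.
Variables (n : 'I_d -> nat) (R : nat).
Hypotheses (hR : (0 < R)%N) (hn : forall i, (R ^ 2 <= n i)%N).

Lemma matricizationD (T E : multi_index n -> K) y (a b c e : 'I_d) :
  matricization (fun x => T x + E x) y a b c e =
  matricization T y a b c e + matricization E y a b c e.
Proof. by apply/matrixP => k l; rewrite !mxE. Qed.

Lemma op_leN p q (E : 'M[K]_(p, q)) s : op_le E s -> op_le (- E) s.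
Proof.
by move=> H x y; have := H (- x) y; rewrite enormN mulNmx mulmxN.
Qed.

Lemma R4_le a b : (0 < R ^ 4 <= n a * n b)%N.
Proof. by rewrite expn_gt0 hR (expnD R 2 2) leq_mul. Qed.

Lemma singular_value_perturb_rank p q (M E : 'M[K]_(p, q)) k s : (0 < k <= q)%N ->
  0 <= s -> op_le E s -> (\rank M < k)%N -> singular_value k (M + E) <= s.
Proof.
move=> kq s0 HE rM; have := singular_value_perturb (M + E) kq s0 (op_leN HE).
by rewrite addrK (singular_value_rank kq rM) subr_le0.
Qed.

Lemma cyclic4_reverse (a b c e : nat) : cyclic4 a b c e = cyclic4 a e c b.
Proof.
rewrite /cyclic4.
move: (a < b)%N (b < c)%N (c < e)%N (e < a)%N (b < a)%N (c < b)%N (e < c)%N (a < e)%N.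
by do 8!case.
Qed.

Lemma correct_order_reverse (tau : {perm 'I_d}) a b c e :
  correct_order tau a b c e = correct_order tau a e c b.
Proof. by rewrite !correct_orderE cyclic4_reverse. Qed.

Variables (r : 'I_d -> nat) (tau : {perm 'I_d}) (u : ring_cores K r n tau).
Hypothesis hrmax : (\max_(j < d) r j < R ^ 2)%N.
Variable sigma : K.
Hypothesis hgap : forall (i1 i2 i3 i4 : 'I_d) (y : multi_index n),
  correct_order tau i1 i2 i3 i4 ->
  sigma <= singular_value (R ^ 4) (matricization (tr_tensor u) y i1 i3 i2 i4).

(** The two pairings that do not cross have singular value 0 without noise, so at most s; the
    crossing one stays at least sigma - s > s. The strict gap also excludes ties. *)
Lemma four_index_right (E : multi_index n -> K) (y : multi_index n) (i1 i2 i3 i4 : 'I_d) s :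
  0 <= s -> 2 * s < sigma -> uniq [:: i1; i2; i3; i4] ->
  op_le (matricization E y i1 i2 i3 i4) s ->
  op_le (matricization E y i1 i3 i2 i4) s ->
  op_le (matricization E y i1 i4 i2 i3) s ->
  four_index R (fun x => tr_tensor u x + E x) y i1 i2 i3 i4 = right_answer tau i1 i2 i3 i4.
Proof.
move=> s0 ss U A B C; pose m := (R ^ 2).-1.
have rm j : (r j <= m)%N.
  by rewrite -ltnS prednK ?expn_gt0 ?hR//; apply: leq_ltn_trans hrmax; apply: leq_bigmax.
have mR : (m * m < R ^ 4)%N.
  rewrite (expnD R 2 2); have : (0 < R ^ 2)%N by rewrite expn_gt0 hR.
  by rewrite /m; case: (R ^ 2)%N => // k _ /=; apply: ltn_mul.
have low a b c e : (\rank (matricization (tr_tensor u) y a b c e) <= m * m)%N ->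
    op_le (matricization E y a b c e) s ->
    singular_value (R ^ 4) (matricization (fun x => tr_tensor u x + E x) y a b c e) <= s.
  move=> rk HE; rewrite matricizationD; apply: singular_value_perturb_rank => //; first exact: R4_le.
  exact: leq_ltn_trans mR.
have high a b c e : sigma <= singular_value (R ^ 4) (matricization (tr_tensor u) y a b c e) ->
    op_le (matricization E y a b c e) s ->
    s < singular_value (R ^ 4) (matricization (fun x => tr_tensor u x + E x) y a b c e).
  move=> sv HE; have := singular_value_perturb (matricization (tr_tensor u) y a b c e) (R4_le c e) s0 HE.
  rewrite matricizationD; move: sv; set x := singular_value _ _; set z := singular_value _ _.
  by lra.
have [q0 [q1 [q2 [q3 [E1 _ _]]]]] := right_answer_exists tau U.
move: E1; rewrite /right_answer /four_index.
move: (low i1 i2 i3 i4) (low i1 i3 i2 i4) (low i1 i4 i2 i3)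
      (high i1 i2 i3 i4) (high i1 i3 i2 i4) (high i1 i4 i2 i3).
set a := singular_value _ (matricization (fun x => _ + _) _ _ _ _ _).
set b := singular_value _ (matricization (fun x => _ + _) _ _ _ _ _).
set c := singular_value _ (matricization (fun x => _ + _) _ _ _ _ _).
move=> la lb lc ha hb hc.
case: ifP => [H _|_].
  have [/lb /(_ B) {}lb _] := mxrank_correct_order u rm y H.
  (* Reversal yields the rank bound for the column order i2, i3 used in [four_index]. *)
  have H' : correct_order tau i1 i4 i2 i3 by rewrite correct_order_reverse.
  have [/lc /(_ C) {}lc _] := mxrank_correct_order u rm y H'.
  have {}ha := ha (hgap y H) A.
  by rewrite gt_max (le_lt_trans lb ha) (le_lt_trans lc ha).
case: ifP => [H _|_].
  have [/la /(_ A) {}la /lc /(_ C) {}lc] := mxrank_correct_order u rm y H.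
  have {}hb := hb (hgap y H) B.
  rewrite !gt_max (le_lt_trans la hb) (le_lt_trans lc hb) ifF//.
  by rewrite ltNge (ltW (le_lt_trans la hb)).
case: ifP => [H _|//].
have [_ /lb /(_ B) {}lb] := mxrank_correct_order u rm y H.
have H' : correct_order tau i1 i3 i4 i2 by rewrite correct_order_reverse.
have [_ /la /(_ A) {}la] := mxrank_correct_order u rm y H'.
have {}hc := hc (hgap y H) C.
rewrite !gt_max (le_lt_trans la hc) (le_lt_trans lb hc) ifF ?ifF//.
  by rewrite [c < b]ltNge (ltW (le_lt_trans lb hc)) andbF.
by rewrite [c < a]ltNge (ltW (le_lt_trans la hc)) andbF.
Qed.

End FourIndex.

(** * Measurability of the output *)

Section DiscreteMeasurability.
Context {K : realType} {disp : measure_display} {S : measurableType disp}.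

(** Measurability for the sigma-algebra of all subsets of X, suited to intermediate results such as
    lists and options. *)
Definition discretely_measurable (X : Type) (f : S -> X) : Prop :=
  forall B : set X, measurable (f @^-1` B).

Lemma discretely_measurable_cst (X : Type) (x : X) : discretely_measurable (fun _ => x).
Proof.
move=> B; have [Bx|Bx] := pselect (B x).
  by rewrite (_ : _ @^-1` _ = setT)//; apply/seteqP; split.
by rewrite (_ : _ @^-1` _ = set0)//; apply/seteqP; split.
Qed.

(** Splitting over the countably many values of f handles each branch of an adaptive program
    separately. *)
Lemma discretely_measurable_bind (X : countType) (X' : Type) (f : S -> X) (g : X -> S -> X') :
  discretely_measurable f -> (forall x, discretely_measurable (g x)) ->
  discretely_measurable (fun w => g (f w) w).
Proof.
move=> mf mg B.
rewrite (_ : _ @^-1` _ = \bigcup_x (f @^-1` [set x] `&` g x @^-1` B)); last first.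
  by apply/seteqP; split => w /=; [exists (f w) | case=> x _ [/= <-]].
apply: countable_bigcupT_measurable => // x.
by apply: measurableI; [exact: mf | exact: mg].
Qed.

Lemma discretely_measurable_bool (f : S -> bool) : measurable [set w | f w] ->
  discretely_measurable f.
Proof.
move=> mf B.
rewrite (_ : _ @^-1` _ = ([set w | f w] `&` [set _ | B true]) `|`
  (~` [set w | f w] `&` [set _ | B false])); last first.
  apply/seteqP; split => w /=; case: (f w) => //; first by left.
  - by right.
  - by case=> -[].
  - by case=> -[].
have mc (Q : Prop) : measurable [set _ : S | Q].
  exact: (discretely_measurable_cst Q (fun q => q)).
by apply: measurableU; apply: measurableI => //; exact: measurableC.
Qed.

(** By Weyl's inequality singular values are 1-Lipschitz in the operator norm, which is at most the
    entrywise l1 norm. *)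
Lemma measurable_singular_value m p (k : nat) (X : S -> 'M[K]_(m, p)) : (0 < k <= p)%N ->
  (forall i j, measurable_fun [set: S] (fun w => X w i j)) ->
  measurable_fun [set: S] (fun w => singular_value k (X w)).
Proof.
move=> kp mX; apply: (measurable_lipschitz (c := 1)) => // A B; rewrite mul1r.
have H : op_le (B - A) (l1 (A - B)).
  move=> x y; rewrite -l1N opprB -{1}(trmxK y).
  rewrite /dotr; apply: le_trans (_ : \sum_j \sum_i `|x 0 i| * `|(B - A) i j| * `|y 0 j| <= _).
    apply: ler_sum => j _; rewrite trmxK mxE mulr_suml; apply: ler_sum => i _.
    by rewrite -!normrM ler_norm.
  rewrite /l1 mulr_suml exchange_big /=; apply: ler_sum => i _.
  rewrite mulr_suml; apply: ler_sum => j _.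
  rewrite mulrAC [leRHS]mulrC ler_wpM2r//.
  have coord q (z : 'rV[K]_q) a : `|z 0 a| <= enorm z.
    rewrite -(@ler_pXn2r _ 2) ?nnegrE ?enorm_ge0// enorm_sqr real_normK ?num_real//.
    by rewrite (bigD1 a)//= lerDl sumr_ge0// => b _; exact: sqr_ge0.
  by rewrite ler_pM.
have := singular_value_perturb A kp (l1_ge0 _) H.
by rewrite (addrCA A) subrr addr0 lerBlDr.
Qed.

Variables (d' : nat).
Local Notation d := d'.+1.
Variables (n : 'I_d -> nat) (R : nat).
Hypotheses (hR : (0 < R)%N) (hn : forall i, (R ^ 2 <= n i)%N).

(** The space S is left general: the lemma is used on Omega itself and on Omega with the
    sigma-algebra generated by the noise. *)
Lemma four_index_measurable (W : multi_index n -> S -> K) y (i1 i2 i3 i4 : 'I_d) :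
  (forall x, measurable_fun [set: S] (W x)) ->
  discretely_measurable (fun w => four_index R (fun x => W x w) y i1 i2 i3 i4).
Proof.
move=> mW.
have mM a b c e : measurable_fun [set: S] (fun w =>
    singular_value (R ^ 4) (matricization (fun x => W x w) y a b c e)).
  apply: measurable_singular_value; first exact: R4_le.
  move=> i j; under eq_fun do rewrite mxE.
  exact: mW.
have lt_max (f g h : S -> K) : measurable_fun [set: S] f -> measurable_fun [set: S] g ->
    measurable_fun [set: S] h -> discretely_measurable (fun w => Num.max (g w) (h w) < f w).
  move=> mf mg mh; apply: discretely_measurable_bool.
  rewrite (_ : mkset _ = [set w | 0 < f w - g w] `&` [set w | 0 < f w - h w]).
    by apply: measurableI; apply: measurable_gt; exact: measurable_funB.
  by apply/seteqP; split => w /=; rewrite gt_max !subr_gt0 => /andP.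
rewrite /four_index.
apply: (@discretely_measurable_bind _ _ _
  (fun t w => if t then _ else _) (lt_max _ _ _ (mM _ _ _ _) (mM _ _ _ _) (mM _ _ _ _))) => -[].
  exact: discretely_measurable_cst.
apply: (@discretely_measurable_bind _ _ _
  (fun t w => if t then _ else _) (lt_max _ _ _ (mM _ _ _ _) (mM _ _ _ _) (mM _ _ _ _))) => -[].
  exact: discretely_measurable_cst.
apply: (@discretely_measurable_bind _ _ _
  (fun t w => if t then _ else _) (lt_max _ _ _ (mM _ _ _ _) (mM _ _ _ _) (mM _ _ _ _))) => -[];
  exact: discretely_measurable_cst.
Qed.

Lemma ring_recovery_measurable
    (F : nat -> 'I_d -> 'I_d -> 'I_d -> 'I_d -> S -> option (seq 'I_d)) :
  (forall c a b e f, discretely_measurable (F c a b e f)) ->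
  discretely_measurable (fun w => ring_recovery (fun c a b e f => F c a b e f w)).
Proof.
move=> mF; pose G w c a b e f := F c a b e f w.
have mL t s v fuel c jmin jmax :
    discretely_measurable (fun w => locate (G w) t s v fuel c jmin jmax).
  elim: fuel c jmin jmax => [|fuel IH] c jmin jmax /=;
    case: (jmax - jmin < 2)%N; try exact: discretely_measurable_cst.
  case: (probes t jmin jmax) => -[j1 j2] j3.
  set i := fun j => nth v s j.-1.
  apply: (@discretely_measurable_bind _ _ _ (fun o w => if o is Some q then
    if equiv_tuple q [:: i j1; v; i j2; i j3] then locate (G w) t s v fuel c.+1 j1 j2
    else if equiv_tuple q [:: i j1; i j2; v; i j3] then locate (G w) t s v fuel c.+1 j2 j3
    else locate (G w) t s v fuel c.+1 j3 jmax else None) (mF c v (i j1) (i j2) (i j3))).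
  move=> [q|]; last exact: discretely_measurable_cst.
  by case: equiv_tuple => //; case: equiv_tuple.
have mI st t : discretely_measurable (fun w => insertion_step (G w) st t).
  case: st => [[c s]|] /=; last exact: discretely_measurable_cst.
  apply: (@discretely_measurable_bind _ _ _ (fun o w => if o is Some (c', (jmin, jmax)) then
    Some (c', take jmin s ++ inord t :: drop jmax.-1 s) else None) (mL _ _ _ _ _ _ _)).
  by move=> [[c' [jmin jmax]]|]; exact: discretely_measurable_cst.
have mFold l st : discretely_measurable (fun w => foldl (insertion_step (G w)) st l).
  elim: l st => [|t l IH] st /=; first exact: discretely_measurable_cst.
  exact: (@discretely_measurable_bind _ _ _ (fun st w => foldl (insertion_step (G w)) st l) (mI st t)).
rewrite /ring_recovery.
apply: (@discretely_measurable_bind _ _ _ (fun q w =>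
  if foldl (insertion_step (G w)) (omap (fun q => (1%N, q)) q) (iota 4 (d - 4)) is Some (_, s)
  then [pick t : {perm 'I_d} | [seq t j | j <- enum 'I_d] == s] else None) (mF 0%N _ _ _ _)) => q.
apply: (@discretely_measurable_bind _ _ _ (fun st w => if st is Some (_, s)
  then [pick t : {perm 'I_d} | [seq t j | j <- enum 'I_d] == s] else None) (mFold _ _)).
by move=> [[c s]|]; exact: discretely_measurable_cst.
Qed.

End DiscreteMeasurability.

Lemma index_pair_inj m n : injective (@index_pair m n).
Proof. by move=> k l /enum_val_inj/cast_ord_inj. Qed.

(** Distinct entries of a matricization read distinct observations, so the noise matrix has
    independent entries. *)
Lemma set_coords_inj d' (n : 'I_d'.+1 -> nat) (y : multi_index n) (a b c e : 'I_d'.+1)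
    (xa xa' : 'I_(n a)) (xb xb' : 'I_(n b)) (xc xc' : 'I_(n c)) (xe xe' : 'I_(n e)) :
  uniq [:: a; b; c; e] ->
  set_coords y xa xb xc xe = set_coords y xa' xb' xc' xe' ->
  [/\ xa = xa', xb = xb', xc = xc' & xe = xe'].
Proof.
rewrite /= !inE !negb_or andbT -!andbA => /and5P[ab ac ae bc /andP[be ce]].
move=> /ffunP H; split.
- have := H a; rewrite !set_coordsE.
  by do 3!(rewrite eqtype.dfwith_out; last by rewrite eq_sym); rewrite eqtype.dfwith_in;
     do 3!(rewrite eqtype.dfwith_out; last by rewrite eq_sym); rewrite eqtype.dfwith_in.
- have := H b; rewrite !set_coordsE.
  by do 2!(rewrite eqtype.dfwith_out; last by rewrite eq_sym); rewrite eqtype.dfwith_in;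
     do 2!(rewrite eqtype.dfwith_out; last by rewrite eq_sym); rewrite eqtype.dfwith_in.
- have := H c; rewrite !set_coordsE.
  by rewrite eqtype.dfwith_out 1?eq_sym// eqtype.dfwith_in
     eqtype.dfwith_out 1?eq_sym// eqtype.dfwith_in.
- by have := H e; rewrite !set_coordsE !eqtype.dfwith_in.
Qed.

(** * Failure probability of a call and of the run *)

Section NoisyCall.
Context {K : realType} {disp : measure_display} {Omega : measurableType disp}.
Variable P : probability Omega K.
Variables (d' : nat).
Local Notation d := d'.+1.
Variables (n : 'I_d -> nat) (Z : nat -> multi_index n -> {mfun Omega >-> K}) (s : K).
Hypotheses (n0 : forall i, (0 < n i)%N) (s0 : 0 < s).
Hypothesis Zlaw : forall c x (B : set K), measurable B ->
  P (Z c x @^-1` B) = normal_prob 0 s B.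
Hypothesis Zind : mutually_independent P
  (fun cx : nat * multi_index n => Z cx.1 cx.2 : Omega -> K).

Lemma op_le_trans m p (E : 'M[K]_(m, p)) t t' : t <= t' -> op_le E t -> op_le E t'.
Proof.
move=> tt H x y; apply: le_trans (H x y) _.
by rewrite ler_wpM2r// mulr_ge0 ?enorm_ge0.
Qed.

(** The term 2 n_max bounds the sum of the square roots of the two dimensions, each of which is a
    product of two mode sizes. *)
Lemma noise_matricization_tail k (y : multi_index n) (a b c e : 'I_d) (tau : K) :
  uniq [:: a; b; c; e] -> 0 < tau ->
  exists A : set Omega, [/\ measurable A,
    (P A <= (4 * expR (- (tau ^+ 2 / 2)))%:E)%E &
    forall w, ~ A w -> op_le (matricization (fun x => Z k x w) y a b c e)
      (s * (2 * (\max_(i < d) n i)%:R + tau))].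
Proof.
move=> U tau0.
pose g (kl : 'I_(n a * n b) * 'I_(n c * n e)) : nat * multi_index n :=
  (k, set_coords y (index_pair kl.1).1 (index_pair kl.1).2 (index_pair kl.2).1 (index_pair kl.2).2).
have ginj : injective g.
  move=> [i1 i2] [j1 j2] [/(set_coords_inj U) /= [e1 e2 e3 e4]].
  congr (_, _); apply: index_pair_inj.
    by move: e1 e2; do 2!case: index_pair => ? ?; move=> /= -> ->.
  by move: e3 e4; do 2!case: index_pair => ? ?; move=> /= -> ->.
have M0 : (0 < n a * n b)%N by rewrite muln_gt0 !n0.
have N0 : (0 < n c * n e)%N by rewrite muln_gt0 !n0.
have Gind := mutually_independent_inj ginj Zind.
have [A [mA PA HA]] := @gaussian_op_norm_tail _ _ _ P _ _ (fun kl => Z (g kl).1 (g kl).2)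
  s M0 N0 s0 Gind (fun kl => Zlaw (g kl).1 (g kl).2) tau tau0.
exists A; split=> // w /HA.
rewrite (_ : random_matrix _ w = matricization (fun x => Z k x w) y a b c e); last first.
  by apply/matrixP => i j; rewrite !mxE.
apply: op_le_trans; apply: ler_wpM2l; rewrite ?(ltW s0)// lerD2r mulr_natl mulr2n.
have sqrt_le i j : Num.sqrt (n i * n j)%:R <= (\max_(i < d) n i)%:R :> K.
  rewrite -[leRHS]ger0_norm// -sqrtr_sqr ler_wsqrtr// -natrX ler_nat expnS expn1.
  by apply: leq_mul; apply: leq_bigmax.
by rewrite lerD.
Qed.

End NoisyCall.

Lemma union_bound {K : realType} {disp : measure_display} {Omega : measurableType disp}
    (P : probability Omega K) (I : eqType) (L : seq I) (B : I -> set Omega) (p : K)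
    (S : set Omega) : measurable S ->
  (forall i, i \in L -> measurable (B i) /\ (P (B i) <= p%:E)%E) ->
  (forall w, S w -> exists2 i, i \in L & B i w) ->
  (P S <= ((size L)%:R * p)%:E)%E.
Proof.
elim: L S => [|i L IH] S mS HB SB.
  rewrite mul0r (_ : S = set0) ?measure0//.
  by apply/seteqP; split=> // w /SB[].
have [mi pi] := HB i (mem_head _ _).
have {}HB j : j \in L -> measurable (B j) /\ (P (B j) <= p%:E)%E.
  by move=> jL; apply: HB; rewrite inE jL orbT.
have mD : measurable (S `\` B i) by exact: measurableD.
have {}IH : (P (S `\` B i) <= ((size L)%:R * p)%:E)%E.
  apply: IH => // w [Sw nB]; have [j] := SB w Sw.
  by rewrite inE => /predU1P[->//|jL Bj]; exists j.
apply: (@le_trans _ _ (P (B i `|` (S `\` B i)))).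
  apply: le_measure; rewrite ?inE//; first exact: measurableU.
  by move=> w Sw; have [|] := pselect (B i w); [left | right].
apply: le_trans (measureU2 _ mi mD) _.
by rewrite -[(size _)%:R]/((size L).+1%:R) mulrS mulrDl mul1r EFinD leeD.
Qed.

(* Conditioning on the finitely many values of Y. *)
Lemma independent_mixture {K : realType} {disp : measure_display} {Omega : measurableType disp}
    (P : probability Omega K) (I : finType) (Y : Omega -> I) (B : I -> set Omega) (p : K) :
  (forall y, measurable (Y @^-1` [set y])) -> (forall y, measurable (B y)) ->
  (forall y, P (Y @^-1` [set y] `&` B y) = (P (Y @^-1` [set y]) * P (B y))%E) ->
  (forall y, P (B y) <= p%:E)%E ->
  (P [set w | B (Y w) w] <= p%:E)%E.
Proof.
move=> mY mB YB pB.
have finI : finite_set [set: I] by exact: finite_finset.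
have tY : trivIset [set: I] (fun y => Y @^-1` [set y]).
  by apply/trivIsetP => i j _ _ ij; apply/seteqP; split=> // w [/= -> /eqP]; rewrite (negbTE ij).
have sumY : (\sum_(y \in [set: I]) P (Y @^-1` [set y]) = 1)%E.
  have e : \bigcup_y (Y @^-1` [set y]) = setT.
    by apply/seteqP; split=> // w _; exists (Y w).
  by rewrite -(probability_setT P) -e measure_fin_bigcup// => y _; exact: mY.
rewrite (_ : mkset _ = \bigcup_y (Y @^-1` [set y] `&` B y)); last first.
  by apply/seteqP; split => w /=; [exists (Y w) | case=> y _ [/= <-]].
rewrite measure_fin_bigcup//; last 2 first.
- apply/trivIsetP => i j _ _ ij; move/trivIsetP: tY => /(_ i j Logic.I Logic.I ij) e.
  by rewrite setIACA e set0I.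
- by move=> y _; exact: measurableI.
apply: (@le_trans _ _ (\sum_(y \in [set: I]) (P (Y @^-1` [set y]) * p%:E))%E).
  apply: lee_fsum => // y _.
  by rewrite -[leLHS]/(P (Y @^-1` [set y] `&` B y)) YB lee_wpmul2l.
by rewrite -ge0_mule_fsuml ?sumY ?mul1e.
Qed.

Theorem corollary4p12 (K : realType) :
  exists C : K,
  forall (d' : nat) (hd : (4 <= d'.+1)%N)
    (n r : 'I_d'.+1 -> nat) (tau : {perm 'I_d'.+1})
    (R : nat) (hR : (0 < R)%N)
    (hn : forall i, (R ^ 2 <= n i)%N)
    (hrmax : (\max_(j < d'.+1) r j < R ^ 2)%N)
    (hrmin : forall j, (R <= r j)%N)
    (u : ring_cores K r n tau)
    (sigma : K) (hsigma : 0 < sigma)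
    (hgap : forall (i1 i2 i3 i4 : 'I_d'.+1) (y : multi_index n),
       correct_order tau i1 i2 i3 i4 ->
       sigma <=
         singular_value (R ^ 4) (matricization (tr_tensor u) y i1 i3 i2 i4))
    (sigma_e : K) (hsigma_e : 0 < sigma_e)
    (disp : measure_display) (Omega : measurableType disp)
    (P : probability Omega K)
    (Z : nat -> multi_index n -> {RV P >-> K})
    (hZnormal : forall c x (B : set K), measurable B ->
       distribution P (Z c x) B = normal_prob 0 sigma_e B)
    (hZindep : mutually_independent P
       (fun cx : nat * multi_index n => Z cx.1 cx.2 : Omega -> K))
    (Y : nat -> 4.-tuple 'I_d'.+1 -> Omega -> multi_index n)
    (hYmeas : sigma_of setT
       (fun cq : nat * 4.-tuple 'I_d'.+1 => Y cq.1 cq.2) `<=` measurable)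
    (hYZ : independent_algebras P
       (sigma_of setT (fun cq : nat * 4.-tuple 'I_d'.+1 => Y cq.1 cq.2))
       (sigma_of measurable
          (fun cx : nat * multi_index n => Z cx.1 cx.2 : Omega -> K)))
    (T : K) (hT : T < sigma / sigma_e),
  (P [set w | ~ (exists2 tau' : {perm 'I_d'.+1},
                   noisy_ring_recovery R (tr_tensor u)
                     (fun c x => Z c x w) (fun c q => Y c q w) = Some tau'
                   & tau' \in ring_class tau)]
   <= (C * d'.+1%:R * ln d'.+1%:R *
       expR (- (1 / 8) *
             Num.max (T - 4 * (\max_(i < d'.+1) n i)%:R) 0 ^+ 2))%:E)%E.
Proof.
exists 24 => d' hd n r tau R hR hn hrmax _ u sigma hsigma hgap s s0.
move=> disp Omega P Z hZ hZind Y hY hYZ T hT.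
set d := d'.+1; set nmax := (\max_(i < d) n i)%N.
have n0 i : (0 < n i)%N by apply: leq_trans (hn i); rewrite expn_gt0 hR.
have mZ c x : measurable_fun [set: Omega] (Z c x) by [].
have sY c q B : sigma_of setT (fun cq : nat * 4.-tuple 'I_d => Y cq.1 cq.2) (Y c q @^-1` B).
  by apply: sub_sigma_algebra; exists (c, q); exists B.
pose F w c i1 i2 i3 i4 := four_index R (fun x => tr_tensor u x + Z c x w)
  (Y c [tuple i1; i2; i3; i4] w) i1 i2 i3 i4.
have mF c a b e f : discretely_measurable (fun w => F w c a b e f).
  apply: (@discretely_measurable_bind _ _ _ _ (Y c [tuple a; b; e; f])
    (fun y w => four_index R (fun x => tr_tensor u x + Z c x w) y a b e f)).
    by move=> B; apply: hY; exact: sY.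
  move=> y; apply: (four_index_measurable hR hn (W := fun x w => tr_tensor u x + Z c x w)) => x.
  exact: measurable_funD.
have mS : measurable [set w | ~ (exists2 tau' : {perm 'I_d},
    ring_recovery (F w) = Some tau' & tau' \in ring_class tau)].
  exact: (ring_recovery_measurable (F := fun c a b e f w => F w c a b e f) mF
    [set o | ~ (exists2 tau' : {perm 'I_d}, o = Some tau' & tau' \in ring_class tau)]).
(* With d >= 4, this makes the claimed bound at least 1 when T <= 4 n_max. *)
have lnd : 1 <= ln d%:R :> K.
  have : (2 <= trunc_log 2 d)%N by apply: (@leq_trunc_log 2 4 d).
  rewrite -(ler_nat K) => h; have := @trunc_log_le_ln K d isT; lra.
have d4 : 4 <= d%:R :> K by rewrite ler_nat.
have [TN|NT] := leP T (4 * nmax%:R).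
  rewrite (_ : Num.max _ 0 = 0); last by apply/max_idPr; rewrite subr_le0.
  rewrite expr0n /= mulr0 expR0 mulr1; apply: le_trans (probability_le1 P mS) _.
  by rewrite lee_fin; nra.
(* Then t^2 / 2 = (T - 4 n_max)^2 / 8, and twice the norm bound s (2 n_max + t) is T s < sigma,
   where s is the standard deviation of the noise. *)
pose t := T / 2 - 2 * nmax%:R; have t0 : 0 < t by rewrite /t; lra.
have [L [tau' [Ls Lu tauC LF]]] := ring_recovery_correct tau hd.
(* Three noise matrices per call, each failing with probability at most 4 exp (- t^2 / 2). *)
pose p : K := 12 * expR (- (t ^+ 2 / 2)).
have p0 : 0 <= p by rewrite mulr_ge0 ?expR_ge0.
apply: (@le_trans _ _ ((size L)%:R * p)%:E); last first.
  rewrite lee_fin (_ : Num.max _ 0 = T - 4 * nmax%:R); last by apply/max_idPl; rewrite subr_ge0 ltW.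
  rewrite (_ : - (1 / 8) * _ = - (t ^+ 2 / 2)); last by rewrite /t; field.
  rewrite (_ : 24 * _ * _ * _ = d%:R * (2 * ln d%:R) * p); last by rewrite /p; ring.
  rewrite ler_wpM2r//; apply: (@le_trans _ _ (d * trunc_log 2 d)%:R); first by rewrite ler_nat.
  by rewrite natrM ler_wpM2l// trunc_log_le_ln.
(* The algorithm is adaptive, but L depends on tau alone: a run that fails must have a wrong answer
   to some call of this fixed list. *)
apply: (union_bound (B := fun x => [set w | ~ answers_right tau (F w) x])) => //; last first.
  move=> w nw; apply: contrapT => H; apply: nw; exists tau' => //.
  by apply: LF => x xL; apply: contrapT => nx; apply: H; exists x.
move=> [c q] /Lu /= Uq; rewrite /answers_right /=.
have {Uq} : uniq [:: tnth q (inord 0); tnth q (inord 1); tnth q (inord 2); tnth q (inord 3)].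
  case: q Uq => -[|x0 [|x1 [|x2 [|x3 [|]]]]] // sz /=.
  by rewrite !(tnth_nth x0) /= !inordK.
move: (tnth q (inord 0)) (tnth q (inord 1)) (tnth q (inord 2)) (tnth q (inord 3)) => a b e f U {q}.
split; first exact: (mF c a b e f [set o | ~ o = right_answer tau a b e f]).
(* With the sampled coordinates frozen at y, failure depends on the noise alone, so it is
   independent of the event that y is sampled. *)
pose B y := [set w | four_index R (fun x => tr_tensor u x + Z c x w) y a b e f
  <> right_answer tau a b e f].
have mB y : measurable (B y).
  apply: (four_index_measurable hR hn (W := fun x w => tr_tensor u x + Z c x w) y a b e f _
    [set o | o <> right_answer tau a b e f]) => x.
  exact: measurable_funD.
have sB y : sigma_of measurable (fun cx : nat * multi_index n => Z cx.1 cx.2 : Omega -> K) (B y).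
  pose G := [set A | exists cx : nat * multi_index n, exists2 B0 : set K, measurable B0 &
    A = (Z cx.1 cx.2 : Omega -> K) @^-1` B0].
  (* Measurability with respect to the sigma-algebra of the noise is what the independence
     hypothesis requires. *)
  apply: (@four_index_measurable K _ (g_sigma_algebraType G) d' n R hR hn
    (fun x w => tr_tensor u x + Z c x w) y a b e f _ [set o | o <> right_answer tau a b e f]) => x.
  apply: measurable_funD => // _ B0 mB0; rewrite setTI; apply: sub_sigma_algebra.
  by exists (c, x), B0.
apply: (independent_mixture (Y := Y c [tuple a; b; e; f]) (B := B)) => // y.
- by apply: hY; exact: sY.
- by apply: hYZ; [exact: sY | exact: sB].
have [A1 [mA1 PA1 HA1]] := noise_matricization_tail n0 s0 hZ hZind c y U t0.
have U2 : uniq [:: a; e; b; f].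
  move: U; rewrite /= !inE !negb_or !andbT -!andbA => /and5P[h1 h2 h3 h4 /andP[h5 h6]].
  by rewrite (eq_sym e b) h1 h2 h3 h4 h5 h6.
have [A2 [mA2 PA2 HA2]] := noise_matricization_tail n0 s0 hZ hZind c y U2 t0.
have U3 : uniq [:: a; f; b; e].
  move: U; rewrite /= !inE !negb_or !andbT -!andbA => /and5P[h1 h2 h3 h4 /andP[h5 h6]].
  by rewrite !(eq_sym f) h1 h2 h3 h4 h5 h6.
have [A3 [mA3 PA3 HA3]] := noise_matricization_tail n0 s0 hZ hZind c y U3 t0.
have st0 : 0 <= s * (2 * nmax%:R + t) by rewrite mulr_ge0 ?(ltW s0)// addr_ge0 ?mulr_ge0// ltW.
have st : 2 * (s * (2 * nmax%:R + t)) < sigma.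
  by rewrite (_ : 2 * _ = T * s) -?ltr_pdivlMr// /t; field.
apply: (@le_trans _ _ (P (A1 `|` A2 `|` A3))).
  apply: le_measure; rewrite ?inE//; first by do 2?apply: measurableU.
  move=> w Bw; apply: contrapT => nA; apply: Bw.
  by apply: (four_index_right hR hn hrmax hgap st0 st U);
     [apply: HA1 | apply: HA2 | apply: HA3] => Aw; apply: nA; [left; left | left; right | right].
apply: le_trans (measureU2 _ _ _) _ => //; first exact: measurableU.
rewrite (_ : p = 4 * expR (- (t ^+ 2 / 2)) + 4 * expR (- (t ^+ 2 / 2)) + 4 * expR (- (t ^+ 2 / 2)));
  last by rewrite /p; ring.
rewrite !EFinD leeD//; apply: le_trans (measureU2 _ _ _) _ => //.
exact: leeD.
Qed.
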